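(* For $\mu>0$ let $\varphi_\mu:=f_1+\mu f_2$ and $\gamma(\mu):=\operatorname{arg\,min}_{x\in\mathcal{M}}\varphi_\mu(x)$. Assume that: $\mathcal{M}$ is a smooth and compact Riemannian manifold; $f_1,f_2:\mathcal{M}\to\mathbb{R}$ are twice continuously differentiable; for every $\mu>0$, $\gamma(\mu)$ is a singleton; and for every $\mu>0$, the Riemannian Hessian $\operatorname{Hess}\varphi_\mu(\gamma(\mu))$ is invertible on $T_{\gamma(\mu)}\mathcal{M}$. Let $0<\mu_{\min}<\mu_{\max}$. Then there exist $\delta>0$, $\eta_0>0$ and a constant $C>0$ such that the following holds for every partition $\mu_{\min}=\mu_0<\mu_1<\cdots<\mu_N=\mu_{\max}$ with $\Delta_{\max}:=\max_{0\le i\le N-1}(\mu_{i+1}-\mu_i)\le\delta$ and every $\eta\in[0,\eta_0]$ (so $C$ is independent of the partition, of $\Delta_{\max}$ and of $\eta$). For each $i\in\{0,\dots,N-1\}$ let $I_i:=[\mu_i,\mu_{i+1}]$, $q_i:=\gamma(\mu_{i+1})$ and $\Gamma_i(\mu):=\operatorname{Log}_{q_i}(\gamma(\mu))$, $\mu\in I_i$. Let $\widehat v_i^L,\widehat v_i^R\in T_{q_i}\mathcal{M}$ be endpoint tangent data satisfying $$\|\widehat v_i^L-\dot\Gamma_i(\mu_i)\|_{q_i}\le\eta,\qquad \|\widehat v_i^R-\dot\Gamma_i(\mu_{i+1})\|_{q_i}\le\eta,$$ let $\tilde\Gamma_i:I_i\to T_{q_i}\mathcal{M}$ be the cubic Hermite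 interpolant with endpoint values $\Gamma_i(\mu_i)$, $\Gamma_i(\mu_{i+1})=0$ and endpoint derivatives $\widehat v_i^L$, $\widehat v_i^R$, let $\tilde\gamma_i(\mu):=\operatorname{Exp}_{q_i}(\tilde\Gamma_i(\mu))$, and let $\tilde\gamma:[\mu_{\min},\mu_{\max}]\to\mathcal{M}$ be the concatenation of the $\tilde\gamma_i$. Define $$\omega(t):=\max_{0\le i\le N-1}\ \sup_{\substack{\mu,\nu\in I_i\\ |\mu-\nu|\le t}}\|\dot\Gamma_i(\mu)-\dot\Gamma_i(\nu)\|_{q_i}.$$ Then $$\sup_{\mu\in[\mu_{\min},\mu_{\max}]}\operatorname{dist}\bigl(\gamma(\mu),\tilde\gamma(\mu)\bigr)\le C\bigl[\Delta_{\max}\,\omega(\Delta_{\max})+\eta\,\Delta_{\max}\bigr].$$ In particular, if the exact endpoint velocities are used, i.e. $\eta=0$, then $$\sup_{\mu\in[\mu_{\min},\mu_{\max}]}\operatorname{dist}\bigl(\gamma(\mu),\tilde\gamma(\mu)\bigr)\le C\,\Delta_{\max}\,\omega(\Delta_{\max}).$$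
   Context: When the set of global minimizers $\gamma(\mu)$ is a singleton, it is identified with its unique element. $\operatorname{dist}$ is the Riemannian distance, $\|\cdot\|_q$ the norm on $T_q\mathcal{M}$ induced by the metric, and $\operatorname{Hess}$ the Riemannian Hessian, a linear operator on the tangent space. $\operatorname{Exp}_q:T_q\mathcal{M}\to\mathcal{M}$ is the Riemannian exponential map; $\mathcal{I}_q$ denotes the interior set of $q$ (the complement of the cut locus of $q$) and $\mathcal{I}_q^T\subset T_q\mathcal{M}$ the corresponding tangent interior set (the open star-shaped domain bounded by the tangent cut locus), which $\operatorname{Exp}_q$ maps diffeomorphically onto $\mathcal{I}_q$. For $y\in\mathcal{I}_q$, $\operatorname{Log}_q(y)$ is the unique $\xi\in\mathcal{I}_q^T$ with $\operatorname{Exp}_q(\xi)=y$. Under the stated hypotheses $\gamma$ is $C^1$ and, for all sufficiently fine partitions (which is part of the meaning of $\Delta_{\max}\le\delta$), $\gamma(I_i)\subset\mathcal{I}_{q_i}$ and $\Gamma_i\in C^1(I_i,T_{q_i}\mathcal{M})$ for every $i$, so all the objects are well defined. The cubic Hermite interpolant on $[a,b]$ with $h=b-a$, endpoint values $y_a,y_b$ and endpoint derivatives $v_a,v_b$ in a vector space is $\mu\mapsto h_{00}(\theta)y_a+h\,h_{10}(\theta)v_a+h_{01}(\theta)y_b+h\,h_{11}(\theta)v_b$ with $\theta=(\mu-a)/h$, $h_{00}(\theta)=2\theta^3-3\theta^2+1$, $h_{10}(\theta)=\theta^3-2\theta^2+\theta$, $h_{01}(\theta)=-2\theta^3+3\theta^2$,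 $h_{11}(\theta)=\theta^3-\theta^2$. At each node $\mu_i$ the adjacent pieces $\tilde\gamma_{i-1},\tilde\gamma_i$ both take the value $\gamma(\mu_i)$, so the concatenation $\tilde\gamma$ (equal to $\tilde\gamma_i$ on $I_i$) is well defined. *)

(* Defs.v *)
From HB Require Import structures.
From mathcomp Require Export all_boot all_order all_algebra.
From mathcomp Require Export all_classical all_reals all_analysis.
Export Order.TTheory GRing.Theory Num.Theory.
Export numFieldNormedType.Exports.
Set Implicit Arguments.
Unset Strict Implicit.
Unset Printing Implicit Defensive.
Local Open Scope classical_set_scope.
Local Open Scope ring_scope.

(* C^k on an open set, through iterated directional derivatives; for
   finite-dimensional V and W this is the usual notion. *)
Fixpoint Ck_on (R : realType) (V W : normedModType R) (k : nat) (U : set V)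
    (f : V -> W) : Prop :=
  match k with
  | 0 => forall x, U x -> {for x, continuous f}
  | k'.+1 => (forall x, U x -> differentiable f x) /\
             (forall v : V, Ck_on k' U (fun x => 'D_v f x : W))
  end.

(* Derivative relative to A: at an end point of a closed interval A it is the
   one-sided derivative. *)
Definition derivable_within (R : realType) (W : normedModType R) (A : set R)
    (f : R -> W) (t : R) : Prop :=
  cvg ((fun s => (s - t)^-1 *: (f s - f t)) @ within A t^').

Definition derive_within (R : realType) (W : normedModType R) (A : set R)
    (f : R -> W) (t : R) : W :=
  lim ((fun s => (s - t)^-1 *: (f s - f t)) @ within A t^').

Definition C1_within (R : realType) (W : normedModType R) (A : set R)
    (f : R -> W) (t : R) : Prop :=
  derivable_within A f t /\
  derive_within A f s @[s --> within A (nbhs t)] --> derive_within A f t.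

(* A smooth Riemannian manifold without boundary of dimension n, not assumed
   connected.  [chart] indexes a smooth atlas, [coord c] and [para c] are
   mutually inverse homeomorphisms between [dom c] and [cod c], and [gram c] is
   the matrix of the metric in the chart c.  Outside [dom c], [cod c] the values
   are irrelevant.  The tangent space at q is modelled by 'rV_n: a tangent
   vector at q is given by its components in the chart [chart_at q]. *)
Record riemannian_manifold (R : realType) (n : nat) (M : topologicalType) :=
  RiemannianManifold {
  chart : Type;
  dom : chart -> set M;
  coord : chart -> M -> 'rV[R]_n;
  para : chart -> 'rV[R]_n -> M;
  chart_at : M -> chart;
  gram : chart -> 'rV[R]_n -> 'M[R]_n;
  cod := fun c : chart => coord c @` dom c;
  overlap := fun c d : chart => [set x | cod c x /\ dom d (para c x)];
  rm_hausdorff : hausdorff_space M;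
  rm_second_countable : @second_countable M;
  chart_atP : forall q, dom (chart_at q) q;
  dom_open : forall c, open (dom c);
  cod_open : forall c, open (cod c);
  coordK : forall c q, dom c q -> para c (coord c q) = q;
  coord_continuous : forall c q, dom c q -> {for q, continuous (coord c)};
  para_continuous : forall c x, cod c x -> {for x, continuous (para c)};
  transition_smooth : forall (c d : chart) (k : nat),
    Ck_on k (overlap c d) (coord d \o para c);
  gram_smooth : forall (c : chart) (k : nat), Ck_on k (cod c) (gram c);
  gram_sym : forall c x, cod c x -> (gram c x)^T = gram c x;
  gram_pos : forall c x (v : 'rV[R]_n), cod c x -> v != 0 ->
    0 < (v *m gram c x *m v^T) 0 0;
  gram_transition : forall c d x (u v : 'rV[R]_n), overlap c d x ->
    let tau := coord d \o para c in
    u *m gram c x *m v^T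
      = ('D_u tau x : 'rV[R]_n) *m gram d (tau x) *m ('D_v tau x : 'rV[R]_n)^T
}.

Section Riemannian.
Context {R : realType} {n : nat} {M : topologicalType}.
Variable X : riemannian_manifold R n M.
Implicit Types (q : M) (u v x : 'rV[R]_n) (c : chart X).

Definition C2_on_manifold (f : M -> R) : Prop :=
  forall c, Ck_on 2 (cod c) (f \o para c).

Definition tnorm q v : R :=
  Num.sqrt ((v *m gram (chart_at X q) (coord (chart_at X q) q) *m v^T) 0 0).

Definition dgram c x (i j l : 'I_n) : R :=
  'D_(delta_mx 0 i : 'rV[R]_n) (fun y => gram c y j l : R) x.

Definition christoffel c x (k i j : 'I_n) : R :=
  2^-1 * \sum_(l < n) invmx (gram c x) k l *
    (dgram c x i j l + dgram c x j i l - dgram c x l i j).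

(* Correction term of the Levi-Civita connection in coordinates. *)
Definition connection_term c x u v : 'rV[R]_n :=
  \row_k \sum_(i < n) \sum_(j < n) christoffel c x k i j * u 0 i * v 0 j.

Definition gradient c (f : M -> R) x : 'rV[R]_n :=
  \row_k \sum_(l < n) invmx (gram c x) k l *
    ('D_(delta_mx 0 l : 'rV[R]_n) (f \o para c : 'rV[R]_n -> R) x : R).

(* Hess f(q)[v] is the covariant derivative of grad f at q along v. *)
Definition hessian (f : M -> R) q v : 'rV[R]_n :=
  let c := chart_at X q in
  let x := coord c q in
  'D_v (gradient c f) x + connection_term c x v (gradient c f x).

Definition geodesic_on (A : set R) (g : R -> M) : Prop :=
  forall t, A t -> {for t, continuous g} /\
    forall c, dom c (g t) ->
      let x : R -> 'rV[R]_n := coord c \o g in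
      let x' : R -> 'rV[R]_n := derive1 x in
      [/\ derivable x t 1, derivable x' t 1 &
          (derive1 x' t : 'rV[R]_n) + connection_term c (x t) (x' t) (x' t) = 0].

(* The default value q is irrelevant when geodesics exist for all times. *)
Definition Exp q v : M :=
  xget q [set y | exists (g : R -> M) (e : R),
    [/\ 0 < e, geodesic_on `](- e), (1 + e)[ g, g 0 = q,
        derive1 (coord (chart_at X q) \o g) 0 = v & g 1 = y]].

Definition is_partition (a b : R) (N : nat) (p : nat -> R) : Prop :=
  [/\ p 0%N = a, p N = b & forall i, (i < N)%N -> p i < p i.+1].

Definition C1_curve_on (A : set R) (g : R -> M) : Prop :=
  {within A, continuous g} /\
  forall t c, A t -> dom c (g t) -> C1_within A (coord c \o g) t.

Definition speed_within (A : set R) (g : R -> M) (t : R) : R :=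
  tnorm (g t) (derive_within A (coord (chart_at X (g t)) \o g) t).

(* Infimum of the lengths of the piecewise C^1 curves on [0,1] from y to z; it
   is +oo when y and z lie in different components. *)
Definition dist (y z : M) : \bar R :=
  ereal_inf [set l | exists (g : R -> M) (N : nat) (p : nat -> R),
    [/\ is_partition 0 1 N p, g 0 = y, g 1 = z,
        forall i, (i < N)%N -> C1_curve_on `[p i, p i.+1] g &
        l = (\sum_(i < N) \int[lebesgue_measure]_(t in `[p i, p i.+1])
               (speed_within `[p i, p i.+1] g t)%:E)%E]].

(* Supremum of the t such that s |-> Exp_q(s v) is minimizing on [0,t]; v need
   not be a unit vector, and the value at v = 0 is +oo. *)
Definition cut_time q v : \bar R :=
  ereal_sup [set t%:E | t in
    [set t : R | 0 <= t /\ dist q (Exp q (t *: v)) = (t * tnorm q v)%:E]].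

Definition tangent_cut_locus q : set 'rV[R]_n := [set v | cut_time q v = 1%:E].

Definition cut_locus q : set M := Exp q @` tangent_cut_locus q.

Definition tangent_interior_set q : set 'rV[R]_n :=
  [set v | (1%:E < cut_time q v)%E].

Definition interior_set q : set M := ~` cut_locus q.

Definition log_set q y : set 'rV[R]_n :=
  [set xi | tangent_interior_set q xi /\ Exp q xi = y].

Definition Log q y : 'rV[R]_n := xget 0 (log_set q y).

End Riemannian.

Definition argmin_set (R : realType) (M : Type) (f : M -> R) : set M :=
  [set x | forall y, f x <= f y].

Definition hermite (R : realType) (V : lmodType R) (a b : R)
    (ya yb va vb : V) (mu : R) : V :=
  let h := b - a in
  let th := (mu - a) / h in
  (2 * th ^+ 3 - 3 * th ^+ 2 + 1) *: ya
  + (h * (th ^+ 3 - 2 * th ^+ 2 + th)) *: va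
  + (- 2 * th ^+ 3 + 3 * th ^+ 2) *: yb
  + (h * (th ^+ 3 - th ^+ 2)) *: vb.

Definition mesh (R : realType) (N : nat) (p : nat -> R) : R :=
  \big[Num.max/0]_(i < N) (p i.+1 - p i).

(* Pieces F i on [p i, p i.+1]; at an interior node the left piece is used. *)
Definition concatenation (R : realType) (M : Type) (N : nat) (p : nat -> R)
    (F : nat -> R -> M) (mu : R) : M :=
  F (find (fun i => mu <= p i.+1) (iota 0 N)) mu.

Section SolutionPath.
Context {R : realType} {n : nat} {M : topologicalType}.
Variable X : riemannian_manifold R n M.
Variables (gamma : R -> M) (p : nat -> R).

Definition node_interval (i : nat) : set R := `[p i, p i.+1].

Definition base_point (i : nat) : M := gamma (p i.+1).

Definition lifted (i : nat) (mu : R) : 'rV[R]_n :=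
  Log X (base_point i) (gamma mu).

Definition lifted_velocity (i : nat) (mu : R) : 'rV[R]_n :=
  derive_within (node_interval i) (lifted i) mu.

Definition interpolant_piece (vL vR : nat -> 'rV[R]_n) (i : nat) (mu : R) : M :=
  Exp X (base_point i)
    (hermite (p i) (p i.+1) (lifted i (p i)) (lifted i (p i.+1)) (vL i) (vR i) mu).

Definition interpolant (N : nat) (vL vR : nat -> 'rV[R]_n) : R -> M :=
  concatenation N p (interpolant_piece vL vR).

Definition velocity_modulus (N : nat) (t : R) : \bar R :=
  \big[maxe/-oo%E]_(i < N) ereal_sup [set e | exists mu nu : R,
    [/\ node_interval i mu, node_interval i nu, `|mu - nu| <= t &
        e = (tnorm X (base_point i)
               (lifted_velocity i mu - lifted_velocity i nu))%:E]].

Definition sup_error (a b : R) (g : R -> M) : \bar R :=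
  ereal_sup [set dist X (gamma mu) (g mu) | mu in `[a, b]].

End SolutionPath.

(* Main.v *)
Require Import Defs.
From mathcomp Require Import ring lra.

(** On one interval [[a, b]] of the partition, of length [h], put [q = gamma b] and
let [W] be the lifted curve [Log_q o gamma].  With [u = W' a], both [W] and its
Hermite interpolant differ from [W a + (mu - a) *: u] by at most a multiple of
[h * (omega + eta)]: the former by the mean value inequality, the latter since
its weights reproduce affine functions ([hermite_error]).  As [Exp_q] is
Lipschitz near [0], the distance in [M] obeys the same bound.  The rest of the
proof shows that the lift is well defined and of class C^1, with constants
that do not depend on the interval.

The curve [gamma] is of class C^1.  It is continuous because [M] is compact and
the minimizers are unique ([gamma_cont]).  In a chart it solves the equation
'differential of the objective = 0', whose derivative in the space variable is
the matrix of second derivatives; at a critical point this matrix represents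
the Hessian, hence is invertible ([gamma_hess_unit]), and [gamma] can be
differentiated implicitly ([gamma_curve]).

The exponential map.  The geodesic equation is a first-order system whose right
side has a Lipschitz derivative.  Its flow and the solution of the linearised
system, both obtained by Picard iteration ([flow_exists]), show that in a chart
[Exp_q] is a map near the identity, with a derivative and constants uniform in
[q], and satisfies the Gauss lemma ([chart_exp]).  Inverting it along [gamma]
gives the C^1 lift ([lift_local]).

The logarithm.  That small vectors are the only logarithms of their images, and
that these images avoid the cut locus, requires the distance itself, which is
an infimum of lengths.  The Gauss lemma makes the radius a calibration, so that
[dist q (Exp q v)] is the norm of [v] for small [v] ([dist_Exp_ge]), on a ball
of uniform size ([normal_radius_unif]).  If a geodesic with another initial
velocity [w] reaches the same point [Exp q xi] and is minimizing almost up to it or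
beyond it, the detour through [xi] shows that [w] is no longer than [xi]
([exp_detour]); then [w] lies in the small ball, where [Exp_q] is injective
and no vector is in the tangent cut locus ([log_set_small], [interior_small]).

Uniformity.  All local statements are made with constants that survive small
changes of the base point, and compactness of [M] and of the parameter interval
makes them global ([compact_unif], [lift_uniform]). *)

Set Implicit Arguments.
Unset Strict Implicit.
Unset Printing Implicit Defensive.
Local Open Scope classical_set_scope.
Local Open Scope ring_scope.

(** * Vector identities by reflection *)

Section VectorIdentities.
Context {R : realType} {V : lmodType R}.

(** Two linear combinations of vectors are equal as soon as the coefficients
    of each atom agree, which is an identity between scalars. *)
Inductive vexpr :=
  VAtom of nat | VZero | VAdd of vexpr & vexpr | VOpp of vexpr | VScale of R & vexpr.

Fixpoint veval (l : seq V) (e : vexpr) : V :=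
  match e with
  | VAtom i => nth 0 l i
  | VZero => 0
  | VAdd a b => veval l a + veval l b
  | VOpp a => - veval l a
  | VScale k a => k *: veval l a
  end.

Fixpoint vcoef (e : vexpr) (i : nat) : R :=
  match e with
  | VAtom j => if eqn i j then 1 else 0
  | VZero => 0
  | VAdd a b => vcoef a i + vcoef b i
  | VOpp a => - vcoef a i
  | VScale k a => k * vcoef a i
  end.

Fixpoint vwf (n : nat) (e : vexpr) : bool :=
  match e with
  | VAtom j => (j < n)%N
  | VZero => true
  | VAdd a b => vwf n a && vwf n b
  | VOpp a => vwf n a
  | VScale k a => vwf n a
  end.

Fixpoint vagree (n : nat) (a b : vexpr) : Prop :=
  if n is m.+1 then vcoef a m = vcoef b m /\ vagree m a b else True.

Lemma vevalE (l : seq V) (e : vexpr) : vwf (size l) e ->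
  veval l e = \sum_(i < size l) vcoef e i *: l`_i.
Proof.
elim: e => [j|_|a IHa b IHb|a IHa|k a IHa] /=.
- move=> jl; rewrite (bigD1 (Ordinal jl))//= [X in X *: _](_ : _ = 1); last first.
    by rewrite eqnE eqxx.
  rewrite scale1r big1 ?addr0// => i ij; rewrite [X in X *: _](_ : _ = 0) ?scale0r//.
  by rewrite eqnE; move: ij; rewrite -val_eqE /= => /negPf ->.
- by rewrite big1// => i _; rewrite scale0r.
- move=> /andP[/IHa-> /IHb->]; rewrite -big_split; apply: eq_bigr => i _.
  by rewrite scalerDl.
- by move=> /IHa->; rewrite -sumrN; apply: eq_bigr => i _; rewrite scaleNr.
- by move=> /IHa->; rewrite scaler_sumr; apply: eq_bigr => i _; rewrite scalerA.
Qed.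

Lemma vexpr_eq (l : seq V) (a b : vexpr) :
  vwf (size l) a && vwf (size l) b -> vagree (size l) a b -> veval l a = veval l b.
Proof.
move=> /andP[wa wb] ab; rewrite !vevalE//; apply: eq_bigr => -[i i_lt] _ /=.
congr (_ *: _); elim: (size l) ab i_lt => [|n IH] //= [abn ab].
by rewrite ltnS leq_eqVlt => /orP[/eqP->|/(IH ab)].
Qed.
End VectorIdentities.

Ltac vmember x l :=
  lazymatch l with
  | nil => constr:(false)
  | cons x _ => constr:(true)
  | cons _ ?l' => vmember x l'
  end.
Ltac vindex x l :=
  lazymatch l with
  | cons x _ => constr:(0%N)
  | cons _ ?l' => let n := vindex x l' in constr:(S n)
  end.
Ltac vatoms l e :=
  lazymatch e with
  | (0)%R => l
  | (?a + ?b)%R => let l' := vatoms l a in vatoms l' b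
  | (- ?a)%R => vatoms l a
  | (_ *: ?a)%R => vatoms l a
  | _ => lazymatch vmember e l with true => l | false => constr:(cons e l) end
  end.
Ltac vreify R l e :=
  lazymatch e with
  | (0)%R => constr:(@VZero R)
  | (?a + ?b)%R => let a' := vreify R l a in let b' := vreify R l b in constr:(VAdd a' b')
  | (- ?a)%R => let a' := vreify R l a in constr:(VOpp a')
  | (?k *: ?a)%R => let a' := vreify R l a in constr:(@VScale R k a')
  | _ => let n := vindex e l in constr:(@VAtom R n)
  end.
Ltac vlinear R :=
  lazymatch goal with
  | |- @eq ?T ?a ?b =>
    let l0 := vatoms (@nil T) a in
    let l := vatoms l0 b in
    let a' := vreify R l a in
    let b' := vreify R l b in
    refine (@vexpr_eq R _ l a' b' isT _); cbn;
    repeat (split; [ring|]); exact I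
  end.

(** * Derivatives of curves and the mean value inequality *)

Section Curves.
Context {R : realType}.

(** The derivative of a curve relative to [A], in epsilon form: the point [s =
    t] needs no separate treatment, and at an end point of an interval the
    derivative is one-sided. *)
Definition hasd (W : normedModType R) (A : set R) (f : R -> W) (t : R) (l : W) :=
  forall e : R, 0 < e -> \forall s \near t, A s ->
    `|f s - f t - (s - t) *: l| <= e * `|s - t|.

Definition lin (V W : normedModType R) (L : V -> W) :=
  forall (a : R) u v, L (a *: u + v) = a *: L u + L v.

(** Frechet differentiability with the derivative as a datum, so that the
    chain rules compute it. *)
Definition hasD (V W : normedModType R) (f : V -> W) (x : V) (L : V -> W) :=
  [/\ lin L, exists2 C : R, 0 <= C & forall h, `|L h| <= C * `|h| &
  forall e : R, 0 < e -> \forall y \near x, `|f y - f x - L (y - x)| <= e * `|y - x|].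

Section lin.
Variables (V W : normedModType R) (L : V -> W).
Hypothesis linL : lin L.
Lemma lin0 : L 0 = 0.
Proof.
have := linL (-1) 0 0; rewrite scaler0 addr0 => {1}->.
by rewrite scaleN1r addNr.
Qed.
Lemma linD u v : L (u + v) = L u + L v.
Proof. by have := linL 1 u v; rewrite !scale1r. Qed.
Lemma linZ a u : L (a *: u) = a *: L u.
Proof. by have := linL a u 0; rewrite !addr0 lin0 addr0. Qed.
Lemma linN u : L (- u) = - L u.
Proof. by rewrite -scaleN1r linZ scaleN1r. Qed.
Lemma linB u v : L (u - v) = L u - L v.
Proof. by rewrite linD linN. Qed.
Lemma lin_sum n (f : 'I_n -> V) : L (\sum_i f i) = \sum_i L (f i).
Proof.
elim/big_ind2 : _ => [|x y u v <- <-|//]; first exact: lin0.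
exact: linD.
Qed.
End lin.

Lemma hasd_near (W : normedModType R) (A : set R) (f g : R -> W) t l :
  A t -> (\forall s \near t, A s -> f s = g s) -> hasd A f t l -> hasd A g t l.
Proof.
move=> At fg H e e0; move: (H _ e0).
have <- : f t = g t by move: fg => /nbhs_singleton; apply.
by apply: filterS2 fg => s E + As => /(_ As); rewrite E.
Qed.

Lemma hasd_ext (W : normedModType R) (A : set R) (f g : R -> W) t l :
  (forall s, f s = g s) -> hasd A f t l -> hasd A g t l.
Proof. by move=> fg; have -> : f = g by apply/funext. Qed.

Lemma hasd_sub (W : normedModType R) (A B : set R) (f : R -> W) t l :
  B `<=` A -> hasd A f t l -> hasd B f t l.
Proof.
move=> BA H e e0; move: (H _ e0).
by apply: filterS => s + Bs => /(_ (BA _ Bs)).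
Qed.

Lemma near_dist (V : normedModType R) (x : V) (d : R) : 0 < d -> \forall y \near x, `|y - x| < d.
Proof.
move=> d0; near=> y; rewrite distrC; near: y.
by have := @cvg_id _ (nbhs x); move/cvgrPdist_lt; exact.
Unshelve. all: by end_near. Qed.

Lemma near_distP (V : normedModType R) (x : V) (P : set V) :
  (\forall y \near x, P y) <-> exists2 d : R, 0 < d & forall y, `|y - x| < d -> P y.
Proof.
split.
  move=> /nbhs_ballP [d d0 H]; exists d => // y yx; apply: H.
  by rewrite -ball_normE /= distrC.
move=> [d d0 H]; apply: filterS (near_dist x d0) => y; exact: H.
Qed.

Lemma near_ord (V : normedModType R) (x : V) n (P : 'I_n -> V -> Prop) :
  (forall i, \forall y \near x, P i y) -> \forall y \near x, forall i, P i y.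
Proof. by move=> H; exact: (@filter_forall _ _ P (nbhs x) _ H). Qed.

Lemma hasd_cont (W : normedModType R) (A : set R) (f : R -> W) t l :
  hasd A f t l -> forall e : R, 0 < e -> \forall s \near t, A s -> `|f s - f t| < e.
Proof.
move=> H e e0.
have e1 : 0 < e / (2 * (1 + `|l|)) by rewrite divr_gt0 // mulr_gt0// ltr_wpDr.
near=> s => As.
have H1 : `|f s - f t - (s - t) *: l| <= 1 * `|s - t|.
  by move: As; near: s; exact: H.
have st : `|s - t| <= e / (2 * (1 + `|l|)).
  by apply/ltW; near: s; exact: (@near_dist R^o t _ e1).
rewrite -(subrK ((s - t) *: l) (f s - f t)).
rewrite (le_lt_trans (ler_normD _ _))//.
rewrite (le_lt_trans (lerD H1 (lexx _)))// normrZ.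
move: st; rewrite ler_pdivlMr ?mulr_gt0 ?ltr_wpDr// => st; nra.
Unshelve. all: by end_near. Qed.

Lemma within_near T (A P : set T) (F : set_system T) {FF : Filter F} :
  (\forall s \near within A F, P s) <-> (\forall s \near F, A s -> P s).
Proof. by []. Qed.

Lemma hasd_cvg_within (W : normedModType R) (A : set R) (f : R -> W) t l :
  hasd A f t l -> f s @[s --> within A (nbhs t)] --> f t.
Proof.
move=> H; apply/cvgrPdist_lt => e e0; rewrite within_near.
by apply: filterS (hasd_cont H e0) => s + As => /(_ As); rewrite distrC.
Qed.

Lemma hasd_cvg (W : normedModType R) (A : set R) (f : R -> W) t l :
  hasd A f t l <->
  (fun s => (s - t)^-1 *: (f s - f t)) @ within A t^' --> l.
Proof.
have E s e : s != t -> (`|l - (s - t)^-1 *: (f s - f t)| <= e) =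
     (`|f s - f t - (s - t) *: l| <= e * `|s - t|).
  move=> st; have st0 : s - t != 0 by rewrite subr_eq0.
  rewrite distrC -(ler_pM2l (x := `|s - t|)) ?normr_gt0//.
  by rewrite -normrZ scalerBr scalerA divff// scale1r mulrC.
split.
  move=> H; apply/cvgrPdist_le => e e0.
  rewrite !within_near; apply: filterS (H _ e0) => s h st As.
  by rewrite E ?h//.
move=> /cvgrPdist_le H e e0; move: (H _ e0); rewrite !within_near.
apply: filterS => s h As.
have [->|st] := eqVneq s t.
  by rewrite !subrr scale0r subr0 !normr0 mulr0.
by rewrite -E// h.
Qed.

Lemma hasd_unique (W : normedModType R) (A : set R) (f : R -> W) t l l' :
  (ProperFilter (within A t^')) ->
  hasd A f t l -> hasd A f t l' -> l = l'.
Proof.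
move=> PF /hasd_cvg H /hasd_cvg H'; exact: cvg_unique H H'.
Qed.

Lemma hasd_within (W : normedModType R) (A : set R) (f : R -> W) t l :
  (ProperFilter (within A t^')) ->
  hasd A f t l -> derivable_within A f t /\ derive_within A f t = l.
Proof.
move=> PF /hasd_cvg H; split; first by apply/cvg_ex; exists l.
exact: cvg_lim.
Qed.

Lemma within_hasd (W : normedModType R) (A : set R) (f : R -> W) t :
  derivable_within A f t -> hasd A f t (derive_within A f t).
Proof. by move=> H; apply/hasd_cvg. Qed.

Lemma hasd_derive (W : normedModType R) (f : R -> W) t l :
  hasd setT f t l -> derivable f t 1 /\ derive1 f t = l.
Proof.
move=> H.
have K : (fun h : R => h^-1 *: (f (h + t) - f t)) @ 0^' --> l.
  apply/cvgrPdist_le => e e0; rewrite within_near.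
  have /near_distP[d d0 h] := H _ e0.
  apply/(@near_distP R^o); exists d => // s; rewrite subr0 => sd s0.
  have := h (s + t); rewrite addrK => /(_ sd I) {}h.
  rewrite distrC -(ler_pM2l (x := `|s|)) ?normr_gt0//.
  by rewrite -normrZ scalerBr scalerA divff// scale1r mulrC.
split; last exact: cvg_lim.
apply/cvg_ex; exists l.
have -> : (fun h : R => h^-1 *: ((f \o shift t) (h *: (1 : R)) - f t)) =
  (fun h : R => h^-1 *: (f (h + t) - f t)).
  by apply/funext => h /=; rewrite /shift/= [h *: 1]mulr1.
exact: K.
Qed.

Lemma derive_hasd (W : normedModType R) (f : R -> W) t :
  derivable f t 1 -> hasd setT f t (derive1 f t).
Proof.
rewrite /derivable.
have -> : (fun h : R => h^-1 *: ((f \o shift t) (h *: (1 : R)) - f t)) =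
  (fun h : R => h^-1 *: (f (h + t) - f t)).
  by apply/funext => h /=; rewrite /shift/= [h *: 1]mulr1.
move=> H; rewrite /derive1.
move/cvgrPdist_le : H => H e e0.
have := H _ e0; rewrite within_near => /near_distP[d d0 h].
apply/near_distP; exists d => // s sd _.
have [->|st] := eqVneq s t.
  by rewrite !subrr scale0r subr0 !normr0 mulr0.
have st0 : s - t != 0 by rewrite subr_eq0.
have := h (s - t); rewrite subr0 => /(_ sd st0).
rewrite subrK distrC -(ler_pM2l (x := `|s - t|)) ?normr_gt0//.
by rewrite -normrZ scalerBr scalerA divff// scale1r mulrC.
Qed.

Lemma hasd_comp (V W : normedModType R) (A : set R) (g : R -> V) (f : V -> W) t l L :
  hasD f (g t) L -> hasd A g t l -> hasd A (f \o g) t (L l).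
Proof.
move=> [linL [C C0 LC] H] G e e0.
have c0 : 0 < 1 + `|l| by rewrite ltr_wpDr.
have [e1 e10 e1E] : exists2 e1 : R, 0 < e1 & e1 * (1 + `|l|) <= e / 2.
  exists (e / 2 / (1 + `|l|)); first by rewrite !divr_gt0.
  by rewrite divfK// gt_eqF.
have [e2 [e20 e21 e2E]] : exists e2 : R, [/\ 0 < e2, e2 <= 1 & C * e2 <= e / 2].
  exists (Num.min 1 (e / 2 / (1 + C))); rewrite lt_min ltr01/= !divr_gt0//; last by lra.
  rewrite ge_min lexx/=; split=> //.
  have : Num.min 1 (e / 2 / (1 + C)) <= e / 2 / (1 + C) by rewrite ge_min lexx orbT.
  by rewrite ler_pdivlMr; [|lra]; set m := Num.min _ _ => ?; have : 0 <= m;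
     [rewrite le_min ler01/= !divr_ge0//; lra | nra].
have /near_distP[d d0 Hd] := H _ e10.
near=> s => As.
have gs : `|g s - g t| < d by move: As; near: s; exact: hasd_cont G _ d0.
have Gs : `|g s - g t - (s - t) *: l| <= e2 * `|s - t|.
  by move: As; near: s; exact: G.
have Hs := Hd _ gs.
have gs2 : `|g s - g t| <= (1 + `|l|) * `|s - t|.
  rewrite -(subrK ((s - t) *: l) (g s - g t)) (le_trans (ler_normD _ _))// normrZ.
  have := normr_ge0 (s - t); nra.
have -> : (f \o g) s - (f \o g) t - (s - t) *: L l =
  (f (g s) - f (g t) - L (g s - g t)) + L (g s - g t - (s - t) *: l).
  by rewrite (linB linL (g s - g t)) (linZ linL) addrA subrK.
rewrite (le_trans (ler_normD _ _))//.
have h1 := le_trans (LC _) (ler_wpM2l C0 Gs).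
rewrite (le_trans (lerD Hs h1))//.
apply: (@le_trans _ _ (e1 * ((1 + `|l|) * `|s - t|) + e / 2 * `|s - t|)).
  by rewrite lerD ?ler_pM2l// mulrA ler_wpM2r.
by rewrite mulrA -mulrDl ler_wpM2r//; lra.
Unshelve. all: by end_near. Qed.

Lemma hasD_hasd_line (V W : normedModType R) (f : V -> W) (x w : V) (t : R) L :
  hasD f (x + t *: w) L -> hasd setT (fun s => f (x + s *: w)) t (L w).
Proof.
move=> H; apply: (@hasd_comp V W setT (fun s => x + s *: w) f) => //.
move=> e e0; apply/(@near_distP R^o); exists 1 => // s _ _.
have -> : x + s *: w - (x + t *: w) = (s - t) *: w.
  by rewrite addrAC opprD addrA subrr sub0r scalerBl addrC.
by rewrite subrr normr0 mulr_ge0// ltW.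
Qed.

Lemma diff_hasD (V W : normedModType R) (f : V -> W) x :
  differentiable f x -> hasD f x (fun h => 'D_h f x).
Proof.
move=> df.
have E : (fun h => 'D_h f x) = 'd f x by apply/funext => h; rewrite deriveE.
rewrite E; split.
- by move=> a u v; rewrite linearP.
- have /linear_lipschitz[k k0 H] := @diff_continuous _ _ _ _ _ df.
  by exists k => //; rewrite ltW.
have [_ /eqaddoP H] := (diff_locallyP x f).1 df.
move=> e e0; have /near_distP[d d0 h] := H _ e0.
apply/near_distP; exists d => // y yx.
have := h (y - x); rewrite subr0 => /(_ yx).
by rewrite !fctE /= /shift/= subrK opprD addrA.
Qed.

(** The supremum of the times up to which [P] holds satisfies [P] by the last
    hypothesis, and could be increased by the one before unless it is [b]. *)
Lemma real_induction (a b : R) (P : R -> Prop) : a <= b -> P a ->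
  (forall t, a <= t -> t < b -> (forall s, a <= s -> s <= t -> P s) ->
     exists2 d : R, 0 < d & forall s, t < s -> s < t + d -> s <= b -> P s) ->
  (forall t, a < t -> t <= b -> (forall s, a <= s -> s < t -> P s) -> P t) ->
  forall t, a <= t -> t <= b -> P t.
Proof.
move=> ab Pa step lim.
pose S := [set t : R | a <= t /\ t <= b /\ forall s, a <= s -> s <= t -> P s].
have Sa : S a.
  by split=> //; split=> // s s1 s2; have -> : s = a by apply/eqP; rewrite eq_le s1 s2.
have supS : has_sup S.
  by split; [exists a | exists b => x [_ []]].
set c := sup S.
have ac : a <= c by apply: ub_le_sup => //; case: supS.
have cb : c <= b by apply: sup_le_ub; [exists a | move=> x [_ []]].
have Pc' s : a <= s -> s < c -> P s.
  move=> as_ sc.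
  have cs0 : 0 < c - s by rewrite subr_gt0.
  have [x Sx sx] := sup_adherent cs0 supS.
  move: sx; rewrite -/c subKr => sx.
  by case: Sx => _ [_]; apply => //; apply: ltW.
have Pc s : a <= s -> s <= c -> P s.
  move=> as_; rewrite le_eqVlt => /orP[/eqP sc|]; last exact: Pc'.
  move: as_; rewrite le_eqVlt => /orP[/eqP <-//|as_].
  by rewrite sc; apply: lim => //; rewrite -sc// sc.
have [bc|cb'] := leP b c.
  by move=> t at_ tb; apply: Pc => //; apply: le_trans bc.
have [d d0 H] := step c ac cb' Pc.
pose e := c + Num.min d (b - c) / 2.
have m0 : 0 < Num.min d (b - c) by rewrite lt_min d0 subr_gt0.
have md : Num.min d (b - c) <= d by rewrite ge_min lexx.
have mb : Num.min d (b - c) <= b - c by rewrite ge_min lexx orbT.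
have Se : S e.
  split; first by rewrite /e; lra.
  split; first by rewrite /e; lra.
  move=> s as_ se; have [sc|sc] := leP s c; first exact: Pc.
  by apply: H => //; rewrite /e in se; lra.
have : e <= c by apply: ub_le_sup => //; case: supS.
by rewrite /e; lra.
Qed.

(** Real induction on [|f t - f a| <= phi t - phi a + e * (t - a)], followed
    by letting [e] tend to [0]. *)
Lemma mean_value_ineq (W : normedModType R) (f : R -> W) (phi : R -> R) (a b : R) : a <= b ->
  (forall t, a <= t -> t <= b -> exists l, exists m, [/\
     hasd `[a, b] f t l, hasd `[a, b] (phi : R -> R^o) t m & `|l| <= m]) ->
  `|f b - f a| <= phi b - phi a.
Proof.
move=> ab H; apply/ler_addgt0Pr => e e0.
pose k := e / (1 + (b - a)).
have k0 : 0 < k by rewrite divr_gt0//; lra.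
have kE : k * (1 + (b - a)) = e by rewrite /k divfK//; apply/eqP; lra.
suff : `|f b - f a| <= phi b - phi a + k * (b - a) by nra.
apply: (@real_induction a b (fun t => `|f t - f a| <= phi t - phi a + k * (t - a))) => //.
- by rewrite !subrr normr0 mulr0 addr0.
- move=> t at_ tb IH; have [l [m [hf hphi lm]]] := H t at_ (ltW tb).
  have k2 : 0 < k / 2 by lra.
  have /(@near_distP R^o)[d1 d10 h1] := hf _ k2.
  have /(@near_distP R^o)[d2 d20 h2] := hphi _ k2.
  exists (Num.min d1 d2); first by rewrite lt_min d10.
  move=> s ts std sb.
  have [sd1 sd2] : s - t < d1 /\ s - t < d2.
    by apply/andP; rewrite -lt_min; lra.
  have as_ : `[a, b]%classic s by rewrite /= in_itv/=; apply/andP; split; lra.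
  have st0 : `|s - t| = s - t by rewrite gtr0_norm//; lra.
  have := h1 s (ltac:(by rewrite st0)) as_; have := h2 s (ltac:(by rewrite st0)) as_.
  rewrite st0 => + A; rewrite ler_norml => /andP[B _].
  have := IH t at_ (lexx _) => C.
  have -> : f s - f a = (f s - f t - (s - t) *: l) + (s - t) *: l + (f t - f a).
    by rewrite subrK addrA subrK.
  rewrite (le_trans (ler_normD _ _))// (le_trans (lerD (ler_normD _ _) (lexx _)))//.
  rewrite normrZ st0; move: B; rewrite /GRing.scale/=; nra.
- move=> t at_ tb IH; have [l [m [hf hphi lm]]] := H t (ltW at_) tb.
  apply/ler_addgt0Pr => e' e'0.
  have e2 : 0 < e' / 2 by lra.
  have /(@near_distP R^o)[d1 d10 h1] := hasd_cont hf e2.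
  have /(@near_distP R^o)[d2 d20 h2] := hasd_cont hphi e2.
  pose d := Num.min (Num.min d1 d2) (t - a).
  have d0 : 0 < d by rewrite !lt_min d10 d20 subr_gt0.
  have dd1 : d <= d1 by rewrite !ge_min lexx.
  have dd2 : d <= d2 by rewrite !ge_min lexx orbT.
  have dta : d <= t - a by rewrite !ge_min lexx !orbT.
  pose s := t - d / 2.
  have as_ : a <= s by rewrite /s; lra.
  have st : s < t by rewrite /s; lra.
  have sab : `[a, b]%classic s by rewrite /= in_itv/=; apply/andP; split; lra.
  have st0 : `|s - t| = d / 2 by rewrite distrC gtr0_norm /s; lra.
  have A := h1 s (ltac:(rewrite st0; lra)) sab.
  have B := h2 s (ltac:(rewrite st0; lra)) sab.
  have C := IH s as_ st.
  have -> : f t - f a = (f s - f a) - (f s - f t).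
    by rewrite opprB [RHS]addrC addrA subrK.
  rewrite (le_trans (ler_normB _ _))//.
  move: B; rewrite ltr_norml => /andP[_ B].
  have : k * (s - a) <= k * (t - a) by rewrite ler_pM2l// /s; lra.
  lra.
Qed.

Lemma mean_value_bound (W : normedModType R) (f : R -> W) (B a b : R) : a <= b ->
  (forall t, a <= t -> t <= b -> exists2 l, hasd `[a, b] f t l & `|l| <= B) ->
  `|f b - f a| <= B * (b - a).
Proof.
move=> ab H; rewrite mulrBr; apply: (mean_value_ineq (phi := fun t => B * t)) => //.
move=> t at_ tb; have [l hl lB] := H t at_ tb; exists l, B; split=> //.
move=> e e0; apply/(@near_distP R^o); exists 1 => // s _ _.
by rewrite -mulrBr [_ *: _]mulrC subrr normr0 mulr_ge0// ltW.
Qed.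

End Curves.

(** * Maps with a Lipschitz derivative *)

Section C11.
Context {R : realType}.
Implicit Types V W U : normedModType R.

(** A map of class C^1 near [x0] with Lipschitz derivative, all estimates
    having the same constant. These maps are stable under the operations that
    build the geodesic equation from the metric, and their quadratic Taylor
    remainder is what the estimates of the flow require. *)
Definition C11 V W (f : V -> W) (df : V -> V -> W) (x0 : V) :=
  exists r C : R, [/\ 0 < r, 0 <= C & forall x, `|x - x0| < r ->
    [/\ lin (df x), forall h, `|df x h| <= C * `|h| &
      forall y, `|y - x0| < r ->
        [/\ `|f y - f x - df x (y - x)| <= C * `|y - x| ^+ 2,
            forall h, `|df x h - df y h| <= C * `|y - x| * `|h| &
            `|f y - f x| <= C * `|y - x|]]].

Lemma C11_mk V W (f : V -> W) (df : V -> V -> W) (x0 : V) (r C : R) : 0 < r -> 0 <= C ->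
  (forall x, `|x - x0| < r ->
    [/\ lin (df x), forall h, `|df x h| <= C * `|h| &
      forall y, `|y - x0| < r ->
        [/\ `|f y - f x - df x (y - x)| <= C * `|y - x| ^+ 2 &
            forall h, `|df x h - df y h| <= C * `|y - x| * `|h|]]) -> C11 f df x0.
Proof.
move=> r0 C0 H; exists r, (C * (1 + 2 * r)).
have CC : C <= C * (1 + 2 * r) by rewrite ler_peMr//; lra.
split=> //; first by rewrite mulr_ge0//; lra.
move=> x xr; have [l1 l2 l3] := H x xr; split=> // [h|y yr].
  by rewrite (le_trans (l2 h))// ler_wpM2r.
have [m1 m2] := l3 y yr; split.
- by rewrite (le_trans m1)// ler_wpM2r// sqr_ge0.
- by move=> h; rewrite (le_trans (m2 h))// !ler_wpM2r.
- rewrite -(subrK (df x (y - x)) (f y - f x)) (le_trans (ler_normD _ _))//.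
  rewrite (le_trans (lerD m1 (l2 _)))//.
  have yx : `|y - x| < 2 * r.
    have -> : y - x = (y - x0) - (x - x0) by rewrite opprB addrA subrK.
    by rewrite (le_lt_trans (ler_normB _ _))//; lra.
  have a0 := normr_ge0 (y - x).
  have : C * `|y - x| * `|y - x| <= C * `|y - x| * (2 * r) by rewrite ler_wpM2l ?mulr_ge0// ltW.
  by rewrite expr2; lra.
Qed.

Lemma C11_hasD V W (f : V -> W) df x0 : C11 f df x0 -> hasD f x0 (df x0).
Proof.
move=> [r [C [r0 C0 H]]]; have x00 : `|x0 - x0| < r by rewrite subrr normr0.
have [l1 l2 l3] := H x0 x00; split=> //; first by exists C.
move=> e e0; apply/near_distP; exists (Num.min r (e / (1 + C))).
  by rewrite lt_min r0 divr_gt0//; lra.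
move=> y; rewrite lt_min => /andP[yr]; rewrite ltr_pdivlMr; last by lra.
move=> ye; have [m1 _ _] := l3 y yr; rewrite (le_trans m1)// expr2 mulrA.
by rewrite ler_wpM2r//; have := normr_ge0 (y - x0); nra.
Qed.

Lemma C11_ext V W (f g : V -> W) df dg x0 : (\forall x \near x0, f x = g x) ->
  (\forall x \near x0, forall h, df x h = dg x h) -> C11 f df x0 -> C11 g dg x0.
Proof.
move=> /near_distP[r1 r10 h1] /near_distP[r2 r20 h2] [r [C [r0 C0 H]]].
pose r' := Num.min r (Num.min r1 r2).
exists r', C; split=> //; first by rewrite !lt_min r0 r10 r20.
have T z : `|z - x0| < r' -> [/\ `|z - x0| < r, `|z - x0| < r1 & `|z - x0| < r2].
  by rewrite !lt_min => /and3P[].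
move=> x /T[xr xr1 xr2]; have [l1 l2 l3] := H x xr; split.
- by move=> a u v; rewrite -!h2.
- by move=> h; rewrite -h2.
- move=> y /T[yr yr1 yr2]; have [m1 m2 m3] := l3 y yr.
  split; [by rewrite -!h1// -h2|by move=> h; rewrite -!h2//|by rewrite -!h1].
Qed.

Lemma C11_comp V W U (f : V -> W) df (g : W -> U) dg x0 :
  C11 f df x0 -> C11 g dg (f x0) -> C11 (g \o f) (fun x h => dg (f x) (df x h)) x0.
Proof.
move=> [r1 [C1 [r10 C10 H1]]] [r2 [C2 [r20 C20 H2]]].
pose r := Num.min r1 (r2 / (1 + C1)).
have r0 : 0 < r by rewrite lt_min r10 divr_gt0//; lra.
apply: (@C11_mk _ _ _ _ _ r (C2 * C1 + C2 * C1 * C1)) => //.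
  by rewrite addr_ge0 ?mulr_ge0.
have x00 : `|x0 - x0| < r1 by rewrite subrr normr0.
have T x : `|x - x0| < r -> `|x - x0| < r1 /\ `|f x - f x0| < r2.
  rewrite lt_min => /andP[xr]; rewrite ltr_pdivlMr; last by lra.
  move=> h; split=> //; have [_ _ l3] := H1 x0 x00; have [_ _ m3] := l3 x xr.
  rewrite (le_lt_trans m3)//; have := normr_ge0 (x - x0); nra.
have C12 : 0 <= C2 * C1 by rewrite mulr_ge0.
have C122 : 0 <= C2 * C1 * C1 by rewrite mulr_ge0.
move=> x /T[xr fxr]; have [l1 l2 l3] := H1 x xr; have [k1 k2 k3] := H2 _ fxr.
split=> [a u v|h|y /T[yr fyr]]; first by rewrite l1 k1.
  rewrite (le_trans (k2 _))// mulrDl -mulrA (le_trans (ler_wpM2l C20 (l2 h)))//.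
  by rewrite lerDl mulr_ge0.
have [m1 m2 m3] := l3 y yr; have [n1 n2 n3] := k3 _ fyr; split.
  have -> : (g \o f) y - (g \o f) x - dg (f x) (df x (y - x)) =
    (g (f y) - g (f x) - dg (f x) (f y - f x)) + dg (f x) (f y - f x - df x (y - x)).
    by rewrite (linB k1 (f y - f x)) addrA subrK.
  rewrite (le_trans (ler_normD _ _))//.
  rewrite (le_trans (lerD n1 (k2 _)))// addrC mulrDl lerD//.
    by rewrite -mulrA ler_wpM2l.
  rewrite -!mulrA ler_wpM2l//.
  rewrite (le_trans (lerXn2r 2 _ _ m3)) ?nnegrE ?mulr_ge0// exprMn expr2.
  by rewrite mulrA.
move=> h.
have -> : dg (f x) (df x h) - dg (f y) (df y h) =
  (dg (f x) (df x h) - dg (f y) (df x h)) + dg (f y) (df x h - df y h).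
  have [k1' _ _] := H2 _ fyr; by rewrite (linB k1') addrA subrK.
rewrite (le_trans (ler_normD _ _))//.
have [_ k2' _] := H2 _ fyr.
rewrite (le_trans (lerD (n2 _) (k2' _)))//.
have a0 := normr_ge0 (y - x); have b0 := normr_ge0 h.
have -> : (C2 * C1 + C2 * C1 * C1) * `|y - x| * `|h| =
  (C2 * (C1 * `|y - x|)) * (C1 * `|h|) + C2 * (C1 * `|y - x| * `|h|) by ring.
by rewrite lerD ?ler_wpM2l// ler_pM ?mulr_ge0// ler_wpM2l.
Qed.

Lemma C11_lin V W (L : V -> W) x0 (C : R) : lin L -> (forall h, `|L h| <= C * `|h|) ->
  C11 L (fun _ => L) x0.
Proof.
move=> linL LC; apply: (@C11_mk _ _ _ _ _ 1 `|C|) => //.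
move=> x _; split=> // [h|y _]; first by rewrite (le_trans (LC h))// ler_wpM2r// ler_norm.
split=> [|h]; last by rewrite subrr normr0 !mulr_ge0.
by rewrite (linB linL) subrr normr0 mulr_ge0// sqr_ge0.
Qed.

Lemma C11_cst V W (c : W) (x0 : V) : C11 (fun _ => c) (fun _ _ => 0) x0.
Proof.
apply: (@C11_mk _ _ _ _ _ 1 0) => // x _; split=> [a u v|h|y _].
- by rewrite scaler0 addr0.
- by rewrite normr0 mul0r.
- by split=> [|h]; rewrite ?subrr ?subr0 normr0 !mul0r.
Qed.

Lemma pair_norm U V (x : U * V) : `|x| = Num.max `|x.1| `|x.2|.
Proof. by []. Qed.

Lemma pair_norm_le U V (x : U * V) (C : R) : `|x.1| <= C -> `|x.2| <= C -> `|x| <= C.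
Proof. by move=> h1 h2; rewrite pair_norm ge_max h1. Qed.
Lemma pair_norm1 U V (x : U * V) : `|x.1| <= `|x|.
Proof. by rewrite pair_norm le_max lexx. Qed.
Lemma pair_norm2 U V (x : U * V) : `|x.2| <= `|x|.
Proof. by rewrite pair_norm le_max lexx orbT. Qed.

Lemma C11_pair V W U (f : V -> W) df (g : V -> U) dg x0 :
  C11 f df x0 -> C11 g dg x0 -> C11 (fun x => (f x, g x)) (fun x h => (df x h, dg x h)) x0.
Proof.
move=> [r1 [C1 [r10 C10 H1]]] [r2 [C2 [r20 C20 H2]]].
exists (Num.min r1 r2), (Num.max C1 C2).
split; [by rewrite lt_min r10|by rewrite le_max C10|].
have M1 : C1 <= Num.max C1 C2 by rewrite le_max lexx.
have M2 : C2 <= Num.max C1 C2 by rewrite le_max lexx orbT.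
move=> x; rewrite lt_min => /andP[/H1[a1 a2 a3] /H2[b1 b2 b3]].
split=> [a u v|h|y]; first by rewrite a1 b1.
  apply: pair_norm_le => /=; [rewrite (le_trans (a2 h))//|rewrite (le_trans (b2 h))//];
   by rewrite ler_wpM2r.
rewrite lt_min => /andP[/a3[c1 c2 c3] /b3[d1 d2 d3]]; split.
- apply: pair_norm_le => /=; [rewrite (le_trans c1)//|rewrite (le_trans d1)//];
   by rewrite ler_wpM2r ?sqr_ge0.
- move=> h; apply: pair_norm_le => /=; [rewrite (le_trans (c2 h))//|rewrite (le_trans (d2 h))//];
   by rewrite !ler_wpM2r ?sqr_ge0.
- apply: pair_norm_le => /=; [rewrite (le_trans c3)//|rewrite (le_trans d3)//];
   by rewrite ler_wpM2r.
Qed.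

Definition bilin V W U (mu : V -> W -> U) :=
  [/\ forall a, lin (mu a), forall b, lin (mu ^~ b) &
      exists2 K : R, 0 <= K & forall a b, `|mu a b| <= K * `|a| * `|b|].

Lemma C11_bilin0 V W U (mu : V -> W -> U) (x0 : V * W) : bilin mu ->
  C11 (fun x => mu x.1 x.2) (fun x h => mu x.1 h.2 + mu h.1 x.2) x0.
Proof.
move=> [l1 l2 [K K0 muK]].
have B (a : V * W) (b : V * W) : `|mu a.1 b.2| <= K * `|a| * `|b|.
  rewrite (le_trans (muK _ _))// -!mulrA ler_wpM2l// ler_pM//.
  - exact: pair_norm1.
  - exact: pair_norm2.
apply: (@C11_mk _ _ _ _ _ 1 (2 * K * (`|x0| + 1) + 2 * K)) => //.
  by rewrite addr_ge0 ?mulr_ge0 ?addr_ge0.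
move=> x xr; have xn : `|x| <= `|x0| + 1.
  rewrite -(subrK x0 x) (le_trans (ler_normD _ _))//; lra.
have n0 := normr_ge0 x0.
have K1 : 0 <= 2 * K * (`|x0| + 1) by rewrite !mulr_ge0// addr_ge0.
split=> [a u v|h|y yr].
- rewrite /= (l1 _ a) (l2 _ a) scalerDr -!addrA; congr (_ + _).
  by rewrite addrCA.
- rewrite (le_trans (ler_normD _ _))//.
  have h1 := B x h; have h2 := B h x; have h0 := normr_ge0 h; have x1 := normr_ge0 x.
  apply: (@le_trans _ _ (2 * K * (`|x0| + 1) * `|h|)); last first.
    by rewrite ler_wpM2r// lerDl mulr_ge0.
  have : K * `|x| * `|h| <= K * (`|x0| + 1) * `|h| by rewrite ler_wpM2r// ler_wpM2l.
  lra.
split.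
  have -> : mu y.1 y.2 - mu x.1 x.2 - (mu x.1 (y - x).2 + mu (y - x).1 x.2) =
     mu (y - x).1 (y - x).2.
    rewrite /= (linB (l2 _)) (linB (l2 _)) !(linB (l1 _)).
    by vlinear R.
  rewrite (le_trans (B _ _))// expr2 mulrA ler_wpM2r// ler_wpM2r//; lra.
move=> h.
have -> : mu x.1 h.2 + mu h.1 x.2 - (mu y.1 h.2 + mu h.1 y.2) =
   - (mu (y - x).1 h.2 + mu h.1 (y - x).2).
  rewrite /= (linB (l2 _)) (linB (l1 _)) !opprD !opprK addrACA; congr (_ + _);
  by rewrite addrC.
rewrite normrN (le_trans (ler_normD _ _))//.
have h1 := B (y - x) h; have h2 := B h (y - x).
rewrite -mulrA; have := mulr_ge0 (normr_ge0 (y - x)) (normr_ge0 h).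
move: h1 h2; rewrite -!mulrA [`|h| * _]mulrC; nra.
Qed.

Lemma C11_bilin V W U (X : normedModType R) (mu : V -> W -> U) (f : X -> V) df (g : X -> W) dg x0 : bilin mu ->
  C11 f df x0 -> C11 g dg x0 ->
  C11 (fun x => mu (f x) (g x)) (fun x h => mu (f x) (dg x h) + mu (df x h) (g x)) x0.
Proof.
move=> bm cf cg.
exact: (C11_comp (C11_pair cf cg) (C11_bilin0 _ bm)).
Qed.

Lemma C11D V W (f g : V -> W) df dg x0 : C11 f df x0 -> C11 g dg x0 ->
  C11 (fun x => f x + g x) (fun x h => df x h + dg x h) x0.
Proof.
move=> cf cg.
apply: (@C11_comp _ _ _ (fun x => (f x, g x)) (fun x h => (df x h, dg x h))
  (fun p : W * W => p.1 + p.2) (fun _ p => p.1 + p.2)); first exact: C11_pair.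
apply: (@C11_lin _ _ _ _ 2) => [a u v|h] /=.
  by rewrite scalerDr addrACA.
rewrite (le_trans (ler_normD _ _))// mulr2n mulrDl mul1r lerD//; [exact: pair_norm1|exact: pair_norm2].
Qed.

Lemma bilin_mul : bilin (fun a b : R^o => a * b : R^o).
Proof.
split=> [a c u v|b c u v|].
- by rewrite mulrDr /GRing.scale/=; ring.
- by rewrite mulrDl /GRing.scale/=; ring.
- by exists 1 => // a b; rewrite mul1r normrM.
Qed.

Lemma bilin_scale W : bilin (fun (a : R^o) (b : W) => a *: b).
Proof.
split=> [a c u v|b c u v|].
- by rewrite scalerDr !scalerA mulrC.
- by rewrite scalerDl scalerA.
- by exists 1 => // a b; rewrite mul1r normrZ.
Qed.

Lemma C11V V (f : V -> R^o) df x0 : f x0 != 0 -> C11 f df x0 ->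
  C11 (fun x => (f x)^-1 : R^o) (fun x h => - (f x) ^- 2 * df x h) x0.
Proof.
move=> f0 cf.
apply: (@C11_comp V R^o R^o f df (fun a => a^-1) (fun a h => - a ^- 2 * h)) => //.
set a := f x0 in f0 *.
have a0 : 0 < `|a| by rewrite normr_gt0.
pose m := `|a| / 2.
have m0 : 0 < m by rewrite divr_gt0.
pose k := m^-1.
have k0 : 0 < k by rewrite invr_gt0.
have T (x : R^o) : `|x - a| < m -> x != 0 /\ `|x^-1| <= k.
  move=> xa; have mx : m <= `|x|.
    have : `|a| <= `|x - a| + `|x|.
      rewrite distrC -{1}(subrK x a) (le_trans (ler_normD _ _))//.
    rewrite /m in xa *; lra.
  have x0' : x != 0 by rewrite -normr_gt0 (lt_le_trans m0).
  by split=> //; rewrite normfV lef_pV2 ?posrE// normr_gt0.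
apply: (@C11_mk _ _ _ _ _ m (k ^+ 2 + 2 * k ^+ 3)) => //.
  by have := exprn_ge0 2 (ltW k0); have := exprn_ge0 3 (ltW k0); lra.
have k2 : 0 <= k ^+ 2 by rewrite exprn_ge0// ltW.
have k3 : 0 <= k ^+ 3 by rewrite exprn_ge0// ltW.
move=> x /T[x0' xk]; split=> [c u v|h|y /T[y0 yk]].
- by rewrite mulrDr /GRing.scale/=; ring.
- rewrite normrM normrN normrV ?unitfE ?expf_neq0// normrX -exprVn -normfV ler_wpM2r//.
  rewrite (@le_trans _ _ (k ^+ 2))//; last by rewrite lerDl mulr_ge0.
  by rewrite lerXn2r ?nnegrE// ltW.
split.
  have -> : y^-1 - x^-1 - - x ^- 2 * (y - x) = (y^-1 * x^-1 ^+ 2) * (y - x) ^+ 2.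
    by field; rewrite x0'.
  rewrite normrM [in leLHS]normrX ler_wpM2r ?sqr_ge0//.
  rewrite (@le_trans _ _ (k * k ^+ 2))//; last by rewrite -exprS; lra.
  by rewrite normrM normrX ler_pM ?exprn_ge0// lerXn2r ?nnegrE// ltW.
move=> h.
have -> : - x ^- 2 * h - - y ^- 2 * h = - (x^-1 * y^-1 * (x^-1 + y^-1)) * (y - x) * h.
  by field; rewrite ?x0' ?y0.
rewrite !normrM normrN !normrM !ler_wpM2r//.
rewrite (@le_trans _ _ (k * k * (2 * k)))//; last by rewrite !exprS expr0; nra.
rewrite !ler_pM ?mulr_ge0//.
by rewrite (le_trans (ler_normD _ _))//; lra.
Qed.

End C11.

(** * From iterated directional derivatives to Lipschitz derivatives *)

Section CkC11.
Context {R : realType}.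
Implicit Types V W U : normedModType R.

Lemma mx_entry_le m n (M : 'M[R]_(m, n)) i j : `|M i j| <= `|M|.
Proof.
rewrite [leRHS]/Num.norm/= mx_normrE.
exact: (le_bigmax _ (fun ij : 'I_m * 'I_n => `|M ij.1 ij.2|) (i, j)).
Qed.

Lemma mx_norm_le m n (M : 'M[R]_(m, n)) (C : R) : 0 <= C ->
  (forall i j, `|M i j| <= C) -> `|M| <= C.
Proof.
move=> C0 H; rewrite [leLHS]/Num.norm/= mx_normrE.
by apply: bigmax_le => // -[i j] _; exact: H.
Qed.

Lemma rV_norm_le n (M : 'rV[R]_n) (C : R) : 0 <= C ->
  (forall j, `|M 0 j| <= C) -> `|M| <= C.
Proof. by move=> C0 H; apply: mx_norm_le => // i j; rewrite ord1. Qed.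

Lemma lin_bounded n W (L : 'rV[R]_n -> W) : lin L ->
  exists2 C : R, 0 <= C & forall h, `|L h| <= C * `|h|.
Proof.
move=> linL; exists (\sum_i `|L (delta_mx 0 i)|); first exact: sumr_ge0.
move=> h; rewrite {1}(row_sum_delta h) (lin_sum linL) mulr_suml.
rewrite (le_trans (ler_norm_sum _ _ _))// ler_sum// => i _.
by rewrite (linZ linL) normrZ mulrC ler_wpM2l// mx_entry_le.
Qed.

Lemma derive_lin V W (f : V -> W) x : differentiable f x -> lin (fun h => 'D_h f x).
Proof. by move=> /diff_hasD[]. Qed.

Lemma derive_sum_delta n W (f : 'rV[R]_n -> W) x h : differentiable f x ->
  'D_h f x = \sum_i h 0 i *: 'D_(delta_mx 0 i : 'rV[R]_n) f x.
Proof.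
move=> /derive_lin df; rewrite {1}(row_sum_delta h) (lin_sum df).
by apply: eq_bigr => i _; rewrite (linZ df).
Qed.

Lemma seg_ball V (x0 x y : V) (r t : R) : `|x - x0| < r -> `|y - x0| < r ->
  0 <= t -> t <= 1 -> `|x + t *: (y - x) - x0| < r.
Proof.
move=> xr yr t0 t1.
have -> : x + t *: (y - x) - x0 = (1 - t) *: (x - x0) + t *: (y - x0) by vlinear R.
rewrite (le_lt_trans (ler_normD _ _))// !normrZ (ger0_norm t0) ger0_norm; last by lra.
have [->|tn1] := eqVneq t 1; first by lra.
have : t < 1 by lra.
nra.
Qed.

Lemma hasD_mean_value_bound V W (f : V -> W) (df : V -> V -> W) (x w : V) (B : R) :
  (forall t, 0 <= t -> t <= 1 -> hasD f (x + t *: w) (df (x + t *: w))) ->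
  (forall t, 0 <= t -> t <= 1 -> `|df (x + t *: w) w| <= B) ->
  `|f (x + w) - f x| <= B.
Proof.
move=> H1 H2.
have := @mean_value_bound R W (fun s => f (x + s *: w)) B 0 1 ler01.
rewrite scale1r scale0r addr0 subr0 mulr1; apply=> t t0 t1.
exists (df (x + t *: w) w); last exact: H2.
by apply: (hasd_sub _ (hasD_hasd_line (H1 t t0 t1))).
Qed.

(** Continuity bounds the derivatives along the finitely many basis vectors,
    hence all directional derivatives, near [x0]; the mean value inequality on
    segments turns this into a Lipschitz estimate. *)
Lemma Ck1_lip n W (U : set 'rV[R]_n) (g : 'rV[R]_n -> W) x0 :
  open U -> Ck_on 1 U g -> U x0 ->
  exists r C : R, [/\ 0 < r, 0 <= C & forall x, `|x - x0| < r ->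
    [/\ U x, forall h, `|'D_h g x| <= C * `|h| &
      forall y, `|y - x0| < r -> `|g y - g x| <= C * `|y - x|]].
Proof.
move=> oU [dg cg] Ux0.
pose C := \sum_i (`|'D_(delta_mx 0 i : 'rV[R]_n) g x0| + 1).
have C0 : 0 <= C by apply: sumr_ge0 => i _; rewrite addr_ge0.
have : \forall x \near x0, forall i : 'I_n, `|'D_(delta_mx 0 i : 'rV[R]_n) g x| <= `|'D_(delta_mx 0 i : 'rV[R]_n) g x0| + 1.
  apply: near_ord => i.
  have /cvgrPdist_lt /(_ _ ltr01) := cg (delta_mx 0 i) x0 Ux0.
  apply: filterS => x; rewrite distrC => h.
  rewrite -lerBlDl (le_trans _ (ltW h))//.
  by rewrite (le_trans _ (lerB_dist _ _)).
move=> /near_distP[r1 r10 h1].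
have /near_distP[r2 r20 h2] : nbhs x0 U by exact: open_nbhs_nbhs.
exists (Num.min r1 r2), C; split=> //; first by rewrite lt_min r10.
have D x h : `|x - x0| < Num.min r1 r2 -> `|'D_h g x| <= C * `|h|.
  rewrite lt_min => /andP[xr1 xr2].
  rewrite derive_sum_delta; last by apply: dg; apply: h2.
  rewrite (le_trans (ler_norm_sum _ _ _))// mulr_suml ler_sum// => i _.
  rewrite normrZ mulrC ler_pM//; [exact: h1|exact: mx_entry_le].
move=> x xr; split=> [|h|y yr].
- by apply: h2; move: xr; rewrite lt_min => /andP[].
- exact: D.
rewrite -{1}(subrK x y) [y - x + x]addrC.
apply: (@hasD_mean_value_bound _ _ g (fun z h => 'D_h g z)) => t t0 t1.
  apply: diff_hasD; apply: dg; apply: h2.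
  by have := seg_ball xr yr t0 t1; rewrite lt_min => /andP[].
by apply: D; exact: seg_ball.
Qed.

(** [Ck1_lip] for the partial derivatives makes the derivative Lipschitz. The
    quadratic remainder is the mean value inequality for [f] minus its
    linearisation at [x]. *)
Lemma Ck2_C11 n W (U : set 'rV[R]_n) (f : 'rV[R]_n -> W) x0 :
  open U -> Ck_on 2 U f -> U x0 -> C11 f (fun x h => 'D_h f x) x0.
Proof.
move=> oU [df cf] Ux0.
pose g (i : 'I_n) x := 'D_(delta_mx 0 i : 'rV[R]_n) f x.
have Hg (i : 'I_n) : exists rC : R * R, [/\ 0 < rC.1, 0 <= rC.2 & forall x, `|x - x0| < rC.1 ->
    [/\ U x, forall h, `|'D_h (g i) x| <= rC.2 * `|h| &
      forall y, `|y - x0| < rC.1 -> `|g i y - g i x| <= rC.2 * `|y - x|]].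
  by have [r [C H]] := Ck1_lip oU (cf (delta_mx 0 i)) Ux0; exists (r, C).
have [rC HrC] := choice Hg.
have Hn : \forall x \near x0, forall i : 'I_n, `|x - x0| < (rC i).1.
  by apply: near_ord => i; apply: near_dist; case: (HrC i).
have /near_distP[r r0 hr] : \forall x \near x0, U x /\ forall i : 'I_n, `|x - x0| < (rC i).1.
  by apply: filterI Hn; exact: open_nbhs_nbhs.
pose C := \sum_i (rC i).2.
have C0 : 0 <= C by apply: sumr_ge0 => i _; case: (HrC i).
pose C' := \sum_i (`|g i x0| + (rC i).2 * r).
have C'0 : 0 <= C'.
  by apply: sumr_ge0 => i _; rewrite addr_ge0// mulr_ge0//; [case: (HrC i)|exact: ltW].
have Ddf x y h : `|x - x0| < r -> `|y - x0| < r -> `|'D_h f x - 'D_h f y| <= C * `|y - x| * `|h|.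
  move=> /hr[Ux xr] /hr[Uy yr]; rewrite !derive_sum_delta; [|exact: df..].
  rewrite -sumrB (le_trans (ler_norm_sum _ _ _))// !mulr_suml ler_sum// => i _.
  rewrite -scalerBr normrZ mulrC ler_pM//; last exact: mx_entry_le.
  by have [_ _ /(_ _ (xr i))[_ _ /(_ _ (yr i))]] := HrC i; rewrite distrC.
apply: (@C11_mk _ _ _ _ _ _ r (C + C')) => //; first by rewrite addr_ge0.
move=> x xr; have [Ux xri] := hr x xr; split.
- by apply: derive_lin; exact: df.
- move=> h; rewrite derive_sum_delta; last exact: df.
  rewrite mulrDl (le_trans (ler_norm_sum _ _ _))//.
  apply: (@le_trans _ _ (C' * `|h|)); last by rewrite lerDr mulr_ge0.
  rewrite mulr_suml ler_sum// => i _; rewrite normrZ mulrC ler_pM//; last exact: mx_entry_le.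
  have [_ c0 Hx] := HrC i.
  have x00 : `|x0 - x0| < (rC i).1 by rewrite subrr normr0; case: (HrC i).
  have [_ _ /(_ _ (xri i)) k] := Hx _ x00.
  rewrite -(subrK (g i x0) ('D__ f x)) addrC (le_trans (ler_normD _ _))// lerD//.
  by rewrite (le_trans k)// ler_wpM2l// ltW.
move=> y yr; split; last first.
  move=> h; rewrite (le_trans (Ddf _ _ _ xr yr))// !ler_wpM2r//.
  by rewrite lerDl.
rewrite (@le_trans _ _ (C * `|y - x| ^+ 2))//; last first.
  by rewrite ler_wpM2r ?sqr_ge0// lerDl.
have -> : f y - f x - 'D_(y - x) f x =
  (f (x + (y - x)) - 'D_(x + (y - x) - x) f x) - (f x - 'D_(x - x) f x).
  have E1 : x + (y - x) = y by rewrite addrC subrK.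
  have E2 : 'D_(x - x) f x = 0 by rewrite subrr (lin0 (derive_lin (df _ Ux))).
  rewrite E1 E2 subr0.
  by rewrite addrAC.
apply: (@hasD_mean_value_bound _ _ (fun z => f z - 'D_(z - x) f x) (fun z h => 'D_h f z - 'D_h f x)) => t t0 t1.
  have zr := seg_ball xr yr t0 t1; set z := x + _ in zr *.
  have [Uz _] := hr _ zr.
  have [l [K K0 b1] H] := diff_hasD (df _ Uz).
  have [l' [K' K'0 b2] _] := diff_hasD (df _ Ux).
  split; first by move=> a u v; rewrite l l'; vlinear R.
    exists (K + K'); first by rewrite addr_ge0.
    by move=> h; rewrite (le_trans (ler_normB _ _))// mulrDl lerD.
  move=> e e0; apply: filterS (H e e0) => w.
  by rewrite !(linB l'); congr (Num.norm _ <= _); vlinear R.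
have zr := seg_ball xr yr t0 t1.
rewrite (le_trans (Ddf _ _ _ zr xr))// expr2 mulrA ler_wpM2r// ler_wpM2l//.
rewrite distrC addrAC subrr add0r normrZ ger0_norm// ler_piMl//.
Qed.

(** The second difference over a small parallelogram is the mixed derivative
    up to a smaller error. As the difference is symmetric in [u] and [v], so
    is the mixed derivative. *)
Lemma schwarz_half n W (U : set 'rV[R]_n) (f : 'rV[R]_n -> W) (x u v : 'rV[R]_n) :
  open U -> Ck_on 2 U f -> U x -> forall e : R, 0 < e ->
  exists2 d : R, 0 < d & forall s, 0 < s -> s < d ->
   `|f (x + s *: u + s *: v) - f (x + s *: u) - f (x + s *: v) + f x
     - s ^+ 2 *: 'D_v (fun y => 'D_u f y) x| <= e * s ^+ 2.
Proof.
move=> oU [df cf] Ux e e0.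
have [dg _] := cf u.
have [l _ H] := diff_hasD (dg x Ux).
pose k := 1 + `|u| + `|v|.
have k0 : 0 < k by rewrite /k -addrA ltr_pwDl// addr_ge0.
have ek : 0 < e / (2 * k) by rewrite divr_gt0// mulr_gt0.
have /near_distP[d1 d10 h1] := H _ ek.
have /near_distP[d2 d20 h2] : nbhs x U by exact: open_nbhs_nbhs.
exists (Num.min d1 d2 / k); first by rewrite divr_gt0// lt_min d10.
move=> s s0; rewrite ltr_pdivlMr// lt_min => /andP[sd1 sd2].
have u0 := normr_ge0 u; have v0 := normr_ge0 v.
have B (t t' : R) : 0 <= t -> t <= s -> 0 <= t' -> t' <= s ->
   `|x + t *: u + t' *: v - x| <= s * k.
  move=> t0 ts t'0 t's; have -> : x + t *: u + t' *: v - x = t *: u + t' *: v by vlinear R.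
  rewrite (le_trans (ler_normD _ _))// !normrZ !ger0_norm// /k; nra.
pose D := 'D_v (fun y => 'D_u f y) x.
have := @mean_value_bound R W (fun t => f (x + s *: v + t *: u) - f (x + t *: u) - t *: (s *: D)) (e * s) 0 s (ltW s0).
have -> : f (x + s *: v + s *: u) - f (x + s *: u) - s *: (s *: D)
   - (f (x + s *: v + 0 *: u) - f (x + 0 *: u) - 0 *: (s *: D)) =
   f (x + s *: u + s *: v) - f (x + s *: u) - f (x + s *: v) + f x - s ^+ 2 *: D.
  rewrite !scale0r !addr0 (addrAC x (s *: v)) scalerA expr2.
  set a1 := f _; set a2 := f _; set a3 := f _; set a4 := f _.
  vlinear R.
rewrite subr0 expr2 mulrA; apply => t t0 ts.
have T w t' : 0 <= t' -> t' <= s -> w = x + t *: u + t' *: v -> hasD f w (fun h => 'D_h f w).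
  move=> t'0 t's ->; apply: diff_hasD; apply: df; apply: h2.
  by rewrite (le_lt_trans (B _ _ _ _ _ _)).
exists ('D_u f (x + s *: v + t *: u) - 'D_u f (x + t *: u) - s *: D).
  have H1 := hasD_hasd_line (T (x + s *: v + t *: u) s (ltW s0) (lexx _) (addrAC _ _ _)).
  have H2 := hasD_hasd_line (T (x + t *: u) 0 (lexx _) (ltW s0) (ltac:(by rewrite scale0r addr0))).
  move=> e' e'0; have e'2 : 0 < e' / 2 by lra.
  near=> q => _.
  have a1 : `|f (x + s *: v + q *: u) - f (x + s *: v + t *: u)
      - (q - t) *: 'D_u f (x + s *: v + t *: u)| <= e' / 2 * `|q - t|.
    by have := I; near: q; exact: H1.
  have a2 : `|f (x + q *: u) - f (x + t *: u)
      - (q - t) *: 'D_u f (x + t *: u)| <= e' / 2 * `|q - t|.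
    by have := I; near: q; exact: H2.
  rewrite (_ : Num.norm _ = `|(f (x + s *: v + q *: u) - f (x + s *: v + t *: u)
      - (q - t) *: 'D_u f (x + s *: v + t *: u)) -
     (f (x + q *: u) - f (x + t *: u)
      - (q - t) *: 'D_u f (x + t *: u))|); last first.
    congr Num.norm; set b1 := f (x + s *: v + q *: u); set b2 := f (x + s *: v + t *: u).
    set b3 := f (x + q *: u); set b4 := f (x + t *: u).
    set b5 := 'D_u f (x + s *: v + t *: u); set b6 := 'D_u f (x + t *: u); by vlinear R.
  rewrite (le_trans (ler_normB _ _))//; lra.
have b1 := h1 (x + t *: u + s *: v) (le_lt_trans (B _ _ t0 ts (ltW s0) (lexx _)) sd1).
have b2' := B t 0 t0 ts (lexx _) (ltW s0).
rewrite scale0r addr0 in b2'.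
have b2 := h1 _ (le_lt_trans b2' sd1).
have b1' := B t s t0 ts (ltW s0) (lexx _).
rewrite [x + s *: v + _]addrAC.
have -> : 'D_u f (x + t *: u + s *: v) - 'D_u f (x + t *: u) - s *: D =
  ('D_u f (x + t *: u + s *: v) - 'D_u f x - 'D_(x + t *: u + s *: v - x) (fun y => 'D_u f y) x) -
  ('D_u f (x + t *: u) - 'D_u f x - 'D_(x + t *: u - x) (fun y => 'D_u f y) x).
  have -> : x + t *: u + s *: v - x = (x + t *: u - x) + s *: v by vlinear R.
  by rewrite (linD l) (linZ l) /= -/D; set z := 'D_(x + t *: u - x) _ _; vlinear R.
rewrite (le_trans (ler_normB _ _))// (le_trans (lerD b1 b2))//.
have -> : e * s = e / (2 * k) * (s * k) + e / (2 * k) * (s * k).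
  by field; rewrite gt_eqF.
by rewrite lerD// ler_wpM2l// ltW.
Unshelve. all: by end_near. Qed.

Lemma schwarz n W (U : set 'rV[R]_n) (f : 'rV[R]_n -> W) (x u v : 'rV[R]_n) :
  open U -> Ck_on 2 U f -> U x ->
  'D_v (fun y => 'D_u f y) x = 'D_u (fun y => 'D_v f y) x.
Proof.
move=> oU cf Ux; apply/eqP; rewrite -subr_eq0 -normr_le0; apply/ler_addgt0Pl => e e0.
rewrite addr0; have e2 : 0 < e / 2 by lra.
have [d1 d10 h1] := schwarz_half u v oU cf Ux e2.
have [d2 d20 h2] := schwarz_half v u oU cf Ux e2.
pose s := Num.min d1 d2 / 2.
have m0 : 0 < Num.min d1 d2 by rewrite lt_min d10.
have s0 : 0 < s by rewrite divr_gt0.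
have s1 : s < d1.
  have : Num.min d1 d2 <= d1 by rewrite ge_min lexx.
  rewrite /s; lra.
have s2 : s < d2.
  have : Num.min d1 d2 <= d2 by rewrite ge_min lexx orbT.
  rewrite /s; lra.
have {}h1 := h1 s s0 s1; have {}h2 := h2 s s0 s2.
have ss0 : 0 < s ^+ 2 by rewrite exprn_gt0.
rewrite -(ler_pM2l ss0) -[X in X * Num.norm _](ger0_norm (ltW ss0)) -normrZ.
rewrite [_ - f (x + s *: v) - _]addrAC in h2.
set A := 'D_v _ _ in h1 *; set B := 'D_u _ _ in h2 *.
have -> : s ^+ 2 *: (A - B) =
 (f (x + s *: v + s *: u) - f (x + s *: u) - f (x + s *: v) + f x - s ^+ 2 *: B)
 - (f (x + s *: u + s *: v) - f (x + s *: u) - f (x + s *: v) + f x - s ^+ 2 *: A).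
  rewrite (addrAC x (s *: v) (s *: u)); set a1 := f (x + s *: u + s *: v).
  set a2 := f (x + s *: u); set a3 := f (x + s *: v); by vlinear R.
by rewrite (le_trans (ler_normB _ _))// (le_trans (lerD h2 h1))// -mulrDl -splitr mulrC.
Qed.

End CkC11.

(** * Differentiation rules for curves *)

Section CurveRules.
Context {R : realType}.
Implicit Types V W U : normedModType R.

Lemma hasd_lin V W (L : V -> W) (C : R) (A : set R) f t l : lin L ->
  (forall h, `|L h| <= C * `|h|) -> hasd A f t l -> hasd A (fun s => L (f s)) t (L l).
Proof.
move=> linL LC; apply: (@hasd_comp _ V W A f L t l L).
exact: C11_hasD (C11_lin _ linL LC).
Qed.

Lemma hasd_pair V W (A : set R) (f : R -> V) (g : R -> W) t l m :
  hasd A f t l -> hasd A g t m -> hasd A (fun s => (f s, g s)) t (l, m).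
Proof.
move=> hf hg e e0; near=> s => As; apply: pair_norm_le => /=.
  by move: As; near: s; exact: hf.
by move: As; near: s; exact: hg.
Unshelve. all: by end_near. Qed.

Lemma hasd_bilin V W U (mu : V -> W -> U) (A : set R) (f : R -> V) (g : R -> W) t l m :
  bilin mu -> hasd A f t l -> hasd A g t m ->
  hasd A (fun s => mu (f s) (g s)) t (mu (f t) m + mu l (g t)).
Proof.
move=> bm hf hg.
exact: (hasd_comp (C11_hasD (C11_bilin0 (f t, g t) bm)) (hasd_pair hf hg)).
Qed.

Lemma hasd_cst W (A : set R) (c : W) t : hasd A (fun=> c) t 0.
Proof.
move=> e e0; apply/(@near_distP R R^o); exists 1 => // s _ _.
by rewrite subrr scaler0 subrr normr0 mulr_ge0// ltW.
Qed.

Lemma hasd_id (A : set R) t : hasd A (fun s => s : R^o) t 1.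
Proof.
move=> e e0; apply/(@near_distP R R^o); exists 1 => // s _ _.
by rewrite [_ *: _]mulr1 subrr normr0 mulr_ge0// ltW.
Qed.

Lemma hasdD W (A : set R) (f g : R -> W) t l m :
  hasd A f t l -> hasd A g t m -> hasd A (fun s => f s + g s) t (l + m).
Proof.
move=> hf hg; apply: (@hasd_lin _ _ (fun p : W * W => p.1 + p.2) 2 _ _ _ _ _ _ (hasd_pair hf hg)).
  by move=> a u v /=; rewrite scalerDr addrACA.
move=> h; rewrite (le_trans (ler_normD _ _))// mulr2n mulrDl mul1r lerD//;
  [exact: pair_norm1|exact: pair_norm2].
Qed.

Lemma hasdZ W (A : set R) (f : R -> W) (k : R) t l :
  hasd A f t l -> hasd A (fun s => k *: f s) t (k *: l).
Proof.
apply: (@hasd_lin _ _ (fun x => k *: x) `|k|) => [a u v|h]; first by vlinear R.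
by rewrite normrZ.
Qed.

Lemma hasdB W (A : set R) (f g : R -> W) t l m :
  hasd A f t l -> hasd A g t m -> hasd A (fun s => f s - g s) t (l - m).
Proof.
move=> hf hg; rewrite -scaleN1r; apply: hasd_ext (hasdD hf (hasdZ (-1) hg)) => s.
by rewrite scaleN1r.
Qed.

Lemma hasdM (A : set R) (f g : R -> R^o) t l m :
  hasd A f t l -> hasd A g t m -> hasd A (fun s => f s * g s : R^o) t (f t * m + l * g t).
Proof. exact: hasd_bilin bilin_mul. Qed.

Lemma hasd_affine W (f : R -> W) (a b t : R) l : hasd setT f (a * t + b) l ->
  hasd setT (fun s => f (a * s + b)) t (a *: l).
Proof.
move=> H e e0; have a1 : 0 < 1 + `|a| by rewrite ltr_wpDr.
have e1 : 0 < e / (1 + `|a|) by rewrite divr_gt0.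
have /(@near_distP R R^o)[d d0 h] := H _ e1.
apply/(@near_distP R R^o); exists (d / (1 + `|a|)); first by rewrite divr_gt0.
move=> s; rewrite ltr_pdivlMr// => sd _.
have E : a * s + b - (a * t + b) = a * (s - t) by ring.
have as_ : `|a * (s - t)| <= (1 + `|a|) * `|s - t| by rewrite normrM ler_wpM2r// lerDr.
have {}h := h (a * s + b) (ltac:(by rewrite E (le_lt_trans as_)// mulrC)) I.
rewrite scalerA [_ * a]mulrC -E (le_trans h)// E.
by rewrite (le_trans (ler_wpM2l (ltW e1) as_))// mulrA divfK// gt_eqF.
Qed.

Lemma hasd_rV n (A : set R) (f : R -> 'rV[R]_n) t (l : 'rV[R]_n) :
  (forall j, hasd A (fun s => f s 0 j : R^o) t (l 0 j)) -> hasd A f t l.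
Proof.
move=> H e e0.
have : \forall s \near (t : R^o), forall j : 'I_n, A s ->
    `|f s 0 j - f t 0 j - (s - t) * l 0 j| <= e * `|s - t|.
  by apply: near_ord => j; exact: H.
apply: filterS => s Hs As; apply: rV_norm_le => [|j]; first by rewrite mulr_ge0// ltW.
by rewrite !mxE; exact: Hs.
Qed.

Lemma hasd_entry m n (A : set R) (f : R -> 'M[R]_(m, n)) t l i j :
  hasd A f t l -> hasd A (fun s => f s i j : R^o) t (l i j).
Proof.
apply: (@hasd_lin _ R^o (fun M : 'M[R]_(m, n) => M i j : R^o) 1) => [a u v|h].
  by rewrite !mxE.
by rewrite mul1r mx_entry_le.
Qed.

Lemma mean_value_bound_sym W (z : R -> W) (g : R -> W) (T B : R) :
  (forall t, `|t| <= T -> hasd setT z t (g t) /\ `|g t| <= B) ->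
  forall s t, `|s| <= T -> `|t| <= T -> `|z t - z s| <= B * `|t - s|.
Proof.
move=> H.
have W1 s t : s <= t -> `|s| <= T -> `|t| <= T -> `|z t - z s| <= B * `|t - s|.
  move=> st sT tT; rewrite (@ger0_norm _ (t - s)) ?subr_ge0//.
  apply: mean_value_bound => // u su ut; have uT : `|u| <= T.
    by move: sT tT; rewrite !ler_norml => /andP[a b] /andP[c d]; apply/andP; split; lra.
  by have [h1 h2] := H _ uT; exists (g u) => //; exact: hasd_sub h1.
move=> s t sT tT; have [st|/ltW ts] := leP s t; first exact: W1.
by rewrite distrC [`|t - s|]distrC; exact: W1.
Qed.

End CurveRules.

(** * Primitives and limits in finite dimension *)

Section Nice.
Context {R : realType}.
Implicit Types V W : normedModType R.

Definition has_primitives W := forall (m : R) (f : R -> W), continuous f ->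
  exists F : R -> W, F 0 = 0 /\ forall t, `|t| < m -> hasd setT F t (f t).

(** Completeness, restricted to the sequences that Picard iteration produces
    and with the rate of convergence that it uses. *)
Definition geometrically_complete W := forall (u : nat -> W) (M : R),
  (forall k, `|u k.+1 - u k| <= M * 2^-1 ^+ k) ->
  exists l, forall k, `|u k - l| <= 2 * M * 2^-1 ^+ k.

(** What Picard iteration requires of the target space. Both properties pass
    to products, so that they are available for the space of positions and
    velocities. *)
Definition ode_space W := has_primitives W /\ geometrically_complete W.

Lemma ode_space_R : ode_space R^o.
Proof.
split.
- move=> m f cf; pose a := - (`|m| + 1); pose b := `|m| + 1.
  pose G (x : R) := (\int[lebesgue_measure]_(t in `[a, x]) f t)%R.
  exists (fun t => G t - G 0); split; first by rewrite subrr.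
  move=> t; rewrite ltr_norml => /andP[mt tm].
  have mm := ler_norm m; have mm' : - m <= `|m| by rewrite -normrN ler_norm.
  have [dG DG] : derivable (G : R -> R^o) t 1 /\ derive1 (G : R -> R^o) t = f t.
    apply: (@continuous_FTC1_closed R f a t b); rewrite /a /b.
    - lra.
    - apply: continuous_compact_integrable; first exact: segment_compact.
      by move=> x; apply: continuous_subspaceT.
    - lra.
    - exact: cf.
  have := hasdB (derive_hasd dG) (hasd_cst setT (G 0 : R^o) t).
  by rewrite subr0 DG.
move=> u M H.
pose c k := 2 * M * 2^-1 ^+ k : R.
have M0 : 0 <= M by have := H 0%N; rewrite expr0 mulr1; apply: le_trans.
have c0 k : 0 <= c k by rewrite !mulr_ge0// exprn_ge0.
have cS k : c k.+1 = c k - M * 2^-1 ^+ k by rewrite /c exprS; lra.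
have Hk k : - (M * 2^-1 ^+ k) <= u k.+1 - u k /\ u k.+1 - u k <= M * 2^-1 ^+ k.
  by apply/andP; rewrite -ler_norml.
have inc k j : u k - c k <= u (k + j)%N - c (k + j)%N.
  elim: j => [|j IH]; first by rewrite addn0.
  by rewrite addnS (le_trans IH)// cS; have [h1 h2] := Hk (k + j)%N; lra.
have dec k j : u (k + j)%N + c (k + j)%N <= u k + c k.
  elim: j => [|j IH]; first by rewrite addn0.
  by rewrite addnS (le_trans _ IH)// cS; have [h1 h2] := Hk (k + j)%N; lra.
have cross k j : u j - c j <= u k + c k.
  have [/subnKC <-|/ltnW/subnKC <-] := leqP k j.
    by have := dec k (j - k)%N; have := c0 (k + (j - k))%N; lra.
  by have := inc j (k - j)%N; have := c0 (j + (k - j))%N; lra.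
pose S := [set u j - c j | j in setT].
have supS : has_sup S.
  split; first by exists (u 0%N - c 0%N), 0%N.
  by exists (u 0%N + c 0%N) => _ [j _ <-]; exact: cross.
exists (sup S) => k; rewrite ler_norml; apply/andP; split.
  have : sup S <= u k + c k.
    by apply: sup_le_ub; [case: supS|move=> _ [j _ <-]; exact: cross].
  by rewrite /c; lra.
have : u k - c k <= sup S by apply: ub_le_sup; [case: supS|exists k].
by rewrite /c; lra.
Qed.

Lemma ode_space_rV n : ode_space 'rV[R]_n.
Proof.
have [pR cR] := ode_space_R; split.
- move=> m f cf.
  have Hj (j : 'I_n) : exists F : R -> R^o, F 0 = 0 /\ forall t, `|t| < m -> hasd setT F t (f t 0 j).
    have cj : continuous (fun t => f t 0 j : R^o).
      move=> t; apply/cvgrPdist_lt => e e0; have /cvgrPdist_lt/(_ _ e0) := cf t.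
      apply: filterS => s; apply: le_lt_trans.
      by rewrite (le_trans _ (mx_entry_le _ 0 j))// !mxE.
    exact: pR cj.
  have [F HF] := choice Hj.
  exists (fun t => \row_j F j t); split.
    by apply/rowP => j; rewrite !mxE; case: (HF j).
  move=> t tm; apply: hasd_rV => j.
  have [_ /(_ _ tm)] := HF j; apply: hasd_ext => s; by rewrite mxE.
move=> u M H; have M0 : 0 <= M by have := H 0%N; rewrite expr0 mulr1; apply: le_trans.
have Hj (j : 'I_n) : exists l : R^o, forall k, `|u k 0 j - l| <= 2 * M * 2^-1 ^+ k.
  apply: cR => k; rewrite (le_trans _ (H k))// (le_trans _ (mx_entry_le _ 0 j))//.
  by rewrite !mxE.
have [l Hl] := choice Hj.
exists (\row_j l j) => k; apply: rV_norm_le => [|j].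
  by rewrite !mulr_ge0// exprn_ge0.
by rewrite !mxE; exact: Hl.
Qed.

Lemma ode_space_prod V W : ode_space V -> ode_space W -> ode_space (V * W)%type.
Proof.
move=> [pV cV] [pW cW]; split.
- move=> m f cf.
  have [F1 [F10 H1]] := pV m (fst \o f) (fun t => continuous_comp (cf t) (@cvg_fst _ _ _ _ _)).
  have [F2 [F20 H2]] := pW m (snd \o f) (fun t => continuous_comp (cf t) (@cvg_snd _ _ _ _ _)).
  exists (fun t => (F1 t, F2 t)); split; first by rewrite F10 F20.
  by move=> t tm; have := hasd_pair (H1 _ tm) (H2 _ tm); rewrite /= -surjective_pairing.
move=> u M H.
have [l1 H1] := cV (fst \o u) M (fun k => le_trans (pair_norm1 (u k.+1 - u k)) (H k)).
have [l2 H2] := cW (snd \o u) M (fun k => le_trans (pair_norm2 (u k.+1 - u k)) (H k)).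
by exists (l1, l2) => k; apply: pair_norm_le; [exact: H1|exact: H2].
Qed.

Lemma le0_geom (x C : R) : (forall k, x <= C * 2^-1 ^+ k) -> x <= 0.
Proof.
move=> H; apply/ler_addgt0Pl => e e0; rewrite addr0.
have := @cvg_geometric _ C (2^-1 : R); rewrite ger0_norm// => /(_ (ltac:(lra))).
move=> /cvgrPdist_lt /(_ _ e0)[N _ /(_ N (leqnn _))]; rewrite sub0r normrN /geometric/= => h.
by rewrite (le_trans (H N))// (le_trans (ler_norm _))// ltW.
Qed.

End Nice.

(** * Picard iteration and the Gronwall inequality *)

Section Picard.
Context {R : realType}.
Implicit Types V W : normedModType R.

(** Truncating the time turns a curve that is controlled on [[- T, T]] only
    into one that is controlled everywhere. *)
Definition clamp (T s : R) : R := Num.max (- T) (Num.min s T).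

Lemma clamp_id T s : `|s| <= T -> clamp T s = s.
Proof.
by rewrite ler_norml => /andP[a b]; rewrite /clamp (min_idPl b) (max_idPr a).
Qed.

Lemma clamp_le T s : 0 <= T -> `|clamp T s| <= T.
Proof.
move=> T0; rewrite ler_norml /clamp le_max lexx/= ge_max ge_min lexx orbT andbT; lra.
Qed.

Lemma clamp_lip T s t : `|clamp T s - clamp T t| <= `|s - t|.
Proof.
have W s' t' : s' <= t' -> `|clamp T s' - clamp T t'| <= `|s' - t'|.
  move=> st; rewrite distrC [`|s' - t'|]distrC (@ger0_norm _ (t' - s')) ?subr_ge0//.
  rewrite /clamp ger0_norm; last first.
    rewrite subr_ge0 ge_max le_max lexx/= le_max; apply/orP; right.
    by rewrite le_min ge_min st/= ge_min lexx orbT.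
  rewrite lerBlDr ge_max; apply/andP; split.
    have : - T <= Num.max (- T) (Num.min s' T) by rewrite le_max lexx.
    lra.
  have h1 : Num.min s' T <= Num.max (- T) (Num.min s' T) by rewrite le_max lexx orbT.
  have [sT|Ts] := leP s' T.
    have : Num.min t' T <= t' by rewrite ge_min lexx.
    move: h1; rewrite (min_idPl sT); lra.
  have : Num.min t' T <= T by rewrite ge_min lexx orbT.
  move: h1; rewrite (min_idPr (ltW Ts)); lra.
by have [/W//|/ltW/W] := leP s t; rewrite distrC [`|t - s|]distrC.
Qed.

Lemma lip_cont V W (f : V -> W) (B : R) : (forall s t, `|f s - f t| <= B * `|s - t|) ->
  continuous f.
Proof.
move=> H t; apply/cvgrPdist_lt => e e0.
have B1 : 0 < 1 + `|B| by rewrite ltr_wpDr.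
apply/near_distP; exists (e / (1 + `|B|)); first by rewrite divr_gt0.
move=> s; rewrite ltr_pdivlMr// => st; rewrite distrC (le_lt_trans (H s t))//.
rewrite (le_lt_trans _ st)// mulrC ler_wpM2l// (le_trans (ler_norm _))// lerDr//.
Qed.

(** The condition [K * T <= 2^-1] halves the distance between successive
    iterates; the radius [2 * M * T] is the sum of these distances. *)
Theorem picard W (f : R -> W -> W) (K M T : R) (p : W) : ode_space W ->
  0 < T -> 0 <= K -> 0 <= M -> K * T <= 2^-1 ->
  (forall t, `|f t p| <= M) ->
  (forall t z z', `|z - p| <= 2 * M * T -> `|z' - p| <= 2 * M * T ->
     `|f t z - f t z'| <= K * `|z - z'|) ->
  (forall z : R -> W, continuous z -> (forall t, `|z t - p| <= 2 * M * T) ->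
     continuous (fun t => f t (z t))) ->
  exists z : R -> W, z 0 = p /\ forall t, `|t| <= T ->
    `|z t - p| <= 2 * M * T /\ hasd setT z t (f t (z t)).
Proof.
move=> [pW cW] T0 K0 M0 KT fM fK fc.
have MT0 : 0 <= 2 * M * T by rewrite !mulr_ge0// ltW.
have HP (g : R -> W) : exists F : R -> W, continuous g ->
    F 0 = 0 /\ forall t, `|t| < T + 1 -> hasd setT F t (g t).
  have [cg|ncg] := pselect (continuous g); last by exists g.
  by have [F HF] := pW (T + 1) g cg; exists F.
have [P {}HP] := choice HP.
pose cl := clamp T.
have clT s : `|cl s| <= T by exact: clamp_le (ltW T0).
have cl0 : cl 0 = 0 by rewrite /cl clamp_id// normr0 ltW.
pose step (z : R -> W) (t : R) := p + P (fun s => f s (z (cl s))) t.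
pose Inv (z : R -> W) := z 0 = p /\
  forall s t, `|s| <= T -> `|t| <= T -> `|z t - z s| <= 2 * M * `|t - s|.
have Invp z t : Inv z -> `|t| <= T -> `|z t - p| <= 2 * M * T.
  move=> [z0 zl] tT; rewrite -{1}z0 (le_trans (zl 0 t _ tT))//; first by rewrite normr0 ltW.
  by rewrite subr0 ler_wpM2l// mulr_ge0.
have Invc z : Inv z -> continuous (z \o cl).
  move=> [z0 zl]; apply: (@lip_cont R^o W (z \o cl) (2 * M)) => s t.
  rewrite /= (le_trans (zl _ _ (clT _) (clT _)))// ler_wpM2l ?mulr_ge0//.
  exact: clamp_lip.
have fbound t z : `|z - p| <= 2 * M * T -> `|f t z| <= 2 * M.
  move=> zp; rewrite -(subrK (f t p) (f t z)) (le_trans (ler_normD _ _))//.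
  have h := fK t z p zp (ltac:(by rewrite subrr normr0)).
  have : K * `|z - p| <= M.
    apply: (@le_trans _ _ (K * (2 * M * T))); first by rewrite ler_wpM2l.
    have : 2 * M * (K * T) <= 2 * M * 2^-1 by rewrite ler_wpM2l ?mulr_ge0.
    lra.
  have := fM t; lra.
have dstep z : Inv z -> step z 0 = p /\ forall t, `|t| <= T -> hasd setT (step z) t (f t (z t)).
  move=> Iz; have [P0 Pd] := HP _ (fc _ (Invc _ Iz) (fun t => Invp _ _ Iz (clT t))).
  split; first by rewrite /step P0 addr0.
  move=> t tT; have := Pd t (ltac:(by rewrite (le_lt_trans tT)// ltrDl)).
  by move=> /(hasdD (hasd_cst setT p t)); rewrite add0r /= /cl clamp_id.
have Istep z : Inv z -> Inv (step z).
  move=> Iz; have [s0 sd] := dstep _ Iz; split=> // s t.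
  apply: (@mean_value_bound_sym _ _ _ (fun t => f t (z t))) => u uT; split; first exact: sd.
  by apply: fbound; exact: Invp.
pose u k := iter k step (fun=> p).
have Iu k : Inv (u k).
  elim: k => [|k IH]; last exact: Istep.
  by split=> // s t _ _; rewrite /u/= subrr normr0 !mulr_ge0.
pose D := 2 * M * T.
have uS k t : `|t| <= T -> `|u k.+1 t - u k t| <= D * 2^-1 ^+ k.
  elim: k t => [|k IH] t tT.
    by rewrite expr0 mulr1 [u 0%N]/u/=; exact: Invp (Iu 1%N) tT.
  have T00 : `|0 : R| <= T by rewrite normr0 ltW.
  have [s0 sd] := dstep _ (Iu k); have [s0' sd'] := dstep _ (Iu k.+1).
  have := @mean_value_bound_sym _ _ (fun t => u k.+2 t - u k.+1 t)
     (fun t => f t (u k.+1 t) - f t (u k t)) T (K * (D * 2^-1 ^+ k)) _ 0 t T00 tT.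
  rewrite /u /= s0' s0 subrr !subr0 => H; rewrite (le_trans (H _))//.
    move=> s sT; split; first by apply: hasdB; [exact: sd'|exact: sd].
    rewrite (le_trans (fK _ _ _ _ _)) ?ler_wpM2l//; [exact: Invp (Iu k.+1) sT|exact: Invp (Iu k) sT|].
    exact: IH.
  have e0 : 0 <= D * 2^-1 ^+ k by rewrite mulr_ge0// exprn_ge0.
  rewrite exprS.
  have : K * `|t| <= 2^-1 by rewrite (le_trans _ KT)// ler_wpM2l.
  by nra.
have Hl t : exists l : W, `|t| <= T -> forall k, `|u k t - l| <= 2 * D * 2^-1 ^+ k.
  have [tT|] := boolP (`|t| <= T); last by exists p.
  by have [l Hl] := cW (fun k => u k t) D (fun k => uS k t tT); exists l.
have [zh Hzh] := choice Hl.
have T00 : `|0 : R| <= T by rewrite normr0 ltW.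
have Izh : Inv zh.
  split.
    apply/eqP; rewrite -subr_eq0 -normr_le0; apply: (@le0_geom R _ (2 * D)) => k.
    by rewrite distrC -{1}(Iu k).1; exact: Hzh.
  move=> s t sT tT; rewrite -subr_le0; apply: (@le0_geom R _ (4 * D)) => k.
  have h1 := Hzh s sT k; have h2 := Hzh t tT k; have h3 := (Iu k).2 s t sT tT.
  have -> : zh t - zh s = - (u k t - zh t) + (u k t - u k s) + (u k s - zh s) by vlinear R.
  rewrite lerBlDr (le_trans (ler_normD _ _))// (le_trans (lerD (ler_normD _ _) (lexx _)))//.
  rewrite normrN; lra.
exists (step zh); have [s0 sd] := dstep _ Izh; split=> // t tT.
suff E s : `|s| <= T -> step zh s = zh s.
  by split; [rewrite E//; exact: Invp|rewrite E//; exact: sd].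
move=> sT; apply/eqP; rewrite -subr_eq0 -normr_le0; apply: (@le0_geom R _ (2 * D)) => k.
have h1 := Hzh s sT k.+1.
have [s0' sd'] := dstep _ (Iu k).
have := @mean_value_bound_sym _ _ (fun t => step zh t - u k.+1 t)
   (fun t => f t (zh t) - f t (u k t)) T (K * (2 * D * 2^-1 ^+ k)) _ 0 s T00 sT.
rewrite /u /= s0' s0 subrr !subr0 => H.
have {}H : `|step zh s - u k.+1 s| <= K * (2 * D * 2^-1 ^+ k) * `|s|.
  apply: H => r rT; split; first by apply: hasdB; [exact: sd|exact: sd'].
  rewrite (le_trans (fK _ _ _ _ _)) ?ler_wpM2l//; [exact: Invp|exact: Invp (Iu k) rT|].
  by rewrite distrC; exact: Hzh.
have e0 : 0 <= D * 2^-1 ^+ k by rewrite mulr_ge0// exprn_ge0.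
have Ks : K * `|s| <= 2^-1 by rewrite (le_trans _ KT)// ler_wpM2l.
rewrite -(subrK (u k.+1 s) (step zh s)) -addrA (le_trans (ler_normD _ _))//.
rewrite exprS in h1; nra.
Qed.

(** At a maximum of [|e|], the mean value inequality and [K * T <= 2^-1] bound
    [|e|] by its half plus [|e 0| + T * eps]. *)
Lemma gronwall W (e : R -> W) (K eps T : R) : 0 <= T -> 0 <= K -> 0 <= eps -> K * T <= 2^-1 ->
  (forall t, 0 <= t -> t <= T -> exists2 l, hasd `[0, T] e t l & `|l| <= K * `|e t| + eps) ->
  forall t, 0 <= t -> t <= T -> `|e t| <= 2 * (`|e 0| + T * eps).
Proof.
move=> T0 K0 eps0 KT H.
have cont : {within `[0, T], continuous (fun t => `|e t|)}.
  apply/subspace_continuousP => t /=; rewrite in_itv/= => /andP[t0 tT].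
  have [l hl _] := H t t0 tT.
  by apply: cvg_norm; exact: hasd_cvg_within hl.
have [c] := EVT_max T0 cont; rewrite in_itv/= => /andP[c0 cT] cmax.
have B t : 0 <= t -> t <= T -> `|e t| <= `|e c|.
  by move=> t0 tT; apply: cmax; rewrite in_itv/= t0.
have := @mean_value_bound R W e (K * `|e c| + eps) 0 c c0.
rewrite subr0 => h.
have {}h : `|e c - e 0| <= (K * `|e c| + eps) * c.
  apply: h => t t0 tc; have tT := le_trans tc cT.
  have [l hl lb] := H t t0 tT; exists l.
    apply: hasd_sub hl => s /=; rewrite !in_itv/= => /andP[-> /le_trans]; exact.
  by rewrite (le_trans lb)// lerD2r ler_wpM2l// B.
move=> t t0 tT; rewrite (le_trans (B t t0 tT))//.
have : `|e c| <= `|e 0| + (K * `|e c| + eps) * c.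
  rewrite -{1}(subrK (e 0) (e c)) (le_trans (ler_normD _ _))// addrC lerD2l//.
have n0 := normr_ge0 (e c).
have : K * `|e c| * c <= 2^-1 * `|e c|.
  rewrite mulrAC ler_wpM2r// (le_trans _ KT)// ler_wpM2l//.
have : eps * c <= T * eps by rewrite mulrC ler_wpM2r.
by rewrite mulrDl; lra.
Qed.

End Picard.

(** * The flow of a vector field and its linearisation *)

Section Flow.
Context {R : realType} {W : normedModType R}.
Variables (F : W -> W) (dF : W -> W -> W) (z0 : W) (r C : R).
Hypotheses (r0 : 0 < r) (C0 : 0 <= C).
Hypothesis HF : forall x, `|x - z0| < r ->
    [/\ lin (dF x), forall h, `|dF x h| <= C * `|h| &
      forall y, `|y - z0| < r ->
        [/\ `|F y - F x - dF x (y - x)| <= C * `|y - x| ^+ 2,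
            forall h, `|dF x h - dF y h| <= C * `|y - x| * `|h| &
            `|F y - F x| <= C * `|y - x|]].

Lemma dF_continuous (y w : R -> W) : continuous y -> continuous w ->
  (forall t, `|y t - z0| < r) -> continuous (fun t => dF (y t) (w t)).
Proof.
move=> cy cw yr t; apply/cvgrPdist_lt => e e0.
have C1 : 0 < C + 1 by rewrite ltr_wpDl.
have e1 : 0 < e / (2 * (C + 1)) by rewrite divr_gt0// mulr_gt0.
have w1 : 0 < 1 + `|w t| by rewrite ltr_pwDl.
have e2 : 0 < e / (2 * (C + 1)) / (1 + `|w t|) by rewrite divr_gt0.
have [lt_ bt Ht] := HF (yr t).
near=> s.
have h1 : `|w t - w s| < e / (2 * (C + 1)).
  by near: s; have /cvgrPdist_lt := cw t; exact.
have h2 : `|y t - y s| < e / (2 * (C + 1)) / (1 + `|w t|).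
  by near: s; have /cvgrPdist_lt := cy t; exact.
have [ls bs Hs] := HF (yr s).
have [_ l2 _] := Hs _ (yr t).
have -> : dF (y t) (w t) - dF (y s) (w s) =
  - (dF (y s) (w t) - dF (y t) (w t)) + dF (y s) (w t - w s).
  by rewrite (linB ls); vlinear R.
rewrite (le_lt_trans (ler_normD _ _))// normrN.
move: h1 h2; rewrite !ltr_pdivlMr ?mulr_gt0// => h1 h2.
have a1 := l2 (w t); have a2 := bs (w t - w s).
have n1 := normr_ge0 (y t - y s); have n2 := normr_ge0 (w t - w s); have n3 := normr_ge0 (w t).
set A := `|y t - y s| in n1 h2 a1; set B := `|w t - w s| in n2 h1 a2; set E := `|w t| in n3 w1 h2 a1.
have b1 : C * A * E <= A * (1 + E) * (C + 1).
  have AE : 0 <= A * E by rewrite mulr_ge0.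
  have CA : 0 <= C * A by rewrite mulr_ge0.
  have -> : A * (1 + E) * (C + 1) = C * A * E + A * E + C * A + A by ring.
  lra.
have b2 : C * B <= B * (C + 1) by have := mulr_ge0 C0 n2; lra.
lra.
Unshelve. all: by end_near. Qed.

Hypothesis ode_spaceW : ode_space W.

(** [D] is defined as the solution of the linearised equation along each
    trajectory. That it is the derivative of the flow is shown by
    [sol_taylor]. *)
Theorem flow_exists (k : R) : 0 < k -> exists rho T : R,
  exists Phi : R -> W -> W, exists D : R -> W -> W -> W,
  [/\ 0 < rho, 2 * rho <= r, 0 < T, T <= 1 & C * T <= k] /\
  forall p, `|p - z0| < rho ->
   [/\ Phi 0 p = p, forall t, `|t| <= T -> `|Phi t p - z0| < r /\ hasd setT (Phi^~ p) t (F (Phi t p)),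
     forall h, D 0 p h = h &
     forall h t, `|t| <= T -> hasd setT (fun t => D t p h) t (dF (Phi t p) (D t p h))].
Proof.
move=> k0.
have z0r : `|z0 - z0| < r by rewrite subrr normr0.
pose M := `|F z0| + C * r + 1.
have M0 : 0 < M by rewrite ltr_wpDl// addr_ge0// mulr_ge0// ltW.
pose q := Num.min 1 (Num.min (r / (8 * M)) (Num.min (k / (C + 1)) ((2 * (C + 1))^-1))).
have C1 : 0 < C + 1 by rewrite ltr_wpDl.
have q0 : 0 < q.
  by rewrite !lt_min ltr01 !divr_gt0 ?mulr_gt0//= invr_gt0 mulr_gt0.
have q1 : q <= 1 by rewrite ge_min lexx.
have q2 : q * (8 * M) <= r by rewrite -ler_pdivlMr ?mulr_gt0// !ge_min lexx !orbT.
have q3 : q * (C + 1) <= k by rewrite -ler_pdivlMr// !ge_min lexx !orbT.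
have q4 : q * (2 * (C + 1)) <= 1 by rewrite -ler_pdivlMr ?mulr_gt0// div1r !ge_min lexx !orbT.
have FM z : `|z - z0| < r -> `|F z| <= M.
  move=> zr; have [_ _ /(_ _ zr)[_ _ l]] := HF z0r.
  rewrite -(subrK (F z0) (F z)) (le_trans (ler_normD _ _))//.
  have : C * `|z - z0| <= C * r by rewrite ler_wpM2l// ltW.
  rewrite /M; lra.
have CT : C * q <= 2^-1 by lra.
have r0' : 0 < r := r0.
have ballp p z : `|p - z0| < r / 2 -> `|z - p| <= 2 * M * q -> `|z - z0| < r.
  move=> pr zp; rewrite -(subrK p z) -addrA (le_lt_trans (ler_normD _ _))//; lra.
have ballpp (p : W) : `|p - p| <= 2 * M * q by rewrite subrr normr0 !mulr_ge0// ltW.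
have HPhi p : exists z : R -> W, `|p - z0| < r / 2 ->
    z 0 = p /\ forall t, `|t| <= q -> `|z t - p| <= 2 * M * q /\ hasd setT z t (F (z t)).
  have [pr|_] := boolP (`|p - z0| < r / 2); last by exists (fun=> p).
  have [| | |z Hz] := @picard R W (fun _ => F) C M q p ode_spaceW q0 C0 (ltW M0) CT; last by exists z.
  - by move=> _; apply: FM; exact: ballp (ballpp p).
  - move=> _ z z' /(ballp _ _ pr) zr /(ballp _ _ pr) z'r.
    by have [_ _ /(_ _ zr)[_ _]] := HF z'r.
  - move=> z cz zp t; apply/cvgrPdist_lt => e e0.
    have e1 : 0 < e / (C + 1) by rewrite divr_gt0.
    have /cvgrPdist_lt/(_ _ e1) := cz t; apply: filterS => s.
    rewrite ltr_pdivlMr// => h.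
    have [_ _ /(_ _ (ballp _ _ pr (zp t)))[_ _ l]] := HF (ballp _ _ pr (zp s)).
    rewrite (le_lt_trans l)//; have := normr_ge0 (z t - z s); lra.
have [Phi0 HP] := choice HPhi; pose Phi t p := Phi0 p t.
have Phir p t : `|p - z0| < r / 2 -> `|t| <= q -> `|Phi t p - z0| < r.
  by move=> pr tq; have [_ /(_ _ tq)[/(ballp _ _ pr)]] := HP p pr.
have HD (ph : W * W) : exists w : R -> W, `|ph.1 - z0| < r / 2 ->
    w 0 = ph.2 /\ forall t, `|t| <= q -> hasd setT w t (dF (Phi t ph.1) (w t)).
  case: ph => p h /=.
  have [pr|_] := boolP (`|p - z0| < r / 2); last by exists (fun=> p).
  have yr t : `|Phi (clamp q t) p - z0| < r by apply: Phir => //; exact: clamp_le (ltW q0).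
  have cy : continuous (fun t => Phi (clamp q t) p).
    apply: (@lip_cont R R^o W _ M) => s t.
    rewrite (le_trans (@mean_value_bound_sym R W (Phi^~ p) (fun t => F (Phi t p)) q M _ _ _ _ _))//.
    - move=> u uq; split; last by apply: FM; exact: Phir.
      by have [_ /(_ _ uq)[_]] := HP p pr.
    - exact: clamp_le (ltW q0).
    - exact: clamp_le (ltW q0).
    - by rewrite ler_wpM2l ?(ltW M0)// clamp_lip.
  have [| | |w [w0 Hw]] := @picard R W (fun t => dF (Phi (clamp q t) p)) C (C * `|h|) q h ode_spaceW q0 C0 (mulr_ge0 C0 (normr_ge0 h)) CT.
  - by move=> t; have [_ b _] := HF (yr t).
  - by move=> t z z' _ _; have [l b _] := HF (yr t); rewrite -(linB l).
  - by move=> z cz _; exact: (dF_continuous cy cz).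
  exists w => _; split=> // t tq; have [_] := Hw _ tq; by rewrite clamp_id.
have [D0 HD0] := choice HD.
exists (r / 2), q, Phi, (fun t p h => D0 (p, h) t); split.
  split=> //; [by rewrite divr_gt0|lra|].
  by rewrite (le_trans _ q3)// mulrC ler_wpM2l ?ltW//; lra.
move=> p pr; split.
- by have [] := HP p pr.
- by move=> t tq; split; [exact: Phir|have [_ /(_ _ tq)[_]] := HP p pr].
- by move=> h; have [] := HD0 (p, h) pr.
- by move=> h t tq; have [_ /(_ _ tq)] := HD0 (p, h) pr.
Qed.

Section Consequences.
Variables (T : R).
Hypotheses (T0 : 0 <= T) (T1 : T <= 1) (CT : C * T <= 2^-1).

Lemma sol_stable (y1 y2 : R -> W) :
  (forall t, 0 <= t -> t <= T -> `|y1 t - z0| < r /\ hasd `[0, T] y1 t (F (y1 t))) ->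
  (forall t, 0 <= t -> t <= T -> `|y2 t - z0| < r /\ hasd `[0, T] y2 t (F (y2 t))) ->
  forall t, 0 <= t -> t <= T -> `|y1 t - y2 t| <= 2 * `|y1 0 - y2 0|.
Proof.
move=> H1 H2 t t0 tT.
have := @gronwall R W (fun t => y1 t - y2 t) C 0 T T0 C0 (lexx _) CT.
rewrite mulr0 addr0; apply => // s s0 sT.
have [a1 b1] := H1 s s0 sT; have [a2 b2] := H2 s s0 sT.
exists (F (y1 s) - F (y2 s)); first exact: hasdB.
by rewrite addr0; have [_ _ /(_ _ a1)[_ _]] := HF a2.
Qed.

Lemma lin_sol_bound (y w : R -> W) :
  (forall t, 0 <= t -> t <= T -> `|y t - z0| < r /\ hasd `[0, T] w t (dF (y t) (w t))) ->
  forall t, 0 <= t -> t <= T -> `|w t| <= 2 * `|w 0|.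
Proof.
move=> H t t0 tT; have := @gronwall R W w C 0 T T0 C0 (lexx _) CT.
rewrite mulr0 addr0; apply => // s s0 sT.
have [a b] := H s s0 sT; exists (dF (y s) (w s)) => //.
by rewrite addr0; have [_ ? _] := HF a.
Qed.

(** The remainder satisfies the linearised equation up to the Taylor remainder
    of [F], which is quadratic in [y2 - y1]; Gronwall's inequality bounds it.
    *)
Lemma sol_taylor (y1 y2 w : R -> W) :
  (forall t, 0 <= t -> t <= T -> `|y1 t - z0| < r /\ hasd `[0, T] y1 t (F (y1 t))) ->
  (forall t, 0 <= t -> t <= T -> `|y2 t - z0| < r /\ hasd `[0, T] y2 t (F (y2 t))) ->
  (forall t, 0 <= t -> t <= T -> hasd `[0, T] w t (dF (y1 t) (w t))) ->
  w 0 = y2 0 - y1 0 ->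
  forall t, 0 <= t -> t <= T -> `|y2 t - y1 t - w t| <= 4 * `|y2 0 - y1 0| ^+ 2.
Proof.
move=> H1 H2 Hw w0 t t0 tT.
set d := `|y2 0 - y1 0|; have d0 : 0 <= d := normr_ge0 _.
have e0 : 0 <= C * (2 * d) ^+ 2 by rewrite mulr_ge0// sqr_ge0.
have := @gronwall R W (fun t => y2 t - y1 t - w t) C (C * (2 * d) ^+ 2) T T0 C0 e0 CT.
rewrite w0 subrr normr0 add0r => h; rewrite (le_trans (h _ t t0 tT))//; last first.
  have : C * T * (2 * d) ^+ 2 <= 2^-1 * (2 * d) ^+ 2 by rewrite ler_wpM2r// sqr_ge0.
  by rewrite exprMn; lra.
move=> s s0 sT; have [a1 b1] := H1 s s0 sT; have [a2 b2] := H2 s s0 sT.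
exists (F (y2 s) - F (y1 s) - dF (y1 s) (w s)).
  by apply: hasdB; [exact: hasdB|exact: Hw].
have [l b /(_ _ a2)[m _ _]] := HF a1.
have -> : F (y2 s) - F (y1 s) - dF (y1 s) (w s) =
  dF (y1 s) (y2 s - y1 s - w s) + (F (y2 s) - F (y1 s) - dF (y1 s) (y2 s - y1 s)).
  by rewrite (linB l (y2 s - y1 s)); vlinear R.
rewrite (le_trans (ler_normD _ _))// lerD// (le_trans m)// ler_wpM2l//.
rewrite lerXn2r ?nnegrE ?mulr_ge0//.
exact: sol_stable H2 H1 s s0 sT.
Qed.

Lemma lin_sol_lip (y1 y2 w1 w2 : R -> W) :
  (forall t, 0 <= t -> t <= T -> `|y1 t - z0| < r /\ hasd `[0, T] y1 t (F (y1 t))) ->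
  (forall t, 0 <= t -> t <= T -> `|y2 t - z0| < r /\ hasd `[0, T] y2 t (F (y2 t))) ->
  (forall t, 0 <= t -> t <= T -> hasd `[0, T] w1 t (dF (y1 t) (w1 t))) ->
  (forall t, 0 <= t -> t <= T -> hasd `[0, T] w2 t (dF (y2 t) (w2 t))) ->
  w1 0 = w2 0 ->
  forall t, 0 <= t -> t <= T -> `|w1 t - w2 t| <= 4 * `|y1 0 - y2 0| * `|w1 0|.
Proof.
move=> H1 H2 Hw1 Hw2 w0 t t0 tT.
set d := `|y1 0 - y2 0|; set h := `|w1 0|.
have d0 : 0 <= d := normr_ge0 _; have h0 : 0 <= h := normr_ge0 _.
have e0 : 0 <= C * (2 * d) * (2 * h) by rewrite !mulr_ge0.
have := @gronwall R W (fun t => w1 t - w2 t) C (C * (2 * d) * (2 * h)) T T0 C0 e0 CT.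
rewrite w0 subrr normr0 add0r => hh; rewrite (le_trans (hh _ t t0 tT))//; last first.
  have : C * T * (d * h) <= 2^-1 * (d * h) by rewrite ler_wpM2r// mulr_ge0.
  lra.
move=> s s0 sT; have [a1 b1] := H1 s s0 sT; have [a2 b2] := H2 s s0 sT.
exists (dF (y1 s) (w1 s) - dF (y2 s) (w2 s)).
  by apply: hasdB; [exact: Hw1|exact: Hw2].
have [l b _] := HF a2; have [_ _ /(_ _ a2)[_ m _]] := HF a1.
have -> : dF (y1 s) (w1 s) - dF (y2 s) (w2 s) =
  dF (y2 s) (w1 s - w2 s) + (dF (y1 s) (w1 s) - dF (y2 s) (w1 s)).
  by rewrite (linB l); vlinear R.
rewrite (le_trans (ler_normD _ _))// lerD// (le_trans (m _))//.
rewrite -mulrA -[leRHS]mulrA ler_wpM2l// ler_pM//.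
  by rewrite distrC; exact: sol_stable H1 H2 s s0 sT.
have H t' : 0 <= t' -> t' <= T -> `|y1 t' - z0| < r /\ hasd `[0, T] w1 t' (dF (y1 t') (w1 t')).
  by move=> p q; split; [case: (H1 t' p q)|exact: Hw1].
exact: lin_sol_bound H s s0 sT.
Qed.

End Consequences.
End Flow.

(** * Closure properties of maps with a Lipschitz derivative *)

Section C11e.
Context {R : realType}.
Implicit Types V W : normedModType R.

Definition C11e V W (f : V -> W) (x0 : V) := exists df, C11 f df x0.

Lemma C11e_ext V W (f g : V -> W) x0 : (\forall x \near x0, f x = g x) ->
  C11e f x0 -> C11e g x0.
Proof.
move=> fg [df cf]; exists df; apply: C11_ext fg _ cf.
by apply/near_distP; exists 1.
Qed.

Lemma C11eD V W (f g : V -> W) x0 : C11e f x0 -> C11e g x0 -> C11e (fun x => f x + g x) x0.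
Proof. by move=> [df cf] [dg cg]; eexists; exact: C11D cf cg. Qed.

Lemma C11eM V (f g : V -> R^o) x0 : C11e f x0 -> C11e g x0 -> C11e (fun x => f x * g x : R^o) x0.
Proof. by move=> [df cf] [dg cg]; eexists; exact: C11_bilin bilin_mul cf cg. Qed.

Lemma C11eZ V W (f : V -> R^o) (g : V -> W) x0 : C11e f x0 -> C11e g x0 ->
  C11e (fun x => f x *: g x) x0.
Proof. by move=> [df cf] [dg cg]; eexists; exact: (C11_bilin (bilin_scale _) cf cg). Qed.

Lemma C11eV V (f : V -> R^o) x0 : f x0 != 0 -> C11e f x0 -> C11e (fun x => (f x)^-1 : R^o) x0.
Proof. by move=> f0 [df cf]; eexists; exact: C11V f0 cf. Qed.

Lemma C11e_cst V W (a : W) (x0 : V) : C11e (fun=> a) x0.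
Proof. by eexists; exact: C11_cst. Qed.

Lemma C11eN V W (f : V -> W) x0 : C11e f x0 -> C11e (fun x => - f x) x0.
Proof.
move=> cf; apply: C11e_ext (C11eZ (C11e_cst (-1 : R^o) x0) cf).
by apply/near_distP; exists 1 => // x _; rewrite scaleN1r.
Qed.

Lemma C11e_sum V W (I : Type) (r : seq I) (P : pred I) (f : I -> V -> W) x0 :
  (forall i, C11e (f i) x0) -> C11e (fun x => \sum_(i <- r | P i) f i x) x0.
Proof.
move=> H; elim: r => [|i r IH].
  apply: C11e_ext (C11e_cst (0 : W) x0); apply/near_distP; exists 1 => // x _.
  by rewrite big_nil.
case Pi : (P i).
  apply: C11e_ext (C11eD (H i) IH); apply/near_distP; exists 1 => // x _.
  by rewrite big_cons Pi.
by apply: C11e_ext IH; apply/near_distP; exists 1 => // x _; rewrite big_cons Pi.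
Qed.

Lemma C11e_prod V (I : Type) (r : seq I) (P : pred I) (f : I -> V -> R^o) x0 :
  (forall i, C11e (f i) x0) -> C11e (fun x => \prod_(i <- r | P i) f i x : R^o) x0.
Proof.
move=> H; elim: r => [|i r IH].
  apply: C11e_ext (C11e_cst (1 : R^o) x0); apply/near_distP; exists 1 => // x _.
  by rewrite big_nil.
case Pi : (P i).
  apply: C11e_ext (C11eM (H i) IH); apply/near_distP; exists 1 => // x _.
  by rewrite big_cons Pi.
by apply: C11e_ext IH; apply/near_distP; exists 1 => // x _; rewrite big_cons Pi.
Qed.

Lemma C11e_det V n (A : V -> 'M[R]_n) x0 :
  (forall i j, C11e (fun x => A x i j : R^o) x0) -> C11e (fun x => \det (A x) : R^o) x0.
Proof.
move=> H; apply: C11e_sum => s; apply: C11eM; first exact: C11e_cst.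
by apply: C11e_prod => i; exact: H.
Qed.

(** Cramer's rule expresses the inverse through determinants, which are
    polynomial in the entries. *)
Lemma C11e_invmx V n (A : V -> 'M[R]_n) x0 i j : (\forall x \near x0, A x \in unitmx) ->
  (forall i j, C11e (fun x => A x i j : R^o) x0) -> C11e (fun x => invmx (A x) i j : R^o) x0.
Proof.
move=> uA H.
apply: (@C11e_ext _ _ (fun x => (\det (A x))^-1 * cofactor (A x) j i : R^o)).
  by apply: filterS uA => x Ax; rewrite /invmx Ax !mxE.
apply: C11eM.
  apply: C11eV; last exact: C11e_det.
  by have := nbhs_singleton uA; rewrite unitmxE unitfE.
apply: C11eM; first exact: C11e_cst.
apply: C11e_det => k l; apply: C11e_ext (H (lift j k) (lift i l)).
by apply/near_distP; exists 1 => // x _; rewrite !mxE.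
Qed.

Lemma C11e_rV V n (f : V -> 'rV[R]_n) x0 :
  (forall j, C11e (fun x => f x 0 j : R^o) x0) -> C11e f x0.
Proof.
move=> H; apply: (@C11e_ext _ _ (fun x => \sum_j f x 0 j *: (delta_mx 0 j : 'rV[R]_n))).
  by apply/near_distP; exists 1 => // x _; rewrite -row_sum_delta.
apply: C11e_sum => j; apply: C11eZ; first exact: H.
exact: C11e_cst.
Qed.

Lemma C11e_lin V W (U : normedModType R) (L : V -> W) (C : R) (f : W -> U) x0 : lin L -> (forall h, `|L h| <= C * `|h|) ->
  C11e f (L x0) -> C11e (fun x => f (L x)) x0.
Proof.
move=> linL LC [df cf]; eexists.
exact: (C11_comp (C11_lin x0 linL LC) cf).
Qed.

Lemma C11_entry V m n (f : V -> 'M[R]_(m, n)) df x0 i j : C11 f df x0 ->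
  C11 (fun x => f x i j : R^o) (fun x h => df x h i j) x0.
Proof.
move=> cf.
apply: (@C11_comp _ _ _ R^o f df (fun M : 'M[R]_(m, n) => M i j) (fun _ M => M i j) x0 cf).
apply: (@C11_lin _ _ R^o _ _ 1) => [a u v|h]; first by rewrite !mxE.
by rewrite mul1r mx_entry_le.
Qed.

Lemma lin_fst V W : lin (fun p : V * W => p.1). Proof. by []. Qed.
Lemma lin_snd V W : lin (fun p : V * W => p.2). Proof. by []. Qed.

End C11e.

(** * Inner products given by a matrix *)

Section InnerProduct.
Context {R : realType} {n : nat}.
Implicit Types (A : 'M[R]_n) (u v w : 'rV[R]_n).

Definition ip A u v : R := (u *m A *m v^T) 0 0.

Lemma ipE A u v : ip A u v = \sum_i \sum_j u 0 i * A i j * v 0 j.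
Proof.
rewrite /ip mxE exchange_big; apply: eq_bigr => j _ /=.
by rewrite !mxE mulr_suml.
Qed.

Lemma ipDl A u v w : ip A (u + v) w = ip A u w + ip A v w.
Proof. by rewrite /ip !mulmxDl mxE. Qed.
Lemma ipDr A u v w : ip A w (u + v) = ip A w u + ip A w v.
Proof. by rewrite /ip linearD /= mulmxDr mxE. Qed.
Lemma ipZl A a u w : ip A (a *: u) w = a * ip A u w.
Proof. by rewrite /ip -!scalemxAl mxE. Qed.
Lemma ipZr A a u w : ip A w (a *: u) = a * ip A w u.
Proof. by rewrite /ip linearZ /= -scalemxAr mxE. Qed.
Lemma ipNl A u w : ip A (- u) w = - ip A u w.
Proof. by rewrite -scaleN1r ipZl mulN1r. Qed.
Lemma ipNr A u w : ip A w (- u) = - ip A w u.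
Proof. by rewrite -scaleN1r ipZr mulN1r. Qed.
Lemma ip0l A w : ip A 0 w = 0.
Proof. by rewrite /ip !mul0mx mxE. Qed.
Lemma ip0r A w : ip A w 0 = 0.
Proof. by rewrite /ip trmx0 mulmx0 mxE. Qed.
Lemma ip0m u v : ip 0 u v = 0.
Proof. by rewrite /ip mulmx0 mul0mx mxE. Qed.
Lemma ipC A u v : A^T = A -> ip A u v = ip A v u.
Proof.
move=> sA; have -> : ip A u v = ((u *m A *m v^T)^T) 0 0 by rewrite mxE.
by rewrite !trmx_mul trmxK sA mulmxA.
Qed.
Lemma bilin_mulmx m p q : bilin (fun (A : 'M[R]_(m, p)) (B : 'M[R]_(p, q)) => A *m B).
Proof.
split=> [A a u v|B a u v|].
- by rewrite mulmxDr -scalemxAr.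
- by rewrite mulmxDl -scalemxAl.
exists p%:R => // A B; apply: mx_norm_le => [|i j]; first by rewrite !mulr_ge0.
rewrite mxE (le_trans (ler_norm_sum _ _ _))//.
rewrite -mulrA -[p%:R]/(p%:R) mulr_natl -[X in _ *+ X](card_ord p) -sumr_const ler_sum// => k _.
by rewrite normrM ler_pM// mx_entry_le.
Qed.

Lemma bilin_dot : bilin (fun u v : 'rV[R]_n => (u *m v^T) 0 0 : R^o).
Proof.
split=> [u a v w|v a u w|].
- by rewrite linearD /= linearZ /= mulmxDr -scalemxAr !mxE.
- by rewrite mulmxDl -scalemxAl !mxE.
exists n%:R => // u v; rewrite mxE (le_trans (ler_norm_sum _ _ _))//.
rewrite -mulrA mulr_natl -[X in _ *+ X](card_ord n) -sumr_const ler_sum// => k _.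
by rewrite normrM !mxE ler_pM// mx_entry_le.
Qed.

Lemma hasd_ip (A : set R) (G : R -> 'M[R]_n) (u v : R -> 'rV[R]_n) t G' u' v' :
  hasd A G t G' -> hasd A u t u' -> hasd A v t v' ->
  hasd A (fun s => ip (G s) (u s) (v s) : R^o) t
    (ip G' (u t) (v t) + ip (G t) u' (v t) + ip (G t) (u t) v').
Proof.
move=> hG hu hv.
have := hasd_bilin bilin_dot (hasd_bilin (bilin_mulmx _ _ _) hu hG) hv.
by rewrite mulmxDl [X in _ + X]mxE [X in hasd _ _ _ X]addrC.
Qed.

Lemma C11_ip (V : normedModType R) (G : V -> 'M[R]_n) (u v : V -> 'rV[R]_n) dG du dv x0 :
  C11 G dG x0 -> C11 u du x0 -> C11 v dv x0 ->
  C11 (fun x => ip (G x) (u x) (v x) : R^o)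
   (fun x h => ip (dG x h) (u x) (v x) + ip (G x) (du x h) (v x) + ip (G x) (u x) (dv x h)) x0.
Proof.
move=> cG cu cv.
have := C11_bilin bilin_dot (C11_bilin (bilin_mulmx _ _ _) cu cG) cv.
apply: C11_ext; first by apply/near_distP; exists 1.
apply/near_distP; exists 1 => // x _ h.
by rewrite mulmxDl [X in _ + X]mxE [LHS]addrC.
Qed.

Lemma ip_le A u v : `|ip A u v| <= (n%:R * n%:R) * `|A| * `|u| * `|v|.
Proof.
have [_ _ [K K0 _]] := bilin_dot.
rewrite ipE (le_trans (ler_norm_sum _ _ _))//.
apply: (@le_trans _ _ (\sum_(i < n) (n%:R * `|A| * `|u| * `|v|))); last first.
  by rewrite sumr_const card_ord -[leLHS]mulr_natl !mulrA.
apply: ler_sum => i _; rewrite (le_trans (ler_norm_sum _ _ _))//.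
apply: (@le_trans _ _ (\sum_(j < n) (`|A| * `|u| * `|v|))); last first.
  by rewrite sumr_const card_ord -[leLHS]mulr_natl !mulrA.
apply: ler_sum => j _; rewrite !normrM; apply: ler_pM => //; last exact: mx_entry_le.
by rewrite mulrC; apply: ler_pM => //; exact: mx_entry_le.
Qed.

End InnerProduct.

(** * The geodesic equation in a chart *)

Section ChartGeometry.
Context {R : realType} {n : nat} {M : topologicalType}.
Variable X : riemannian_manifold R n M.
Implicit Types (c : chart X) (x u v w : 'rV[R]_n).

Definition gram_derivative c x h : 'M[R]_n := 'D_h (gram c) x.
(** Locked, so that unification treats it as an atom. *)
Definition DG := locked gram_derivative.

Lemma DGE c x : DG c x = fun h => 'D_h (gram c) x.
Proof. by rewrite /DG -lock. Qed.

Lemma DGE2 c : DG c = fun x h => 'D_h (gram c) x.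
Proof. by rewrite /DG -lock. Qed.

Lemma gram_diff c x : cod c x -> differentiable (gram c) x.
Proof. by move=> cx; have [h _] := gram_smooth c 1; exact: h. Qed.

Lemma gram_C11 c x : cod c x -> C11 (gram c) (DG c) x.
Proof. by move=> cx; rewrite DGE2; apply: Ck2_C11 (@cod_open _ _ _ X c) (gram_smooth c 2) cx. Qed.

Lemma DG_C11e c x v : cod c x -> C11e (fun y => DG c y v) x.
Proof.
move=> cx; rewrite DGE2; eexists; apply: Ck2_C11 (@cod_open _ _ _ X c) _ cx.
by have [_] := gram_smooth c 3; exact.
Qed.

Lemma dgramE c x i j l : cod c x -> dgram c x i j l = DG c x (delta_mx 0 i) j l.
Proof.
move=> cx; rewrite DGE derive_mx ?mxE//.
by apply: diff_derivable; exact: gram_diff.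
Qed.

Lemma DG_sum c x h : cod c x -> DG c x h = \sum_i h 0 i *: DG c x (delta_mx 0 i).
Proof. by move=> cx; rewrite !DGE; apply: derive_sum_delta; exact: gram_diff. Qed.

Lemma DG_lin c x : cod c x -> lin (DG c x).
Proof. by move=> cx; rewrite DGE; apply: derive_lin; exact: gram_diff. Qed.

Lemma ip_gt0 c x v : cod c x -> v != 0 -> 0 < ip (gram c x) v v.
Proof. by move=> cx v0; exact: gram_pos. Qed.

Lemma ip_ge0 c x v : cod c x -> 0 <= ip (gram c x) v v.
Proof.
by move=> cx; have [->|/(ip_gt0 cx)/ltW//] := eqVneq v 0; rewrite ip0l.
Qed.

Lemma ip_gramC c x u v : cod c x -> ip (gram c x) u v = ip (gram c x) v u.
Proof. by move=> cx; apply: ipC; exact: gram_sym. Qed.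

Lemma gram_unit c x : cod c x -> gram c x \in unitmx.
Proof.
move=> cx; rewrite unitmxE unitfE; apply/det0P => -[v v0 vG].
by have := ip_gt0 cx v0; rewrite /ip vG mul0mx mxE ltxx.
Qed.

(** Pairing with a vector removes the inverse of the metric from the
    Christoffel symbols. *)
Lemma connection_ip c x u w : cod c x ->
  ip (gram c x) (connection_term c x u u) w =
  ip (DG c x u) u w - 2^-1 * ip (DG c x w) u u.
Proof.
move=> cx.
pose S : 'rV[R]_n := \row_l \sum_i \sum_j
  (dgram c x i j l + dgram c x j i l - dgram c x l i j) * u 0 i * u 0 j.
have -> : connection_term c x u u = 2^-1 *: (S *m (invmx (gram c x))^T).
  apply/rowP => k; rewrite !mxE.
  under [in RHS]eq_bigr do rewrite !mxE mulr_suml.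
  rewrite [in RHS]exchange_big mulr_sumr; apply: eq_bigr => i _ /=.
  under [in RHS]eq_bigr do rewrite mulr_suml.
  rewrite [in RHS]exchange_big mulr_sumr; apply: eq_bigr => j _ /=.
  rewrite /christoffel -!mulrA mulr_suml; congr (_ * _); apply: eq_bigr => l _.
  by ring.
rewrite ipZl /ip trmx_inv gram_sym// -mulmxA -mulmxA [invmx _ *m _]mulmxA mulVmx ?gram_unit//.
rewrite mul1mx mxE.
have E1 : ip (DG c x u) u w = \sum_l \sum_i \sum_j dgram c x i j l * u 0 i * u 0 j * w 0 l.
  rewrite ipE exchange_big; apply: eq_bigr => l _ /=; rewrite exchange_big /=.
  apply: eq_bigr => j _; rewrite DG_sum// summxE mulr_sumr mulr_suml.
  by apply: eq_bigr => i _; rewrite mxE dgramE//; ring.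
have E2 : ip (DG c x w) u u = \sum_l \sum_i \sum_j dgram c x l i j * u 0 i * u 0 j * w 0 l.
  rewrite ipE [RHS]exchange_big; apply: eq_bigr => i _ /=; rewrite exchange_big /=.
  apply: eq_bigr => j _; rewrite DG_sum// summxE mulr_sumr mulr_suml.
  by apply: eq_bigr => l _; rewrite mxE dgramE//; ring.
have E3 : ip (DG c x u) u w = \sum_l \sum_i \sum_j dgram c x j i l * u 0 i * u 0 j * w 0 l.
  rewrite E1; apply: eq_bigr => l _; rewrite exchange_big /=.
  by apply: eq_bigr => i _; apply: eq_bigr => j _; ring.
have -> : \sum_l S 0 l * w^T l 0 = ip (DG c x u) u w + ip (DG c x u) u w - ip (DG c x w) u u.
  rewrite {1}E1 E3 E2 -big_split -sumrB; apply: eq_bigr => l _ /=.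
  rewrite -big_split -sumrB !mxE mulr_suml; apply: eq_bigr => i _ /=.
  rewrite -big_split -sumrB mulr_suml; apply: eq_bigr => j _ /=.
  by ring.
by rewrite /ip; lra.
Qed.

(** The Euler-Lagrange expression of the energy, paired with [w], where [u] is
    the velocity and [a] the acceleration. Free of inverse matrices, it has a
    simple transformation law under changes of chart. *)
Definition euler_lagrange c x u a w := ip (gram c x) a w + ip (DG c x u) u w - 2^-1 * ip (DG c x w) u u.

Lemma geodesic_euler_lagrange c x u a : cod c x ->
  a + connection_term c x u u = 0 <-> forall w, euler_lagrange c x u a w = 0.
Proof.
move=> cx; have E w : euler_lagrange c x u a w = ip (gram c x) (a + connection_term c x u u) w.
  by rewrite ipDl connection_ip// /euler_lagrange addrA.
split=> [a0 w|H]; first by rewrite E a0 ip0l.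
apply/eqP; apply: contraT => /(ip_gt0 cx); rewrite -E H ltxx//.
Qed.

Lemma connection_C11e c (z0 : 'rV[R]_n * 'rV[R]_n) : cod c z0.1 ->
  C11e (fun z : 'rV[R]_n * 'rV[R]_n => connection_term c z.1 z.2 z.2) z0.
Proof.
move=> cz; apply: C11e_rV => k.
apply: (@C11e_ext _ _ _ (fun z : 'rV[R]_n * 'rV[R]_n => \sum_i \sum_j
   christoffel c z.1 k i j * z.2 0 i * z.2 0 j : R^o)).
  by apply/near_distP; exists 1 => // z _; rewrite mxE.
have Hc i j : C11e (fun z : 'rV[R]_n * 'rV[R]_n => christoffel c z.1 k i j : R^o) z0.
  apply: (@C11e_lin _ _ _ _ (fun p => p.1) 1 (fun x => christoffel c x k i j : R^o)).
  - exact: lin_fst.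
  - by move=> h; rewrite mul1r pair_norm1.
  apply: C11eM; first exact: C11e_cst.
  apply: C11e_sum => l; apply: C11eM.
    apply: C11e_invmx.
      have : \forall x \near z0.1, cod c x by exact: open_nbhs_nbhs (conj (@cod_open _ _ _ X c) cz).
      by apply: filterS => x; exact: gram_unit.
    by move=> i' j'; eexists; apply: C11_entry; exact: gram_C11.
  have Hd i' j' l' : C11e (fun x => dgram c x i' j' l' : R^o) z0.1.
    have [df cf] := DG_C11e (delta_mx 0 i') cz.
    apply: (@C11e_ext _ _ _ (fun x => DG c x (delta_mx 0 i') j' l' : R^o)).
      have : \forall x \near z0.1, cod c x by exact: open_nbhs_nbhs (conj (@cod_open _ _ _ X c) cz).
      by apply: filterS => x cx; rewrite dgramE.
    by eexists; exact: C11_entry cf.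
  by apply: C11eD; [apply: C11eD|apply: C11eN]; exact: Hd.
have Hs i : C11e (fun z : 'rV[R]_n * 'rV[R]_n => z.2 0 i : R^o) z0.
  eexists; apply: (@C11_entry _ _ _ _ (fun z : 'rV[R]_n * 'rV[R]_n => z.2)).
  apply: (@C11_lin _ _ _ _ _ 1); first exact: lin_snd.
  by move=> h; rewrite mul1r pair_norm2.
apply: C11e_sum => i; apply: C11e_sum => j.
by apply: C11eM; [apply: C11eM|].
Qed.

End ChartGeometry.

(** * The exponential map in a chart *)

Section ChartExp.
Context {R : realType} {n : nat} {M : topologicalType}.
Variable X : riemannian_manifold R n M.
Implicit Types (c : chart X) (x u v w : 'rV[R]_n).
Local Notation E := 'rV[R]_n.

Lemma hasd_setT_unique (W : normedModType R) (f : R -> W) t l m :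
  hasd setT f t l -> hasd setT f t m -> l = m.
Proof. by move=> /hasd_derive[_ <-] /hasd_derive[_ <-]. Qed.

Lemma connection_scale c x u (a : R) :
  connection_term c x (a *: u) (a *: u) = a ^+ 2 *: connection_term c x u u.
Proof.
apply/rowP => k; rewrite !mxE mulr_sumr; apply: eq_bigr => i _.
by rewrite mulr_sumr; apply: eq_bigr => j _; rewrite !mxE; ring.
Qed.

Lemma connection0 c x : connection_term c x 0 0 = 0.
Proof. by have := connection_scale c x 0 0; rewrite !scale0r expr0n scale0r. Qed.

(** The geodesic equation as a first-order system in position and velocity. *)
Definition geodesic_field c (z : E * E) : E * E := (z.2, - connection_term c z.1 z.2 z.2).

Lemma geodesic_field_C11 c x0 : cod c x0 -> exists dg : E * E -> E * E -> E,
  C11 (geodesic_field c) (fun z h => (h.2, dg z h)) (x0, 0).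
Proof.
move=> cx; have [dg cg] := C11eN (@connection_C11e _ _ _ X c (x0, 0) cx).
exists dg; apply: C11_pair cg.
apply: (@C11_lin _ _ _ _ _ 1); first exact: lin_snd.
by move=> h; rewrite mul1r pair_norm2.
Qed.

Lemma hasd_fst (V W : normedModType R) A (f : R -> V * W) t l : hasd A f t l ->
  hasd A (fun s => (f s).1) t l.1.
Proof.
apply: (@hasd_lin _ _ _ _ 1); first exact: lin_fst.
by move=> h; rewrite mul1r pair_norm1.
Qed.

Lemma hasd_snd (V W : normedModType R) A (f : R -> V * W) t l : hasd A f t l ->
  hasd A (fun s => (f s).2) t l.2.
Proof.
apply: (@hasd_lin _ _ _ _ 1); first exact: lin_snd.
by move=> h; rewrite mul1r pair_norm2.
Qed.

Lemma hasd_gram c A (x : R -> E) t x' : cod c (x t) -> hasd A x t x' ->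
  hasd A (fun s => gram c (x s)) t (DG c (x t) x').
Proof. by move=> cx hx; exact: (hasd_comp (C11_hasD (gram_C11 cx)) hx). Qed.

(** The Euler-Lagrange expression paired with the velocity is half the
    derivative of the energy. *)
Lemma energy_der c A (x u : R -> E) t : cod c (x t) ->
  hasd A x t (u t) -> hasd A u t (- connection_term c (x t) (u t) (u t)) ->
  hasd A (fun s => ip (gram c (x s)) (u s) (u s) : R^o) t 0.
Proof.
move=> cx hx hu; have := hasd_ip (hasd_gram cx hx) hu hu.
have := (geodesic_euler_lagrange (u t) (- connection_term c (x t) (u t) (u t)) cx).1 (addNr _) (u t).
rewrite /euler_lagrange (ip_gramC (u t) _ cx) => el0.
set S := (X in hasd _ _ _ X); have -> // : S = 0.
by rewrite /S; lra.
Qed.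

Definition energy c (z : E * E) : R^o := ip (gram c z.1) z.2 z.2.

Lemma energy_C11 c (z : E * E) : cod c z.1 ->
  C11 (energy c) (fun z h => ip (DG c z.1 h.1) z.2 z.2 + ip (gram c z.1) h.2 z.2
     + ip (gram c z.1) z.2 h.2) z.
Proof.
move=> cz.
have c1 : C11 (fun z : E * E => z.1) (fun _ h => h.1) z.
  by apply: (@C11_lin _ _ _ _ _ 1) => [|h]; [exact: lin_fst|rewrite mul1r pair_norm1].
have c2 : C11 (fun z : E * E => z.2) (fun _ h => h.2) z.
  by apply: (@C11_lin _ _ _ _ _ 1) => [|h]; [exact: lin_snd|rewrite mul1r pair_norm2].
exact: (C11_ip (C11_comp c1 (gram_C11 cz)) c2 c2).
Qed.

Lemma near_ball_sub (V : normedModType R) (x : V) (U : set V) : open U -> U x ->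
  exists2 d : R, 0 < d & forall y, `|y - x| < d -> U y.
Proof. by move=> oU Ux; apply/near_distP; exact: open_nbhs_nbhs. Qed.

(** In the chart [c], [e] is the exponential map at [x], [de] is its
    derivative, and [xi v], [up v] are position and velocity of the geodesic
    with initial velocity [v]. Times up to [2] are included so that time [1]
    is interior. The last clause is the Gauss lemma. *)
Definition chart_exp_spec c (x : E) (r C : R) (e : E -> E) (de : E -> E -> E)
    (xi up : E -> R -> E) :=
  forall v, `|v| < r ->
  [/\ (forall t, `|t| <= 2 -> [/\ cod c (xi v t), hasd setT (xi v) t (up v t) &
        hasd setT (up v) t (- connection_term c (xi v t) (up v t) (up v t))]),
      [/\ xi v 0 = x, up v 0 = v & xi v 1 = e v],
      lin (de v),
      (forall w, `|w| < r -> [/\ `|e v - e w - (v - w)| <= 2^-1 * `|v - w|,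
         `|e w - e v - de v (w - v)| <= C * `|w - v| ^+ 2 &
         forall h, `|de v h - de w h| <= C * `|w - v| * `|h|]) &
      forall h, ip (gram c (e v)) (up v 1) (de v h) = ip (gram c x) v h].

(** The geodesic flow exists up to a small time [T], on which it differs from
    free motion by a small multiple of the initial data; rescaling time gives
    the geodesics up to time [2], and [e] near the identity. Energy is
    conserved; differentiating this in the initial velocity shows that the
    inner product of the velocity with the variation field grows linearly in
    time, which is the Gauss lemma. *)
Theorem chart_exp c x0 : cod c x0 -> exists rho r C : R, [/\ 0 < rho, 0 < r, 0 < C &
  forall x, `|x - x0| < rho -> cod c x /\
    exists e de xi up, chart_exp_spec c x r C e de xi up /\ e 0 = x].
Proof.
move=> cx0; have [dg [r1' [C1 [r10' C10 HF']]]] := geodesic_field_C11 cx0.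
have [r2 r20 Hcod] := near_ball_sub (@cod_open _ _ _ X c) cx0.
pose r1 := Num.min r1' r2.
have r10 : 0 < r1 by rewrite lt_min r10'.
pose dF (z h : E * E) := (h.2, dg z h).
pose z0 : E * E := (x0, 0).
have HF z : `|z - z0| < r1 -> [/\ lin (dF z), forall h, `|dF z h| <= C1 * `|h| &
      forall y, `|y - z0| < r1 ->
        [/\ `|geodesic_field c y - geodesic_field c z - dF z (y - z)| <= C1 * `|y - z| ^+ 2,
            forall h, `|dF z h - dF y h| <= C1 * `|y - z| * `|h| &
            `|geodesic_field c y - geodesic_field c z| <= C1 * `|y - z|]].
  rewrite lt_min => /andP[/HF'[h1 h2 h3] _]; split=> // y.
  by rewrite lt_min => /andP[/h3].
have codz (z : E * E) : `|z - z0| < r1 -> cod c z.1.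
  rewrite lt_min => /andP[_ zr]; apply: Hcod.
  exact: le_lt_trans (pair_norm1 (z - z0)) zr.
have nE : ode_space (E * E)%type by apply: ode_space_prod; exact: ode_space_rV.
have k40 : 0 < (4^-1 : R) by lra.
have [rho [T [Phi [D [[rho0 rhor T0 T1 CT] HPhi]]]]] := flow_exists r10 C10 HF nE k40.
have CT2 : C1 * T <= 2^-1 by lra.
have rhor1 : rho <= r1 by move: rho0 rhor; clear; lra.
pose l := T / 2.
have l0 : 0 < l by rewrite divr_gt0.
have lT : l <= T by rewrite /l; lra.
have ln0 : l != 0 by rewrite gt_eqF.
have Tpos t : 0 <= t -> t <= T -> `|t| <= T by move=> t0 tT; rewrite ger0_norm.
have Hsol p : `|p - z0| < rho -> forall t, 0 <= t -> t <= T ->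
    `|Phi t p - z0| < r1 /\ hasd `[0, T] (Phi^~ p) t (geodesic_field c (Phi t p)).
  move=> pr t t0 tT; have [_ H _ _] := HPhi p pr; have [a b] := H t (Tpos t t0 tT).
  by split=> //; apply: hasd_sub b.
have HD p h : `|p - z0| < rho -> forall t, 0 <= t -> t <= T ->
    hasd `[0, T] (fun t => D t p h) t (dF (Phi t p) (D t p h)).
  move=> pr t t0 tT; have [_ _ _ H] := HPhi p pr.
  by apply: hasd_sub (H h t (Tpos t t0 tT)).
have Phi0 p : `|p - z0| < rho -> Phi 0 p = p by move=> /HPhi[].
have D0 p h : `|p - z0| < rho -> D 0 p h = h by move=> /HPhi[_ _].
have Dlin p : `|p - z0| < rho -> forall t, 0 <= t -> t <= T -> lin (D t p).
  move=> pr t t0 tT a h k; apply/eqP; rewrite -subr_eq0 -normr_le0.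
  pose w t := D t p (a *: h + k) - (a *: D t p h + D t p k).
  have := @lin_sol_bound R _ (geodesic_field c) dF z0 r1 C1 C10 HF T (ltW T0) CT2 (Phi^~ p) w _ t t0 tT.
  rewrite /w !D0// subrr normr0 mulr0; apply=> s s0 sT.
  have [a1 _] := Hsol p pr s s0 sT; split=> //; have [ld _ _] := HF _ a1.
  rewrite (linB ld) (linD ld (a *: _)) (linZ ld); apply: hasdB; first exact: HD.
  by apply: hasdD; [apply: hasdZ|]; exact: HD.
have Htaylor p q : `|p - z0| < rho -> `|q - z0| < rho -> forall t, 0 <= t -> t <= T ->
    `|Phi t q - Phi t p - D t p (q - p)| <= 4 * `|q - p| ^+ 2.
  move=> pr qr t t0 tT.
  have := @sol_taylor R _ (geodesic_field c) dF z0 r1 C1 C10 HF T (ltW T0) CT2 (Phi^~ p) (Phi^~ q)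
    (fun t => D t p (q - p)) (Hsol p pr) (Hsol q qr) (HD p (q - p) pr) _ t t0 tT.
  by rewrite !Phi0// D0//; exact.
have HDlip p q h : `|p - z0| < rho -> `|q - z0| < rho -> forall t, 0 <= t -> t <= T ->
    `|D t p h - D t q h| <= 4 * `|p - q| * `|h|.
  move=> pr qr t t0 tT.
  have := @lin_sol_lip R _ (geodesic_field c) dF z0 r1 C1 C10 HF T (ltW T0) CT2 (Phi^~ p) (Phi^~ q)
    (fun t => D t p h) (fun t => D t q h) (Hsol p pr) (Hsol q qr) (HD p h pr) (HD q h qr) _ t t0 tT.
  by rewrite !Phi0// !D0//; exact.
have Hstable p q : `|p - z0| < rho -> `|q - z0| < rho -> forall t, 0 <= t -> t <= T ->
    `|Phi t p - Phi t q| <= 2 * `|p - q|.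
  move=> pr qr t t0 tT.
  have := @sol_stable R _ (geodesic_field c) dF z0 r1 C1 C10 HF T (ltW T0) CT2 (Phi^~ p) (Phi^~ q)
    (Hsol p pr) (Hsol q qr) t t0 tT.
  by rewrite !Phi0.
have Henergy p : `|p - z0| < rho -> forall t, 0 <= t -> t <= T -> energy c (Phi t p) = energy c p.
  move=> pr t t0 tT; apply/eqP; rewrite -subr_eq0 -normr_le0 -{2}(Phi0 p pr).
  have := @mean_value_bound R R^o (fun t => energy c (Phi t p)) 0 0 t t0; rewrite mul0r; apply => s s0 st.
  have sT := le_trans st tT; exists 0; last by rewrite normr0.
  have [a b] := Hsol p pr s s0 sT.
  apply: (@hasd_sub _ _ `[0, T]); first by move=> z /=; rewrite !in_itv/= => /andP[-> /le_trans]; exact.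
  apply: (@energy_der c `[0, T] (fun s => (Phi s p).1) (fun s => (Phi s p).2)).
  - exact: codz.
  - exact: (hasd_fst b).
  - exact: (hasd_snd b).
have Hgauss (x v h : E) : `|((x, v) : E * E) - z0| < rho -> forall t, 0 <= t -> t <= T ->
    ip (gram c (Phi t (x, v)).1) (Phi t (x, v)).2 (D t (x, v) (0, h)).1 = t * ip (gram c x) v h.
  set p := (x, v) => pr.
  have px : cod c x by apply: (codz p); exact: lt_le_trans pr rhor1.
  (* Conservation of energy for the trajectories issued from [ps s],
     differentiated at [s = 0]. *)
  have var t : 0 <= t -> t <= T ->
     2^-1 * ip (DG c (Phi t p).1 (D t p (0, h)).1) (Phi t p).2 (Phi t p).2 +
     ip (gram c (Phi t p).1) (Phi t p).2 (D t p (0, h)).2 = ip (gram c x) v h.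
    move=> t0 tT; pose h0 : E * E := (0, h).
    have [aP _] := Hsol p pr t t0 tT; have cP := codz _ aP.
    pose ps (s : R) := p + s *: h0.
    have hps : hasd setT ps 0 h0.
      move=> e e0; apply/(@near_distP R R^o); exists 1 => // s _ _.
      rewrite /ps scale0r addr0 subr0 [p + _]addrC addrK subrr normr0 mulr_ge0// ltW//.
    have [d d0 Hd] : exists2 d : R, 0 < d & forall s, `|s| < d -> `|ps s - z0| < rho.
      have hn : 0 < 1 + `|h0| by rewrite ltr_pwDl.
      exists ((rho - `|p - z0|) / (1 + `|h0|)); first by rewrite divr_gt0 ?subr_gt0.
      move=> s; rewrite ltr_pdivlMr// => sd.
      have -> : ps s - z0 = (p - z0) + s *: h0 by rewrite /ps addrAC.
      rewrite (le_lt_trans (ler_normD _ _))// normrZ -ltrBrDl (le_lt_trans _ sd)//.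
      by rewrite ler_wpM2l// lerDr.
    have hPhi : hasd setT (fun s => Phi t (ps s)) 0 (D t p h0).
      move=> e e0.
      have hn : 0 < 1 + `|h0| by rewrite ltr_pwDl.
      apply/(@near_distP R R^o); exists (Num.min d (e / (4 * (1 + `|h0|) ^+ 2))).
        by rewrite lt_min d0 divr_gt0// mulr_gt0// exprn_gt0.
      move=> s; rewrite subr0 lt_min => /andP[sd]; rewrite ltr_pdivlMr ?mulr_gt0 ?exprn_gt0// => se _.
      have := Htaylor p (ps s) pr (Hd s sd) t t0 tT.
      have -> : ps s - p = s *: h0 by rewrite /ps addrC addKr.
      rewrite (linZ (Dlin p pr t t0 tT)) [ps 0](_ : _ = p); last by rewrite /ps scale0r addr0.
      move=> /le_trans; apply; rewrite normrZ.
      have s0 := normr_ge0 s; have := normr_ge0 h0; set a := `|s| in s0 se *; set b := `|h0| in se hn * => b0.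
      have : b ^+ 2 <= (1 + b) ^+ 2 by apply: lerXn2r; rewrite ?nnegrE ?lerDr// addr_ge0.
      rewrite exprMn => bb.
      have : a * (4 * b ^+ 2) <= a * (4 * (1 + b) ^+ 2) by rewrite ler_wpM2l// ler_wpM2l.
      move=> ab; have : a * (4 * b ^+ 2) <= e by rewrite (le_trans ab)// ltW.
      move=> abe; have -> : 4 * (a ^+ 2 * b ^+ 2) = (a * (4 * b ^+ 2)) * a by ring.
      by rewrite ler_wpM2r.
    have ps0 : ps 0 = p by rewrite /ps scale0r addr0.
    have cP' : cod c (Phi t (ps 0)).1 by rewrite ps0.
    have H1 := hasd_comp (C11_hasD (energy_C11 cP')) hPhi.
    have cp' : cod c (ps 0).1 by rewrite ps0.
    have H2 := hasd_comp (C11_hasD (energy_C11 cp')) hps.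
    have H3 : hasd setT (energy c \o (fun s => Phi t (ps s))) 0
        (ip (DG c (ps 0).1 h0.1) (ps 0).2 (ps 0).2 + ip (gram c (ps 0).1) h0.2 (ps 0).2
     + ip (gram c (ps 0).1) (ps 0).2 h0.2).
      apply: hasd_near H2 => //; apply/(@near_distP R R^o); exists d => // s sd _ /=.
      by rewrite Henergy//; apply: Hd; move: sd; rewrite subr0.
    have := hasd_setT_unique H1 H3; rewrite !ps0 /= (lin0 (DG_lin px)).
    rewrite ip0m add0r (ip_gramC h _ px) (ip_gramC (D t p h0).2 _ cP).
    clear; lra.
  move=> t t0 tT; apply/eqP; rewrite -subr_eq0 -normr_le0.
  have := @mean_value_bound R R^o (fun t => ip (gram c (Phi t p).1) (Phi t p).2 (D t p (0, h)).1
      - t * ip (gram c x) v h : R^o) 0 0 t t0.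
  rewrite mul0r Phi0// D0//= ip0r mul0r subr0 subr0; apply => s s0 st.
  have sT := le_trans st tT; exists 0; last by rewrite normr0.
  apply: (@hasd_sub _ _ `[0, T]); first by move=> z /=; rewrite !in_itv/= => /andP[-> /le_trans]; exact.
  have [a b] := Hsol p pr s s0 sT; have ca := codz _ a.
  have hx := hasd_fst b; have hu := hasd_snd b; have hJ := hasd_fst (HD p (0, h) pr s s0 sT).
  have := hasdB (hasd_ip (hasd_gram ca hx) hu hJ)
    (hasdM (hasd_id `[0, T] s) (hasd_cst `[0, T] (ip (gram c x) v h : R^o) s)).
  rewrite mulr0 add0r mul1r /=.
  have := (geodesic_euler_lagrange (Phi s p).2 _ ca).1 (addNr _) (D s p (0, h)).1.
  rewrite /euler_lagrange => el0; have vr := var s s0 sT.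
  set S := (X in hasd _ _ _ X); have -> // : S = 0.
  by rewrite /S; move: el0 vr; clear; lra.
(* The geodesic with initial velocity [v] at time [t] is the one with initial
   velocity [v / l] at time [l * t]. *)
pose C := 4 / l ^+ 2.
have Cpos : 0 < C by rewrite divr_gt0// exprn_gt0.
exists rho, (l * rho), C; split=> //; first by rewrite mulr_gt0.
move=> x xr.
pose pp (v : E) : E * E := (x, l^-1 *: v).
have ppr v : `|v| < l * rho -> `|pp v - z0| < rho.
  move=> vr; rewrite pair_norm /= gt_max xr subr0 normrZ normfV (gtr0_norm l0).
  by rewrite ltr_pdivrMl.
have cx : cod c x.
  have z00 : `|(0 : E)| < l * rho by rewrite normr0 mulr_gt0.
  by apply: (codz (pp 0)); exact: lt_le_trans (ppr _ z00) rhor1.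
split=> //.
exists (fun v => (Phi l (pp v)).1), (fun v h => (D l (pp v) (0, l^-1 *: h)).1),
  (fun v t => (Phi (l * t) (pp v)).1), (fun v t => l *: (Phi (l * t) (pp v)).2).
have ppB v w : pp w - pp v = (0, l^-1 *: (w - v)).
  by rewrite /pp scalerBr; congr (_, _); rewrite /= subrr.
have nppB v w : `|pp w - pp v| = l^-1 * `|w - v|.
  by rewrite ppB pair_norm /= normr0 normrZ normfV (gtr0_norm l0) max_r// mulr_ge0// invr_ge0 ltW.
split; last first.
  have z00 : `|(0 : E)| < l * rho by rewrite normr0 mulr_gt0.
  have Sst t : 0 <= t -> t <= T -> `|(fun _ : R => pp 0) t - z0| < r1 /\
     hasd `[0, T] (fun _ => pp 0) t (geodesic_field c ((fun _ : R => pp 0) t)).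
    move=> _ _; split; first exact: lt_le_trans (ppr _ z00) rhor1.
    have -> : geodesic_field c (pp 0) = 0 by rewrite /geodesic_field /pp /= scaler0 connection0 oppr0.
    exact: hasd_cst.
  have := @sol_stable R _ (geodesic_field c) dF z0 r1 C1 C10 HF T (ltW T0) CT2 (Phi^~ (pp 0)) (fun=> pp 0)
    (Hsol _ (ppr _ z00)) Sst l (ltW l0) lT.
  rewrite Phi0//; last exact: ppr.
  by rewrite subrr normr0 mulr0 normr_le0 subr_eq0 => /eqP ->.
move=> v vr; have pvr := ppr v vr; split.
- move=> t t2; have ltT : `|l * t| <= T.
    by rewrite normrM (gtr0_norm l0) (le_trans (ler_wpM2l (ltW l0) t2))// /l divfK.
  have [_ H _ _] := HPhi _ pvr; have [a b] := H _ ltT; split.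
  + exact: codz.
  + have := hasd_fst b; rewrite -{1}[l * t]addr0 => /hasd_affine.
    by apply: hasd_ext => s; rewrite addr0.
  + have := hasd_snd b; rewrite -{1}[l * t]addr0 => /hasd_affine /(hasdZ l).
    rewrite connection_scale /= scalerN scalerN scalerA -expr2.
    by apply: hasd_ext => s; rewrite addr0.
- by rewrite !mulr0 mulr1 !Phi0//= scalerA divff// scale1r.
- move=> a h k; rewrite scalerDr scalerA [_ * a]mulrC -scalerA.
  have -> : (0, a *: (l^-1 *: h) + l^-1 *: k) = a *: ((0, l^-1 *: h) : E * E) + (0, l^-1 *: k).
    by congr (_, _); rewrite /= scaler0 addr0.
  by rewrite (Dlin _ pvr _ (ltW l0) lT).
- move=> w wr; have pwr := ppr w wr; split.
  + have d0 : 0 <= l^-1 * `|v - w| by rewrite mulr_ge0// invr_ge0 ltW.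
    have Hu t : 0 <= t -> t <= T ->
       `|(Phi t (pp v)).2 - (Phi t (pp w)).2 - l^-1 *: (v - w)| <= 2^-1 * (l^-1 * `|v - w|).
      move=> t0 tT.
      have := @mean_value_bound R _ (fun t => (Phi t (pp v)).2 - (Phi t (pp w)).2) (C1 * (2 * (l^-1 * `|v - w|))) 0 t t0.
      rewrite !Phi0//= -scalerBr subr0 => h; rewrite (le_trans (h _))//.
        move=> s s0 st; have sT := le_trans st tT.
        have [a1 b1] := Hsol _ pvr s s0 sT; have [a2 b2] := Hsol _ pwr s s0 sT.
        exists ((geodesic_field c (Phi s (pp v))).2 - (geodesic_field c (Phi s (pp w))).2).
          apply: (@hasd_sub _ _ `[0, T]); first by move=> z /=; rewrite !in_itv/= => /andP[-> /le_trans]; exact.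
          by apply: hasdB; [exact: (hasd_snd b1)|exact: (hasd_snd b2)].
        rewrite (le_trans (pair_norm2 (geodesic_field c (Phi s (pp v)) - geodesic_field c (Phi s (pp w)))))//.
        have [_ _ /(_ _ a1)[_ _ q]] := HF _ a2.
        rewrite (le_trans q)// ler_wpM2l// (le_trans (Hstable _ _ pvr pwr s s0 sT))//.
        by rewrite nppB.
      have : C1 * t <= 4^-1 by rewrite (le_trans _ CT)// ler_wpM2l.
      move=> h1; have := ler_wpM2r d0 h1; clear; lra.
    have := @mean_value_bound R _ (fun t => (Phi t (pp v)).1 - (Phi t (pp w)).1 - t *: (l^-1 *: (v - w)))
        (2^-1 * (l^-1 * `|v - w|)) 0 l (ltW l0).
    rewrite !Phi0//= subrr scale0r subr0 !subr0 scalerA divff// scale1r.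
    have -> : 2^-1 * (l^-1 * `|v - w|) * l = 2^-1 * `|v - w| by field.
    apply=> t t0 tl; have tT := le_trans tl lT.
    exists ((Phi t (pp v)).2 - (Phi t (pp w)).2 - l^-1 *: (v - w)); last exact: Hu.
    have [a1 b1] := Hsol _ pvr t t0 tT; have [a2 b2] := Hsol _ pwr t t0 tT.
    apply: (@hasd_sub _ _ `[0, T]); first by move=> z /=; rewrite !in_itv/= => /andP[-> /le_trans]; exact.
    apply: hasdB; first by apply: hasdB; [exact: (hasd_fst b1)|exact: (hasd_fst b2)].
    move=> e e0; apply/(@near_distP R R^o); exists 1 => // s _ _.
    by rewrite -scalerBl subrr normr0 mulr_ge0// ltW.
  + rewrite (le_trans (pair_norm1 (Phi l (pp w) - Phi l (pp v) - D l (pp v) (0, l^-1 *: (w - v)))))//.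
    rewrite -ppB (le_trans (Htaylor _ _ pvr pwr l (ltW l0) lT))// nppB exprMn exprVn /C.
    by rewrite mulrA.
  + move=> h.
    rewrite (le_trans (pair_norm1 (D l (pp v) (0, l^-1 *: h) - D l (pp w) (0, l^-1 *: h))))//.
    rewrite (le_trans (HDlip _ _ _ pvr pwr l (ltW l0) lT))// distrC nppB pair_norm /= normr0.
    rewrite max_r// normrZ normfV (gtr0_norm l0) /C.
    by rewrite le_eqVlt; apply/orP; left; apply/eqP; field.
- move=> h; rewrite mulr1 ipZl (Hgauss x (l^-1 *: v) (l^-1 *: h) pvr l (ltW l0) lT).
  by rewrite ipZl ipZr; field.
Qed.

End ChartExp.

(** * Change of chart *)

Section Transition.
Context {R : realType} {n : nat} {M : topologicalType}.
Variable X : riemannian_manifold R n M.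
Implicit Types (c d : chart X) (x u v w h : 'rV[R]_n) (q : M).
Local Notation E := 'rV[R]_n.

Definition tau c d : E -> E := coord d \o para c.
Definition transition_derivative c d x u : E := 'D_u (tau c d) x.
(** Locked, so that unification treats it as an atom. *)
Definition Dtau := locked transition_derivative.
Lemma DtauE c d x : Dtau c d x = fun u => 'D_u (tau c d) x.
Proof. by rewrite /Dtau -lock. Qed.
Lemma DtauE1 c d u : (fun y => Dtau c d y u) = 'D_u (tau c d).
Proof. by rewrite /Dtau -lock. Qed.

Lemma codP c x : cod c x -> dom c (para c x) /\ coord c (para c x) = x.
Proof. by move=> [q dq <-]; rewrite coordK. Qed.

Lemma cod_coord c q : dom c q -> cod c (coord c q).
Proof. by move=> dq; exists q. Qed.

Lemma overlap_open c d : open (overlap c d).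
Proof.
rewrite openE => x [cx dx]; rewrite /interior.
have h1 : nbhs x (cod c) by exact: open_nbhs_nbhs (conj (@cod_open _ _ _ X c) cx).
have h2 : nbhs x (para c @^-1` dom d).
  apply: (para_continuous cx).
  exact: open_nbhs_nbhs (conj (@dom_open _ _ _ X d) dx).
by apply: filterS2 h1 h2 => y.
Qed.

Lemma overlap_coord c d q : dom c q -> dom d q -> overlap c d (coord c q).
Proof. by move=> dc dd; split; [exact: cod_coord|rewrite coordK]. Qed.

Lemma tau_coord c d q : dom c q -> tau c d (coord c q) = coord d q.
Proof. by move=> dc; rewrite /tau /= coordK. Qed.

Lemma overlap_tau c d x : overlap c d x ->
  [/\ overlap d c (tau c d x), tau d c (tau c d x) = x & cod d (tau c d x)].
Proof.
move=> [cx dx]; have [dcx cK] := codP cx.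
have E1 : para d (tau c d x) = para c x by rewrite /tau /= coordK.
have cd : cod d (tau c d x) by exists (para c x).
by split=> //; [split=> //; rewrite E1|rewrite {1}/tau /= E1].
Qed.

Lemma tau_diff c d x : overlap c d x -> differentiable (tau c d) x.
Proof. by move=> ox; have [h _] := transition_smooth c d 1; exact: h. Qed.

Lemma Dtau_lin c d x : overlap c d x -> lin (Dtau c d x).
Proof. by move=> ox; rewrite DtauE; apply: derive_lin; exact: tau_diff. Qed.

Lemma hasd_tau c d A (x : R -> E) t x' : overlap c d (x t) -> hasd A x t x' ->
  hasd A (fun s => tau c d (x s)) t (Dtau c d (x t) x').
Proof. by move=> ox hx; rewrite DtauE; exact: (hasd_comp (diff_hasD (tau_diff ox)) hx). Qed.

Lemma hasd_line (W : normedModType R) (x h : W) : hasd setT (fun s : R => x + s *: h) 0 h.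
Proof.
move=> e e0; apply/(@near_distP R R^o); exists 1 => // s _ _.
by rewrite scale0r addr0 subr0 [x + _]addrC addrK subrr normr0 mulr_ge0// ltW.
Qed.

Lemma near_line (W : normedModType R) (x h : W) (U : set W) : open U -> U x ->
  \forall s \near (0 : R), U (x + s *: h).
Proof.
move=> oU Ux; have [d d0 Hd] := near_ball_sub oU Ux.
have h1 : 0 < 1 + `|h| by rewrite ltr_pwDl.
apply/(@near_distP R R^o); exists (d / (1 + `|h|)); first by rewrite divr_gt0.
move=> s; rewrite subr0 ltr_pdivlMr// => sd; apply: Hd.
rewrite addrC addKr normrZ (le_lt_trans _ sd)// ler_wpM2l// lerDr//.
Qed.

(** Differentiate along a line that the composite of the two transition maps
    is the identity. *)
Lemma DtauK c d x u : overlap c d x -> Dtau d c (tau c d x) (Dtau c d x u) = u.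
Proof.
move=> ox; have [ot tK _] := overlap_tau ox.
have h0 := hasd_line x u.
have ox0 : overlap c d (x + 0 *: u) by rewrite scale0r addr0.
have h1 := hasd_tau ox0 h0.
have ot0 : overlap d c (tau c d (x + 0 *: u)) by rewrite scale0r addr0.
have h2 := hasd_tau ot0 h1.
have h3 : hasd setT (fun s => x + s *: u) 0
   (Dtau d c (tau c d (x + 0 *: u)) (Dtau c d (x + 0 *: u) u)).
  apply: hasd_near h2 => //.
  apply: filterS (near_line u (@overlap_open c d) ox) => s os _.
  by have [_ -> _] := overlap_tau os.
by rewrite -{1}[x]addr0 -{2}[x]addr0 -!(scale0r u) (hasd_setT_unique h3 h0).
Qed.

Lemma ip_tau c d x u v : overlap c d x ->
  ip (gram c x) u v = ip (gram d (tau c d x)) (Dtau c d x u) (Dtau c d x v).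
Proof. by move=> ox; rewrite !DtauE /ip; have := gram_transition u v ox; rewrite /= => ->. Qed.

Definition transition_second_derivative c d x h u : E := 'D_h (fun y => Dtau c d y u) x.
(** Locked, so that unification treats it as an atom. *)
Definition D2tau := locked transition_second_derivative.
Lemma D2tauE c d x h u : D2tau c d x h u = 'D_h (fun y => Dtau c d y u) x.
Proof. by rewrite /D2tau -lock. Qed.

Lemma D2tau_sym c d x h u : overlap c d x -> D2tau c d x h u = D2tau c d x u h.
Proof.
move=> ox; rewrite !D2tauE !DtauE1.
exact: (schwarz u h (@overlap_open c d) (transition_smooth c d 2) ox).
Qed.

Lemma Dtau_diff c d x u : overlap c d x -> differentiable (fun y => Dtau c d y u) x.
Proof. by move=> ox; rewrite DtauE1; have [_ /(_ u)[h _]] := transition_smooth c d 2; exact: h. Qed.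

Lemma D2tau_lin c d x u : overlap c d x -> lin (fun h => D2tau c d x h u).
Proof.
move=> ox; have -> : (fun h => D2tau c d x h u) = fun h => 'D_h (fun y => Dtau c d y u) x.
  by apply/funext => h; rewrite D2tauE.
by apply: derive_lin; exact: Dtau_diff.
Qed.

Lemma D2tau_linr c d x h : overlap c d x -> lin (D2tau c d x h).
Proof.
move=> ox a u v; rewrite !(D2tau_sym h _ ox).
exact: (D2tau_lin _ ox).
Qed.

Lemma Dtau_sum c d y w : overlap c d y ->
  Dtau c d y w = \sum_i (w 0 i) *: Dtau c d y (delta_mx 0 i).
Proof. by move=> oy; rewrite !DtauE; apply: derive_sum_delta; exact: tau_diff. Qed.

Lemma hasd_Dtau_cst c d A (x : R -> E) t x' u : overlap c d (x t) -> hasd A x t x' ->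
  hasd A (fun s => Dtau c d (x s) u) t (D2tau c d (x t) x' u).
Proof. by move=> ox hx; rewrite D2tauE; exact: (hasd_comp (diff_hasD (Dtau_diff u ox)) hx). Qed.

Lemma hasd_Dtau c d A (x u : R -> E) t x' u' : A t -> overlap c d (x t) ->
  hasd A x t x' -> hasd A u t u' ->
  hasd A (fun s => Dtau c d (x s) (u s)) t
    (Dtau c d (x t) u' + D2tau c d (x t) x' (u t)).
Proof.
move=> At ox hx hu.
have Hi (i : 'I_n) : hasd A (fun s => (u s 0 i) *: Dtau c d (x s) (delta_mx 0 i)) t
   ((u t 0 i) *: D2tau c d (x t) x' (delta_mx 0 i) + (u' 0 i) *: Dtau c d (x t) (delta_mx 0 i)).
  apply: (hasd_bilin (@bilin_scale R E) (hasd_entry 0 i hu)).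
  exact: hasd_Dtau_cst.
have Hs : hasd A (fun s => \sum_i (u s 0 i) *: Dtau c d (x s) (delta_mx 0 i)) t
  (\sum_i ((u t 0 i) *: D2tau c d (x t) x' (delta_mx 0 i) + (u' 0 i) *: Dtau c d (x t) (delta_mx 0 i))).
  elim: (index_enum _) => [|i r IH].
    rewrite big_nil; apply: hasd_ext (hasd_cst A (0 : E) t) => s; by rewrite big_nil.
  rewrite big_cons; apply: hasd_ext (hasdD (Hi i) IH) => s; by rewrite big_cons.
have SE y w : overlap c d y -> Dtau c d y w = \sum_i (w 0 i) *: Dtau c d y (delta_mx 0 i).
  by move=> oy; exact: Dtau_sum.
have -> : Dtau c d (x t) u' + D2tau c d (x t) x' (u t) =
  \sum_i ((u t 0 i) *: D2tau c d (x t) x' (delta_mx 0 i) + (u' 0 i) *: Dtau c d (x t) (delta_mx 0 i)).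
  rewrite big_split [RHS]addrC /=; congr (_ + _); first exact: SE.
  have L := D2tau_linr x' ox.
  rewrite {1}(row_sum_delta (u t)) (lin_sum L); apply: eq_bigr => i _.
  by rewrite (linZ L).
apply: hasd_near Hs => //.
have [r r0 Hr] := near_ball_sub (@overlap_open c d) ox.
apply: filterS (hasd_cont hx r0) => s Hs As.
by rewrite -SE//; apply: Hr; exact: Hs.
Qed.

Lemma hasd_ip_cst (A : set R) (G : R -> 'M[R]_n) t G' a b : hasd A G t G' ->
  hasd A (fun s => ip (G s) a b : R^o) t (ip G' a b).
Proof.
move=> hG; have := hasd_ip hG (hasd_cst A a t) (hasd_cst A b t).
by rewrite ip0l ip0r !addr0.
Qed.

(** The derivative along [h] of the transformation law of the metric. *)
Lemma DG_tau c d x h a b : overlap c d x ->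
  ip (DG c x h) a b =
  ip (DG d (tau c d x) (Dtau c d x h)) (Dtau c d x a) (Dtau c d x b)
  + ip (gram d (tau c d x)) (D2tau c d x h a) (Dtau c d x b)
  + ip (gram d (tau c d x)) (Dtau c d x a) (D2tau c d x h b).
Proof.
move=> ox; have [_ _ cdt] := overlap_tau ox; have [cx _] := ox.
have [y [hy y0 ny]] : exists y : R -> E, [/\ hasd setT y 0 h, y 0 = x &
    \forall s \near (0 : R), overlap c d (y s)].
  exists (fun s => x + s *: h); split; [exact: hasd_line|by rewrite scale0r addr0|].
  exact: near_line (@overlap_open c d) ox.
have oy : overlap c d (y 0) by rewrite y0.
have cy : cod c (y 0) by rewrite y0.
have cty : cod d (tau c d (y 0)) by rewrite y0.
have H1 := hasd_ip_cst a b (hasd_gram cy hy).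
have H2 := hasd_ip (hasd_gram cty (hasd_tau oy hy)) (hasd_Dtau_cst a oy hy) (hasd_Dtau_cst b oy hy).
have H3 : hasd setT (fun s => ip (gram c (y s)) a b : R^o) 0
  (ip (DG d (tau c d (y 0)) (Dtau c d (y 0) h)) (Dtau c d (y 0) a) (Dtau c d (y 0) b)
  + ip (gram d (tau c d (y 0))) (D2tau c d (y 0) h a) (Dtau c d (y 0) b)
  + ip (gram d (tau c d (y 0))) (Dtau c d (y 0) a) (D2tau c d (y 0) h b)).
  by apply: hasd_near H2 => //; apply: filterS ny => s os _; rewrite -ip_tau.
have := hasd_setT_unique H1 H3; rewrite y0; exact.
Qed.

(** The second derivatives of the transition map that [DG_tau] introduces
    cancel, since they are symmetric. *)
Lemma euler_lagrange_tau c d x u a w : overlap c d x ->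
  euler_lagrange d (tau c d x) (Dtau c d x u) (Dtau c d x a + D2tau c d x u u) (Dtau c d x w) =
  euler_lagrange c x u a w.
Proof.
move=> ox; have [_ _ cdt] := overlap_tau ox.
have e1 := DG_tau u u w ox; have e2 := DG_tau w u u ox; have e3 := ip_tau a w ox.
have e4 := ipDl (gram d (tau c d x)) (Dtau c d x a) (D2tau c d x u u) (Dtau c d x w).
have e5 : ip (gram d (tau c d x)) (D2tau c d x w u) (Dtau c d x u) =
  ip (gram d (tau c d x)) (Dtau c d x u) (D2tau c d x w u) by exact: ip_gramC.
have e6 : ip (gram d (tau c d x)) (Dtau c d x u) (D2tau c d x w u) =
   ip (gram d (tau c d x)) (Dtau c d x u) (D2tau c d x u w).
  exact: (congr1 (ip (gram d (tau c d x)) (Dtau c d x u)) (D2tau_sym w u ox)).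
rewrite /euler_lagrange; move: e1 e2 e3 e4 e5 e6.
move: (ip (DG c x u) u w) (ip (DG c x w) u u) (ip (gram c x) a w) => i1 i2 i3.
move: (ip (gram d (tau c d x)) (Dtau c d x a + D2tau c d x u u) (Dtau c d x w)) => i4.
move: (ip (gram d (tau c d x)) (D2tau c d x w u) (Dtau c d x u)) => i5.
move: (ip (gram d (tau c d x)) (Dtau c d x u) (D2tau c d x w u)) => i6.
move: (ip (gram d (tau c d x)) (Dtau c d x u) (D2tau c d x u w)) => i7.
move: (ip (gram d (tau c d x)) (D2tau c d x u u) (Dtau c d x w)) => i8.
move: (ip (gram d (tau c d x)) (Dtau c d x a) (Dtau c d x w)) => i9.
move: (ip _ _ _) (ip _ _ _) => j1 j2; clear; lra.
Qed.

Lemma geo_tau c d x u a : overlap c d x -> a + connection_term c x u u = 0 ->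
  Dtau c d x a + D2tau c d x u u
   + connection_term d (tau c d x) (Dtau c d x u) (Dtau c d x u) = 0.
Proof.
move=> ox a0; have [ot tK cdt] := overlap_tau ox; have [cx _] := ox.
apply/(geodesic_euler_lagrange _ _ cdt) => w.
rewrite -[w](DtauK w ot) tK euler_lagrange_tau//.
exact: (geodesic_euler_lagrange u a cx).1.
Qed.

End Transition.

(** * Curves in a chart *)

Section LocalCurves.
Context {R : realType} {n : nat} {M : topologicalType}.
Variable X : riemannian_manifold R n M.
Implicit Types (c d : chart X) (q : M) (A : set R) (g : R -> M).
Local Notation E := 'rV[R]_n.

(** Near [t], the chart [c] sees the curve [g] as [x], with velocity [x'] that
    is continuous at [t]. Requiring the derivative near [t] makes the
    condition stable under changes of chart. *)
Definition curve_in c A g (x x' : R -> E) t :=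
  [/\ dom c (g t), \forall s \near t, A s -> dom c (g s) /\ coord c (g s) = x s,
      \forall s \near t, A s -> hasd A x s (x' s) &
      forall e : R, 0 < e -> \forall s \near t, A s -> `|x' s - x' t| < e].

Lemma curve_in_at c A g x x' t : A t -> curve_in c A g x x' t ->
  [/\ dom c (g t), cod c (x t), coord c (g t) = x t, g t = para c (x t) & hasd A x t (x' t)].
Proof.
move=> At [dg n1 n2 _]; have [_ Et] := nbhs_singleton n1 At.
split=> //; first by rewrite -Et; exact: cod_coord.
  by rewrite -Et coordK.
exact: nbhs_singleton n2 At.
Qed.

Lemma tau_cont_comp c d A (x x' : R -> E) t : A t -> overlap c d (x t) -> hasd A x t (x' t) ->
  (forall e : R, 0 < e -> \forall s \near t, A s -> `|x' s - x' t| < e) ->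
  forall e : R, 0 < e -> \forall s \near t, A s ->
    `|Dtau c d (x s) (x' s) - Dtau c d (x t) (x' t)| < e.
Proof.
move=> At ox hx cx' e e0.
have SE y w : overlap c d y -> Dtau c d y w = \sum_i (w 0 i) *: Dtau c d y (delta_mx 0 i).
  by move=> oy; exact: Dtau_sum.
have [r r0 Hr] := near_ball_sub (@overlap_open _ _ _ X c d) ox.
have Hi (i : 'I_n) : \forall s \near t, A s ->
   `|x' s 0 i *: Dtau c d (x s) (delta_mx 0 i) - x' t 0 i *: Dtau c d (x t) (delta_mx 0 i)|
     <= e / (n%:R + 1).
  have n1 : 0 < (n%:R + 1 : R) by rewrite ltr_wpDl.
  have e1 : 0 < e / (n%:R + 1) by rewrite divr_gt0.
  have hD := hasd_Dtau_cst (delta_mx 0 i) ox hx.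
  set a := x' t; set D := Dtau c d (x t) (delta_mx 0 i).
  have w1 : 0 < 1 + `|D| by rewrite ltr_pwDl.
  have w2 : 0 < 1 + `|a| by rewrite ltr_pwDl.
  pose e2 := Num.min 1 (Num.min (e / (n%:R + 1) / (2 * (1 + `|D|))) (e / (n%:R + 1) / (2 * (1 + `|a|)))).
  have e20 : 0 < e2 by rewrite !lt_min ltr01/= !divr_gt0// mulr_gt0.
  have e2a : e2 <= 1 by rewrite ge_min lexx.
  have e2b : e2 * (2 * (1 + `|D|)) <= e / (n%:R + 1).
    by rewrite -ler_pdivlMr ?mulr_gt0// !ge_min lexx orbT.
  have e2c : e2 * (2 * (1 + `|a|)) <= e / (n%:R + 1).
    by rewrite -ler_pdivlMr ?mulr_gt0// !ge_min lexx !orbT.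
  have nD := normr_ge0 D; have na := normr_ge0 a.
  apply: filterS2 (cx' _ e20) (hasd_cont hD e20) => s h1 h2 As.
  have {}h1 := h1 As; have {}h2 := h2 As.
  set D' := Dtau c d (x s) _.
  have -> : x' s 0 i *: D' - a 0 i *: D =
    (x' s - a) 0 i *: (D' - D) + (x' s - a) 0 i *: D + a 0 i *: (D' - D).
    by rewrite !mxE; vlinear R.
  rewrite (le_trans (ler_normD _ _))// (le_trans (lerD (ler_normD _ _) (lexx _)))// !normrZ.
  have k1 : `|(x' s - a) 0 i| <= e2 by rewrite (le_trans (mx_entry_le _ _ _))// ltW.
  have k2 : `|D' - D| <= e2 by rewrite ltW.
  have k3 : `|a 0 i| <= `|a| by exact: mx_entry_le.
  have m1 : `|(x' s - a) 0 i| * `|D' - D| <= e2 * 1 by rewrite ler_pM// (le_trans k2).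
  have m2 : `|(x' s - a) 0 i| * `|D| <= e2 * `|D| by rewrite ler_wpM2r.
  have m3 : `|a 0 i| * `|D' - D| <= `|a| * e2 by rewrite ler_pM.
  move: e20 e2b e2c m1 m2 m3; clear; lra.
have := near_ord Hi.
apply: filterS2 (hasd_cont hx r0) => s h1 h2 As.
have os : overlap c d (x s) by apply: Hr; exact: h1.
rewrite (SE _ _ os) (SE _ _ ox) -sumrB (le_lt_trans (ler_norm_sum _ _ _))//.
apply: (@le_lt_trans _ _ (\sum_(i < n) (e / (n%:R + 1)))).
  by apply: ler_sum => i _; exact: h2.
rewrite sumr_const card_ord -[ltLHS]mulr_natl mulrA ltr_pdivrMr ?ltr_wpDl//.
by rewrite mulrC ltr_pM2l// ltrDl.
Qed.

Lemma curve_in_chart c d A g x x' t : A t -> curve_in c A g x x' t -> dom d (g t) ->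
  curve_in d A g (fun s => tau c d (x s)) (fun s => Dtau c d (x s) (x' s)) t.
Proof.
move=> At cg dd; have [dc cx Ex Eg hx] := curve_in_at At cg.
case: cg => _ n1 n2 n3.
have ox : overlap c d (x t) by rewrite -Ex; exact: overlap_coord.
have [r r0 Hr] := near_ball_sub (@overlap_open _ _ _ X c d) ox.
have nov : \forall s \near t, A s -> overlap c d (x s).
  by apply: filterS (hasd_cont hx r0) => s h As; apply: Hr; exact: h.
split=> //.
- apply: filterS2 n1 nov => s h1 h2 As; have [dcs Es] := h1 As; have [cs ds] := h2 As.
  by rewrite -Es tau_coord//; split=> //; rewrite -(coordK dcs) Es.
- by apply: filterS2 n2 nov => s h1 h2 As; apply: hasd_tau; [exact: h2|exact: h1].
- exact: tau_cont_comp.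
Qed.

End LocalCurves.

(** * Continuity relative to an interval *)

Section Within.
Context {R : realType}.

Lemma itvP_cc (a b t : R) : `[a, b]%classic t <-> a <= t /\ t <= b.
Proof. by rewrite /= in_itv/=; split=> [/andP[]|[-> ->]]. Qed.

(** No point of a nondegenerate interval is isolated, so derivatives relative
    to the interval are unique. *)
Lemma itv_proper (a b t : R) : a < b -> a <= t -> t <= b ->
  ProperFilter (within `[a, b] t^').
Proof.
move=> ab at_ tb; apply: Build_ProperFilter.
move=> /(@near_distP R R^o)[d d0 H].
have [tb'|bt] := ltP t b.
  have m0 : 0 < Num.min d (b - t) by rewrite lt_min d0 subr_gt0.
  have m1 : Num.min d (b - t) <= d by rewrite ge_min lexx.
  have m2 : Num.min d (b - t) <= b - t by rewrite ge_min lexx orbT.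
  apply: (H (t + Num.min d (b - t) / 2)).
  - by rewrite addrC addKr gtr0_norm; lra.
  - by apply/eqP; lra.
  - by apply/itvP_cc; split; lra.
have {tb bt} tb : t = b by apply/eqP; rewrite eq_le tb.
have m0 : 0 < Num.min d (b - a) by rewrite lt_min d0 subr_gt0.
have m1 : Num.min d (b - a) <= d by rewrite ge_min lexx.
have m2 : Num.min d (b - a) <= b - a by rewrite ge_min lexx orbT.
apply: (H (t - Num.min d (b - a) / 2)).
- by rewrite addrC addKr normrN gtr0_norm; lra.
- by apply/eqP; lra.
- by apply/itvP_cc; split; lra.
Qed.

Definition contw (W : normedModType R) (A : set R) (f : R -> W) t :=
  forall e : R, 0 < e -> \forall s \near t, A s -> `|f s - f t| < e.

Lemma contw_cvg (W : normedModType R) A (f : R -> W) t :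
  contw A f t <-> f s @[s --> within A (nbhs t)] --> f t.
Proof.
split=> [H|/cvgrPdist_lt H e e0].
  apply/cvgrPdist_lt => e e0; rewrite within_near.
  by apply: filterS (H e e0) => s h /h; rewrite distrC.
have := H e e0; rewrite within_near.
by apply: filterS => s h /h; rewrite distrC.
Qed.

Lemma contw_comp (V W : normedModType R) A (f : R -> V) (F : V -> W) t :
  contw A f t -> {for f t, continuous F} -> contw A (F \o f) t.
Proof.
move=> cf /cvgrPdist_lt cF e e0.
have /near_distP[d d0 Hd] := cF e e0.
apply: filterS (cf d d0) => s h As.
by rewrite distrC; apply: Hd; exact: h.
Qed.

Lemma contw_near (W : normedModType R) A (f g : R -> W) t :
  A t -> (\forall s \near t, A s -> f s = g s) -> contw A f t -> contw A g t.
Proof.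
move=> At fg H e e0; have <- : f t = g t by move: fg => /nbhs_singleton; apply.
by apply: filterS2 fg (H e e0) => s E h As; rewrite -E//; exact: h.
Qed.

Lemma contw_pair (V W : normedModType R) A (f : R -> V) (g : R -> W) t :
  contw A f t -> contw A g t -> contw A (fun s => (f s, g s)) t.
Proof.
move=> hf hg e e0; apply: filterS2 (hf e e0) (hg e e0) => s h1 h2 As.
by rewrite pair_norm gt_max h1//= h2.
Qed.

Lemma hasD_continuous (V W : normedModType R) (f : V -> W) x L : hasD f x L -> {for x, continuous f}.
Proof.
move=> [l [C C0 LC] H]; apply/cvgrPdist_lt => e e0.
apply/near_distP; have /near_distP[d d0 Hd] := H 1 ltr01.
have C1 : 0 < C + 1 by lra.
exists (Num.min d (e / (C + 1))); first by rewrite lt_min d0 divr_gt0.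
move=> y; rewrite lt_min => /andP[/Hd h1]; rewrite ltr_pdivlMr// => h2.
rewrite distrC -(subrK (L (y - x)) (f y - f x)) (le_lt_trans (ler_normD _ _))//.
rewrite (le_lt_trans (lerD h1 (LC _)))//; lra.
Qed.

Lemma contw_ip n A (G : R -> 'M[R]_n) (u : R -> 'rV[R]_n) t :
  contw A G t -> contw A u t -> contw A (fun s => ip (G s) (u s) (u s) : R^o) t.
Proof.
move=> cG cu.
apply: (@contw_comp _ R^o A (fun s => (G s, u s)) (fun p : 'M[R]_n * 'rV[R]_n => ip p.1 p.2 p.2 : R^o)).
  exact: contw_pair.
apply: hasD_continuous; apply: C11_hasD.
apply: (@C11_ip _ _ _ (fun p : 'M[R]_n * 'rV[R]_n => p.1) (fun p => p.2) (fun p => p.2)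
  (fun _ h => h.1) (fun _ h => h.2) (fun _ h => h.2)).
- by apply: (@C11_lin _ _ _ _ _ 1) => [|h]; [exact: lin_fst|rewrite mul1r pair_norm1].
- by apply: (@C11_lin _ _ _ _ _ 1) => [|h]; [exact: lin_snd|rewrite mul1r pair_norm2].
- by apply: (@C11_lin _ _ _ _ _ 1) => [|h]; [exact: lin_snd|rewrite mul1r pair_norm2].
Qed.

(** Extending [f] by its end values makes it continuous on the whole line, so
    that the primitive is differentiable at the end points as well. *)
Lemma primitive_itv (a b : R) (f : R -> R) : a < b ->
  (forall t, a <= t -> t <= b -> contw `[a, b] (f : R -> R^o) t) ->
  exists F : R -> R, (forall t, a <= t -> t <= b -> hasd `[a, b] (F : R -> R^o) t (f t)) /\
   (\int[lebesgue_measure]_(t in `[a, b]) (f t)%:E)%E = (F b - F a)%:E.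
Proof.
move=> ab cf.
pose cl s := Num.max a (Num.min s b).
have clP s : a <= cl s /\ cl s <= b.
  by rewrite /cl le_max lexx ge_max ge_min lexx orbT (ltW ab).
have cl_id s : a <= s -> s <= b -> cl s = s.
  by move=> as_ sb; rewrite /cl (min_idPl sb) (max_idPr as_).
have cl_lip s t : `|cl s - cl t| <= `|s - t|.
  have W s' t' : s' <= t' -> `|cl s' - cl t'| <= `|s' - t'|.
    move=> st; rewrite distrC [`|s' - t'|]distrC (@ger0_norm _ (t' - s')) ?subr_ge0//.
    rewrite /cl ger0_norm; last first.
      rewrite subr_ge0 ge_max le_max lexx/= le_max; apply/orP; right.
      by rewrite le_min ge_min st/= ge_min lexx orbT.
    rewrite lerBlDr ge_max; apply/andP; split.
      have : a <= Num.max a (Num.min s' b) by rewrite le_max lexx.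
      lra.
    have h1 : Num.min s' b <= Num.max a (Num.min s' b) by rewrite le_max lexx orbT.
    have [sT|Ts] := leP s' b.
      have : Num.min t' b <= t' by rewrite ge_min lexx.
      move: h1; rewrite (min_idPl sT); lra.
    have : Num.min t' b <= b by rewrite ge_min lexx orbT.
    move: h1; rewrite (min_idPr (ltW Ts)); lra.
  by have [/W//|/ltW/W] := leP s t; rewrite distrC [`|t - s|]distrC.
pose g s := f (cl s).
have cg : continuous (g : R -> R^o).
  move=> t; apply/cvgrPdist_lt => e e0.
  have [c1 c2] := clP t; have /(@near_distP R R^o)[d d0 Hd] := cf _ c1 c2 e e0.
  apply/(@near_distP R R^o); exists d => // s sd; rewrite distrC; apply: Hd.
    exact: le_lt_trans (cl_lip _ _) sd.
  by apply/itvP_cc; exact: clP.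
have [pR _] := @ode_space_R R.
have [F [_ HF]] := pR (`|a| + `|b| + 1) (g : R -> R^o) cg.
have na := ler_norm a; have nb := ler_norm b.
have na' : - a <= `|a| by rewrite -normrN ler_norm.
have nb' : - b <= `|b| by rewrite -normrN ler_norm.
have HF' t : a <= t -> t <= b -> hasd setT F t (g t).
  by move=> at_ tb; apply: HF; rewrite ltr_norml; apply/andP; split; lra.
exists F; split.
  move=> t at_ tb; have := HF' t at_ tb; rewrite /g cl_id//.
  by apply: hasd_sub.
have cF t : a <= t -> t <= b -> F s @[s --> t] --> F t.
  move=> at_ tb; apply/cvgrPdist_lt => e e0.
  by apply: filterS (hasd_cont (HF' t at_ tb) e0) => s h; rewrite distrC; exact: h.
rewrite EFinB -(@continuous_FTC2 R g F a b ab) //.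
- apply: eq_integral => t; rewrite inE /= in_itv /= => /andP[at_ tb].
  by rewrite /g cl_id.
- exact: continuous_subspaceT.
- split.
  + move=> t; rewrite in_itv /= => /andP[/ltW at_ /ltW tb].
    by have [] := hasd_derive (HF' t at_ tb).
  + by apply: cvg_at_right_filter; exact: cF (lexx _) (ltW ab).
  + by apply: cvg_at_left_filter; exact: cF (ltW ab) (lexx _).
- move=> t; rewrite in_itv /= => /andP[/ltW at_ /ltW tb].
  by have [_] := hasd_derive (HF' t at_ tb).
Qed.

End Within.

(** * Speed, length and distance *)

Section Lengths.
Context {R : realType} {n : nat} {M : topologicalType}.
Variable X : riemannian_manifold R n M.
Implicit Types (c d : chart X) (q : M) (g : R -> M).
Local Notation E := 'rV[R]_n.

(** The metric is compatible with changes of chart, so the norm can be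
    computed in any chart. *)
Lemma tnorm_chart q c v : dom c q ->
  tnorm X q v = Num.sqrt (ip (gram c (coord c q)) (Dtau (chart_at X q) c (coord (chart_at X q) q) v)
                             (Dtau (chart_at X q) c (coord (chart_at X q) q) v)).
Proof.
move=> dc; rewrite /tnorm -/(ip _ _ _); congr Num.sqrt.
rewrite (@ip_tau _ _ _ X (chart_at X q) c); last first.
  by apply: overlap_coord => //; exact: chart_atP.
by rewrite tau_coord//; exact: chart_atP.
Qed.

Lemma curve_in_within c a b g x x' t : a < b -> a <= t -> t <= b ->
  curve_in c `[a, b] g x x' t ->
  C1_within `[a, b] (coord c \o g) t /\ derive_within `[a, b] (coord c \o g) t = x' t.
Proof.
move=> ab at_ tb cg; have At : `[a, b]%classic t by apply/itvP_cc.
case: cg => dc n1 n2 n3.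
have D s : `[a, b]%classic s -> hasd `[a, b] x s (x' s) ->
   (\forall u \near s, `[a, b]%classic u -> dom c (g u) /\ coord c (g u) = x u) ->
   derivable_within `[a, b] (coord c \o g) s /\ derive_within `[a, b] (coord c \o g) s = x' s.
  move=> As hx ns; have /itvP_cc[as_ sb] := As.
  apply: hasd_within; first exact: itv_proper.
  by apply: hasd_near hx => //; apply: filterS ns => u h Au; have [_ Eu] := h Au; rewrite /= Eu.
have [dt Et] := D t At (nbhs_singleton n2 At) n1.
split=> //; split=> //.
apply/(@contw_cvg R E); rewrite /contw Et => e e0.
move/near_join : (n1) => n1'.
apply: filterS3 n2 (n3 e e0) n1' => s h1 h2 h3 As.
by have [_ ->] := D s As (h1 As) h3; exact: h2.
Qed.

Lemma curve_in_cont c A g x x' t : A t -> curve_in c A g x x' t ->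
  g s @[s --> within A (nbhs t)] --> g t.
Proof.
move=> At cg; have [dc cx Ex Eg hx] := curve_in_at At cg.
rewrite Eg => U nU; have := para_continuous cx nU => /near_distP[r r0 Hr].
case: cg => _ n1 _ _.
suff : \forall s \near t, A s -> U (g s) by [].
near=> s => As.
have [dcs Es] : dom c (g s) /\ coord c (g s) = x s by move: As; near: s; exact: n1.
rewrite -(coordK dcs) Es; apply: Hr.
by move: As; near: s; exact: hasd_cont hx _ r0.
Unshelve. all: by end_near. Qed.

Lemma curve_in_C1 a b g : a < b ->
  (forall t, a <= t -> t <= b -> exists c x x', curve_in (c : chart X) `[a, b] g x x' t) ->
  C1_curve_on X `[a, b] g.
Proof.
move=> ab H; split.
  apply/subspace_continuousP => t At; have /itvP_cc[at_ tb] := At.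
  by have [c [x [x' cg]]] := H t at_ tb; exact: curve_in_cont cg.
move=> t d At dd; have /itvP_cc[at_ tb] := At.
have [c [x [x' cg]]] := H t at_ tb.
by have [] := curve_in_within ab at_ tb (curve_in_chart At cg dd).
Qed.

Lemma curve_in_speed c a b g x x' t : a < b -> a <= t -> t <= b ->
  curve_in c `[a, b] g x x' t ->
  speed_within X `[a, b] g t = Num.sqrt (ip (gram c (x t)) (x' t) (x' t)).
Proof.
move=> ab at_ tb cg; have At : `[a, b]%classic t by apply/itvP_cc.
have [dc cx Ex Eg hx] := curve_in_at At cg.
pose d := chart_at X (g t).
have dd : dom d (g t) by exact: chart_atP.
have [_ Ed] := curve_in_within ab at_ tb (curve_in_chart At cg dd).
have ox : overlap c d (x t) by rewrite -Ex; exact: overlap_coord.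
rewrite /speed_within -/d Ed /tnorm -/d -/(ip _ _ _) (ip_tau _ _ ox).
by rewrite -(tau_coord d dc) Ex.
Qed.

Lemma C1_curve_in c a b g t : a < b -> a <= t -> t <= b -> C1_curve_on X `[a, b] g ->
  dom c (g t) -> curve_in c `[a, b] g (coord c \o g) (derive_within `[a, b] (coord c \o g)) t.
Proof.
move=> ab at_ tb [/subspace_continuousP cg H] dc.
have At : `[a, b]%classic t by apply/itvP_cc.
have nd : \forall s \near t, `[a, b]%classic s -> dom c (g s).
  by apply: (cg t At); exact: open_nbhs_nbhs (conj (@dom_open _ _ _ X c) dc).
split=> //.
- by apply: filterS nd => s h As; split=> //; exact: h.
- apply: filterS nd => s h As; apply: within_hasd.
  by have [] := H s c As (h As).
- by have [_ /(@contw_cvg R E)] := H t c At dc.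
Qed.

Lemma speed_contw a b g t : a < b -> a <= t -> t <= b -> C1_curve_on X `[a, b] g ->
  contw `[a, b] (speed_within X `[a, b] g : R -> R^o) t.
Proof.
move=> ab at_ tb Cg; have At : `[a, b]%classic t by apply/itvP_cc.
pose c := chart_at X (g t); have dc : dom c (g t) by exact: chart_atP.
pose x := coord c \o g; pose x' := derive_within `[a, b] x.
have cg := C1_curve_in ab at_ tb Cg dc.
have [_ cx Ex Eg hx] := curve_in_at At cg.
case: (cg) => _ n1 _ n3.
apply: (@contw_near _ R^o _ (fun s => Num.sqrt (ip (gram c (x s)) (x' s) (x' s)))) => //.
  apply: filterS n1 => s h As; have [ds _] := h As; have /itvP_cc[as_ sb] := As.
  by rewrite (curve_in_speed ab as_ sb (C1_curve_in ab as_ sb Cg ds)).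
have H : contw `[a, b] (fun s => ip (gram c (x s)) (x' s) (x' s) : R^o) t.
  apply: contw_ip; last exact: n3.
  by move=> e e0; exact: hasd_cont (hasd_gram cx hx) _ e0.
exact: (contw_comp H (@sqrt_continuous R _)).
Qed.

Lemma length_primitive a b g : a < b -> C1_curve_on X `[a, b] g ->
  exists F : R -> R, (forall t, a <= t -> t <= b ->
      hasd `[a, b] (F : R -> R^o) t (speed_within X `[a, b] g t)) /\
   (\int[lebesgue_measure]_(t in `[a, b]) (speed_within X `[a, b] g t)%:E)%E = (F b - F a)%:E.
Proof.
move=> ab Cg; apply: primitive_itv => // t at_ tb; exact: speed_contw.
Qed.

Lemma length_le a b g (K : R) : a < b -> C1_curve_on X `[a, b] g ->
  (forall t, a <= t -> t <= b -> speed_within X `[a, b] g t <= K) ->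
  (\int[lebesgue_measure]_(t in `[a, b]) (speed_within X `[a, b] g t)%:E <= (K * (b - a))%:E)%E.
Proof.
move=> ab Cg HK; have [F [HF ->]] := length_primitive ab Cg; rewrite lee_fin.
rewrite (le_trans (ler_norm _))//; apply: (@mean_value_bound _ R^o F K a b (ltW ab)) => t at_ tb.
exists (speed_within X `[a, b] g t); first exact: HF.
by rewrite ger0_norm ?sqrtr_ge0// HK.
Qed.

Lemma dist_le_C1 g (K : R) : C1_curve_on X `[0, 1] g ->
  (forall t, 0 <= t -> t <= 1 -> speed_within X `[0, 1] g t <= K) ->
  (dist X (g 0%R) (g 1%R) <= K%:E)%E.
Proof.
move=> Cg HK; apply: ge_ereal_inf.
exists (\sum_(i < 1) \int[lebesgue_measure]_(t in `[(i%:R : R), i.+1%:R]) (speed_within X `[(i%:R : R), i.+1%:R] g t)%:E)%E.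
  exists g, 1%N, (fun i => i%:R); split=> //.
  - by split=> // i _; rewrite ltr_nat.
  - by case.
rewrite big_ord1 /=; have := length_le ltr01 Cg HK.
by rewrite subr0 mulr1.
Qed.

Lemma dist_le_piecewise_C1 g (K1 K2 : R) : C1_curve_on X `[0, 2^-1] g -> C1_curve_on X `[2^-1, 1] g ->
  (forall t, 0 <= t -> t <= 2^-1 -> speed_within X `[0, 2^-1] g t <= K1) ->
  (forall t, 2^-1 <= t -> t <= 1 -> speed_within X `[2^-1, 1] g t <= K2) ->
  (dist X (g 0%R) (g 1%R) <= (K1 / 2 + K2 / 2)%:E)%E.
Proof.
move=> C1 C2 H1 H2; apply: ge_ereal_inf.
pose p (i : nat) : R := i%:R / 2.
have p0 : p 0%N = 0 by rewrite /p mul0r.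
have p1 : p 1%N = 2^-1 by rewrite /p mul1r.
have p2 : p 2%N = 1 by rewrite /p divff.
exists (\sum_(i < 2) \int[lebesgue_measure]_(t in `[p i, p i.+1]) (speed_within X `[p i, p i.+1] g t)%:E)%E.
  exists g, 2%N, p; split=> //.
  - by split=> // i _; rewrite ltr_pM2r ?invr_gt0// ltr_nat.
  - by case=> [|[|//]] _; rewrite ?p0 p1 ?p2.
rewrite big_ord_recr big_ord1 /= p0 p1 p2 EFinD; apply: leeD.
  have := @length_le 0 (2^-1) g K1 _ C1 H1; rewrite subr0; apply; lra.
have := @length_le (2^-1) 1 g K2 _ C2 H2.
have -> : K2 * (1 - 2^-1) = K2 / 2 by lra.
apply; lra.
Qed.

(** Calibration: a function that varies along curves at most as fast as arc
    length bounds lengths from below. *)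
Lemma dist_ge (phi : M -> R) (y z : M) :
  (forall a b g, a < b -> C1_curve_on X `[a, b] g -> forall t, a <= t -> t <= b ->
     exists2 l, hasd `[a, b] (phi \o g : R -> R^o) t l & `|l| <= speed_within X `[a, b] g t) ->
  ((phi z - phi y)%:E <= dist X y z)%E.
Proof.
move=> H; apply: le_ereal_inf_tmp => _ [g [N [p [[p0 pN pS] g0 g1 Cg ->]]]].
have Ez : z = g (p N) by rewrite pN.
have Ey : y = g (p 0%N) by rewrite p0.
have -> : phi z - phi y = \sum_(i < N) (phi (g (p i.+1)) - phi (g (p i))).
  rewrite Ez Ey -(@big_mkord R 0 +%R N xpredT (fun i => phi (g (p i.+1)) - phi (g (p i)))).
  by rewrite (@telescope_sumr R 0%N N (fun i => phi (g (p i)))).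
rewrite -sumEFin; apply: lee_sum => i _.
have pi := pS i (ltn_ord i); have [F [HF ->]] := length_primitive pi (Cg i (ltn_ord i)).
rewrite lee_fin (le_trans (ler_norm _))//.
apply: (@mean_value_ineq _ R^o (phi \o g) F _ _ (ltW pi)) => t pt tp.
have [l hl lb] := H _ _ _ pi (Cg i (ltn_ord i)) t pt tp.
exists l, (speed_within X `[p i, p i.+1] g t); split=> //; exact: HF.
Qed.

End Lengths.

(** * Geodesics on the manifold *)

Section Geodesics.
Context {R : realType} {n : nat} {M : topologicalType}.
Variable X : riemannian_manifold R n M.
Implicit Types (c d : chart X) (q : M) (g : R -> M) (A : set R).
Local Notation E := 'rV[R]_n.

Lemma oo_open (a b : R) : open (`]a, b[%classic : set R).
Proof. exact: itv_open. Qed.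

(** Near [t], the chart [c] sees [g] as the solution [x] of the geodesic
    equation with velocity [x']. *)
Definition geo_in c g (x x' : R -> E) t :=
  [/\ dom c (g t), \forall s \near t, dom c (g s) /\ coord c (g s) = x s &
      \forall s \near t, hasd setT x s (x' s) /\
        hasd setT x' s (- connection_term c (x s) (x' s) (x' s))].

Lemma geo_in_curve c A g x x' t : geo_in c g x x' t -> curve_in c A g x x' t.
Proof.
move=> [dg n1 n2]; split=> //.
- by apply: filterS n1 => s h _.
- by apply: filterS n2 => s [h _] _; apply: hasd_sub h.
- move=> e e0; have [_ h] := nbhs_singleton n2.
  by apply: filterS (hasd_cont h e0) => s k _; exact: k.
Qed.

Lemma geo_in_at c g x x' t : geo_in c g x x' t ->
  [/\ dom c (g t), cod c (x t), coord c (g t) = x t, g t = para c (x t) &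
     derive1 (coord c \o g) t = x' t].
Proof.
move=> G; have [a b e f h] := curve_in_at (A := setT) I (geo_in_curve setT G).
split=> //; case: G => _ n1 _.
apply: (hasd_derive _).2; apply: hasd_near h => //.
by apply: filterS n1 => s [_ E'] _ /=; rewrite E'.
Qed.

Lemma geo_in_near c g x x' t : geo_in c g x x' t -> \forall s \near t, geo_in c g x x' s.
Proof.
move=> [dg n1 n2]; move/near_join : (n1) => n1'; move/near_join : (n2) => n2'.
by apply: filterS3 n1 n1' n2' => s [ds _] h1 h2.
Qed.

Lemma geo_in_chart c d g x x' t : geo_in c g x x' t -> dom d (g t) ->
  geo_in d g (fun s => tau c d (x s)) (fun s => Dtau c d (x s) (x' s)) t.
Proof.
move=> G dd; have cc := curve_in_chart (A := setT) I (geo_in_curve setT G) dd.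
case: cc => _ n1 n2 _; case: (G) => dc _ n3.
split; [exact: dd|by apply: filterS n1 => s h; exact: h|].
have [_ cx Ex Eg _] := geo_in_at G.
have ox : overlap c d (x t) by rewrite -Ex; exact: overlap_coord.
have [r r0 Hr] := near_ball_sub (@overlap_open _ _ _ X c d) ox.
have [hx _] := nbhs_singleton n3.
apply: filterS3 n2 n3 (hasd_cont hx r0) => s h2 [h3 h3'] h4; split; first exact: h2.
have os : overlap c d (x s) by apply: Hr; exact: h4.
have := hasd_Dtau (A := setT) I os h3 h3'.
have := geo_tau os (addNr (connection_term c (x s) (x' s) (x' s))).
by move=> /eqP; rewrite addr_eq0 => /eqP ->.
Qed.

Lemma geo_on_in A c g t : open A -> geodesic_on X A g -> A t -> dom c (g t) ->
  geo_in c g (coord c \o g) (derive1 (coord c \o g)) t.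
Proof.
move=> oA G At dc; have [gc H] := G t At.
have nd : \forall s \near t, dom c (g s).
  by apply: gc; exact: open_nbhs_nbhs (conj (@dom_open _ _ _ X c) dc).
have nA : \forall s \near t, A s by exact: open_nbhs_nbhs.
split=> //; first by apply: filterS nd => s.
apply: filterS2 nd nA => s ds As; have [_ /(_ c ds)[h1 h2 h3]] := G s As.
split; first exact: derive_hasd.
have := derive_hasd h2; move/eqP: h3; rewrite addr_eq0 => /eqP ->; exact.
Qed.

(** The geodesic equation is covariant, so at each time it is enough to check
    it in one chart. *)
Lemma in_geo_on A g : (forall t, A t -> exists c x x', geo_in (c : chart X) g x x' t) ->
  geodesic_on X A g.
Proof.
move=> H t At; have [c [x [x' G]]] := H t At; split.
  have := curve_in_cont (A := setT) I (geo_in_curve setT G).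
  move=> h U /h Hn; have {}Hn : \forall s \near t, setT s -> U (g s) by exact: Hn.
  by apply: filterS Hn => s; exact.
move=> d dd; have Gd := geo_in_chart G dd.
set y := (fun s => tau c d (x s)) in Gd; set y' := (fun s => Dtau c d (x s) (x' s)) in Gd.
move=> z z'.
have [_ cy Ey _ Ez'] := geo_in_at Gd.
have nz' : \forall s \near t, z' s = y' s.
  by apply: filterS (geo_in_near Gd) => s Gs; have [_ _ _ _] := geo_in_at Gs.
case: (Gd) => _ n1 n2; have [h1 h2] := nbhs_singleton n2.
have hz : hasd setT z t (y' t).
  by apply: hasd_near h1 => //; apply: filterS n1 => s [_ Es] _; rewrite /z /= Es.
have hz' : hasd setT z' t (- connection_term d (y t) (y' t) (y' t)).
  by apply: hasd_near h2 => //; apply: filterS nz' => s -> _.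
have [d1 _] := hasd_derive hz; have [d2 d2E] := hasd_derive hz'.
split=> //; rewrite d2E /z' Ez' /z /= Ey addNr//.
Qed.

Lemma near_affine (a b t : R) (P : R -> Prop) : (\forall s \near (a * t + b), P s) ->
  \forall s \near t, P (a * s + b).
Proof.
move=> /(@near_distP R R^o)[d d0 H].
have a1 : 0 < 1 + `|a| by rewrite ltr_pwDl.
apply/(@near_distP R R^o); exists (d / (1 + `|a|)); first by rewrite divr_gt0.
move=> s; rewrite ltr_pdivlMr// => sd; apply: H.
have -> : a * s + b - (a * t + b) = a * (s - t) by ring.
by rewrite normrM (le_lt_trans _ sd)// mulrC ler_wpM2l// lerDr.
Qed.

Lemma geo_in_affine c g x x' (a b t : R) : geo_in c g x x' (a * t + b) ->
  geo_in c (fun s => g (a * s + b)) (fun s => x (a * s + b)) (fun s => a *: x' (a * s + b)) t.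
Proof.
move=> [dg n1 n2]; split; [exact: dg|exact: near_affine n1|].
apply: filterS (near_affine n2) => s [h1 h2]; split; first exact: hasd_affine.
rewrite connection_scale -scalerN expr2 -scalerA; apply: hasdZ; exact: hasd_affine.
Qed.

Lemma geo_affine A B g (a b : R) : open A -> geodesic_on X A g ->
  (forall t, B t -> A (a * t + b)) -> geodesic_on X B (fun s => g (a * s + b)).
Proof.
move=> oA G AB; apply: in_geo_on => t /AB At.
have dc : dom (chart_at X (g (a * t + b))) (g (a * t + b)) by exact: chart_atP.
have Gc := geo_on_in oA G At dc.
by eexists _, _, _; exact: geo_in_affine Gc.
Qed.

(** The speed of a curve through its two-sided derivative, suited to geodesics
    on open intervals. *)
Definition gspeed g t : R := tnorm X (g t) (derive1 (coord (chart_at X (g t)) \o g) t).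

Lemma gspeedE c g x x' t : geo_in c g x x' t ->
  gspeed g t = Num.sqrt (ip (gram c (x t)) (x' t) (x' t)).
Proof.
move=> G; have [dc cx Ex Eg _] := geo_in_at G.
pose d := chart_at X (g t).
have dd : dom d (g t) by exact: chart_atP.
have [_ _ _ _ Ed] := geo_in_at (geo_in_chart G dd).
have ox : overlap c d (x t) by rewrite -Ex; exact: overlap_coord.
rewrite /gspeed -/d Ed /tnorm -/d -/(ip _ _ _) (ip_tau _ _ ox).
by rewrite -(tau_coord d dc) Ex.
Qed.

Lemma gspeed_der c g x x' t : geo_in c g x x' t ->
  hasd setT (fun s => gspeed g s ^+ 2 : R^o) t 0.
Proof.
move=> G; have [dc cx Ex Eg _] := geo_in_at G.
case: (G) => _ _ n2; have [h1 h2] := nbhs_singleton n2.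
have := energy_der cx h1 h2; apply: hasd_near => //.
apply: filterS (geo_in_near G) => s Gs _; have [_ cs _ _ _] := geo_in_at Gs.
by rewrite (gspeedE Gs) sqr_sqrtr// ip_ge0.
Qed.

Lemma gspeed_const a b g s t : geodesic_on X `]a, b[ g ->
  a < s -> s < b -> a < t -> t < b -> gspeed g s = gspeed g t.
Proof.
move=> G.
have W s' t' : s' <= t' -> a < s' -> t' < b -> gspeed g s' = gspeed g t'.
  move=> st as_ tb.
  have /eqP : gspeed g t' ^+ 2 = gspeed g s' ^+ 2.
    apply/eqP; rewrite -subr_eq0 -normr_le0.
    have := @mean_value_bound R R^o (fun u => gspeed g u ^+ 2) 0 s' t' st; rewrite mul0r; apply => u su ut.
    exists 0; last by rewrite normr0.
    have Au : `]a, b[%classic u by rewrite /= in_itv/=; apply/andP; split; lra.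
    have Gu := geo_on_in (@oo_open _ _) G Au (chart_atP X (g u)).
    by apply: hasd_sub (gspeed_der Gu).
  have g0 u : 0 <= gspeed g u := sqrtr_ge0 _.
  move: (gspeed g t') (gspeed g s') (g0 t') (g0 s') => p r p0 r0.
  by rewrite eqrXn2// => /eqP.
move=> as_ sb at_ tb; have [st|/ltW ts] := leP s t; [exact: W|by rewrite (W t s)].
Qed.

Lemma geodesic_field_lip c (z0 : E * E) : cod c z0.1 -> exists r L : R, [/\ 0 < r, 0 <= L &
  forall z z', `|z - z0| < r -> `|z' - z0| < r -> `|geodesic_field c z - geodesic_field c z'| <= L * `|z - z'|].
Proof.
move=> cz; have [dg cg] := C11eN (connection_C11e cz).
have c2 : C11 (fun z : E * E => z.2) (fun _ h => h.2) z0.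
  by apply: (@C11_lin _ _ _ _ _ 1) => [|h]; [exact: lin_snd|rewrite mul1r pair_norm2].
have [r [L [r0 L0 H]]] := C11_pair c2 cg.
exists r, L; split=> // z z' zr z'r.
by have [_ _ /(_ _ zr)[_ _]] := H z' z'r.
Qed.

(** Gronwall's inequality for the difference of the two solutions of the
    first-order system. *)
Lemma geo_local_unique c g1 g2 x1 x1' x2 x2' t : geo_in c g1 x1 x1' t -> geo_in c g2 x2 x2' t ->
  x1 t = x2 t -> x1' t = x2' t ->
  exists2 d : R, 0 < d & forall s, t < s -> s < t + d -> g1 s = g2 s.
Proof.
move=> G1 G2 E1 E2; have [_ cx _ _ _] := geo_in_at G1.
have [r [L [r0 L0 HL]]] := @geodesic_field_lip c (x1 t, x1' t) cx.
pose z1 s := (x1 s, x1' s); pose z2 s := (x2 s, x2' s).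
case: (G1) => _ n1 n1'; case: (G2) => _ n2 n2'.
have hz1 : \forall s \near t, hasd setT z1 s (geodesic_field c (z1 s)).
  by apply: filterS n1' => s [h1 h2]; exact: hasd_pair.
have hz2 : \forall s \near t, hasd setT z2 s (geodesic_field c (z2 s)).
  by apply: filterS n2' => s [h1 h2]; exact: hasd_pair.
have b1 := hasd_cont (nbhs_singleton hz1) r0.
have b2 := hasd_cont (nbhs_singleton hz2) r0.
have z12 : z2 t = z1 t by rewrite /z1 /z2 E1 E2.
have /(@near_distP R R^o)[d d0 Hd] : \forall s \near t,
   [/\ hasd setT z1 s (geodesic_field c (z1 s)), hasd setT z2 s (geodesic_field c (z2 s)),
     `|z1 s - z1 t| < r /\ `|z2 s - z1 t| < r & coord c (g1 s) = x1 s /\ coord c (g2 s) = x2 s /\ dom c (g1 s) /\ dom c (g2 s)].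
  apply: filterS3 hz1 hz2 (filterI (filterI b1 b2) (filterI n1 n2)) => s k1 k2 [[k3 k4] [[k5 k6] [k7 k8]]].
  split; [exact: k1|exact: k2| |exact: (conj k6 (conj k8 (conj k5 k7)))].
  by split; [exact: k3|rewrite -z12; exact: k4].
have L1 : 0 < L + 1 by lra.
pose T := Num.min (d / 2) ((2 * (L + 1))^-1).
have T0 : 0 < T by rewrite lt_min divr_gt0//= invr_gt0 mulr_gt0.
have Td : T < d.
  have : T <= d / 2 by rewrite ge_min lexx.
  lra.
have LT : L * T <= 2^-1.
  have : T * (2 * (L + 1)) <= 1.
    by rewrite -ler_pdivlMr ?mulr_gt0// div1r ge_min lexx orbT.
  lra.
exists T => // s ts sT.
have Hn u : 0 <= u -> u <= T -> `|u + t - t| < d.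
  by move=> u0 uT; rewrite addrK ger0_norm//; lra.
pose e (u : R) := z1 (1 * u + t) - z2 (1 * u + t).
have := @gronwall R _ e L 0 T (ltW T0) L0 (lexx _) LT.
move=> /(_ _ (s - t)) H.
have : `|e (s - t)| <= 2 * (`|e 0| + T * 0).
  apply: H; [|by lra|by lra] => u u0 uT.
  have [h1 h2 [r1 r2] _] := Hd _ (Hn u u0 uT).
  exists (geodesic_field c (z1 (1 * u + t)) - geodesic_field c (z2 (1 * u + t))).
    apply: (@hasd_sub _ _ setT) => //.
    rewrite -[geodesic_field c (z1 _)]scale1r -[geodesic_field c (z2 _)]scale1r.
    by apply: hasdB; apply: hasd_affine; rewrite mul1r.
  by rewrite addr0 /e mul1r; apply: HL.
rewrite /e !mul1r subrK add0r z12 subrr normr0 mulr0 addr0 mulr0 normr_le0 subr_eq0 => /eqP Es.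
have [_ _ _ [c1 [c2 [d1 d2]]]] := Hd s (ltac:(rewrite gtr0_norm; lra)).
have [Ex _] : x1 s = x2 s /\ x1' s = x2' s by case: Es.
by rewrite -(coordK d1) -(coordK d2) c1 c2 Ex.
Unshelve. all: by end_near. Qed.

(** Real induction. At a limit time the positions agree because [M] is
    Hausdorff, and the velocities because a left derivative is unique. *)
Lemma geo_unique a b g1 g2 t0 c0 : geodesic_on X `]a, b[ g1 -> geodesic_on X `]a, b[ g2 ->
  a < t0 -> g1 t0 = g2 t0 -> dom c0 (g1 t0) ->
  derive1 (coord c0 \o g1) t0 = derive1 (coord c0 \o g2) t0 ->
  forall t, t0 <= t -> t < b -> g1 t = g2 t.
Proof.
move=> G1 G2 at0 E0 dc0 D0 T t0T Tb.
have inA t : t0 <= t -> t <= T -> `]a, b[%classic t.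
  by move=> h1 h2; rewrite /= in_itv/=; apply/andP; split; lra.
have step c t : t0 <= t -> t < T -> g1 t = g2 t -> dom c (g1 t) ->
   derive1 (coord c \o g1) t = derive1 (coord c \o g2) t ->
   exists2 d : R, 0 < d & forall s, t < s -> s < t + d -> s <= T -> g1 s = g2 s.
  move=> tt tT Et dc Dt.
  have At := inA t tt (ltW tT).
  have dc2 : dom c (g2 t) by rewrite -Et.
  have H1 := geo_on_in (@oo_open _ _) G1 At dc.
  have H2 := geo_on_in (@oo_open _ _) G2 At dc2.
  have [|d d0 Hd] := geo_local_unique H1 H2 _ Dt; first by rewrite /= Et.
  by exists d; [exact: d0|move=> s h1 h2 _; exact: (Hd s h1 h2)].
apply: (@real_induction R t0 T (fun t => g1 t = g2 t) t0T E0 _ _ T t0T (lexx T)).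
- move=> t tt tT IH; have Et := IH t tt (lexx _).
  move: (tt); rewrite le_eqVlt => /orP[/eqP tt0|t0t].
    by apply: (step c0 t tt tT Et); rewrite -tt0; [exact: dc0|exact: D0].
  set c := chart_at X (g1 t).
  apply: (step c t tt tT Et); first exact: chart_atP.
  have At := inA t tt (ltW tT).
  have dc : dom c (g1 t) by exact: chart_atP.
  have dc2 : dom c (g2 t) by rewrite -Et.
  case: (geo_on_in (@oo_open _ _) G1 At dc) => _ m1 /nbhs_singleton [h1 _].
  case: (geo_on_in (@oo_open _ _) G2 At dc2) => _ m2 /nbhs_singleton [h2 _].
  apply: (hasd_unique (itv_proper t0t tt (lexx _)) (hasd_sub (fun _ _ => I) h1)).
  apply: hasd_near (hasd_sub (fun _ _ => I) h2); first by apply/itvP_cc.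
  apply/(@near_distP R R^o); exists 1 => // s _ /itvP_cc[ts st].
  by rewrite /= IH.
- move=> t t0t tT IH; have At := inA t (ltW t0t) tT.
  have [gc1 _] := G1 t At; have [gc2 _] := G2 t At.
  apply: (@rm_hausdorff _ _ _ X) => A B nA nB.
  have /(@near_distP R R^o)[d1 d10 H1] : \forall s \near t, A (g1 s) by exact: gc1.
  have /(@near_distP R R^o)[d2 d20 H2] : \forall s \near t, B (g2 s) by exact: gc2.
  pose d := Num.min (Num.min d1 d2) (t - t0).
  have d0 : 0 < d by rewrite !lt_min d10 d20 subr_gt0.
  have dd1 : d <= d1 by rewrite !ge_min lexx.
  have dd2 : d <= d2 by rewrite !ge_min lexx orbT.
  have dd3 : d <= t - t0 by rewrite !ge_min lexx !orbT.
  have nd : `|t - d / 2 - t| = d / 2 by rewrite addrC addKr normrN gtr0_norm//; lra.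
  exists (g1 (t - d / 2)); split; first by apply: H1; rewrite nd; lra.
  by rewrite IH; [apply: H2; rewrite nd; lra|lra|lra].
Qed.

Lemma geodesic_sub A B g : B `<=` A -> geodesic_on X A g -> geodesic_on X B g.
Proof. by move=> BA G t /BA; exact: G. Qed.

Definition geodesic_from q v (e b : R) g :=
  [/\ geodesic_on X `](- e), b[ g, g 0 = q & derive1 (coord (chart_at X q) \o g) 0 = v].

Lemma geodesic_from_unique q v e1 b1 e2 b2 g1 g2 : 0 < e1 -> 0 < e2 ->
  geodesic_from q v e1 b1 g1 -> geodesic_from q v e2 b2 g2 ->
  forall t, 0 <= t -> t < b1 -> t < b2 -> g1 t = g2 t.
Proof.
move=> e10 e20 [G1 q1 v1] [G2 q2 v2] t t0 tb1 tb2.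
pose e := Num.min e1 e2; pose b := Num.min b1 b2.
have e0 : 0 < e by rewrite lt_min e10.
have l1 : e <= e1 by rewrite ge_min lexx.
have l2 : e <= e2 by rewrite ge_min lexx orbT.
have l3 : b <= b1 by rewrite ge_min lexx.
have l4 : b <= b2 by rewrite ge_min lexx orbT.
apply: (@geo_unique (- e) b g1 g2 0 (chart_at X q)).
- apply: geodesic_sub G1 => s /=; rewrite !in_itv/= => /andP[h1 h2]; apply/andP; split; lra.
- apply: geodesic_sub G2 => s /=; rewrite !in_itv/= => /andP[h1 h2]; apply/andP; split; lra.
- lra.
- by rewrite q1 q2.
- by rewrite q1; exact: chart_atP.
- by rewrite v1 v2.
- exact: t0.
- by rewrite lt_min tb1.
Qed.

(** By uniqueness the set from which [Exp] selects a value has one element. *)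
Lemma Exp_geodesic q v e b g : 0 < e -> 1 < b -> geodesic_from q v e b g -> Exp X q v = g 1.
Proof.
move=> e0 b1 G; apply: xget_subset1.
  exists g, (Num.min e (b - 1)).
  have m1 : Num.min e (b - 1) <= e by rewrite ge_min lexx.
  have m2 : Num.min e (b - 1) <= b - 1 by rewrite ge_min lexx orbT.
  case: G => G q0 v0; split=> //; first by rewrite lt_min e0 subr_gt0.
  by apply: geodesic_sub G => s /=; rewrite !in_itv/= => /andP[h1 h2]; apply/andP; split; lra.
move=> y1 y2 [g1 [e1 [e10 G1 q1 v1 <-]]] [g2 [e2 [e20 G2 q2 v2 <-]]].
have k1 : 1 < 1 + e1 by rewrite ltrDl.
have k2 : 1 < 1 + e2 by rewrite ltrDl.
exact: (geodesic_from_unique e10 e20 (And3 G1 q1 v1) (And3 G2 q2 v2) ler01 k1 k2).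
Qed.

Lemma geodesic_from_scale q v e b g (a : R) : 0 <= a -> 0 < e -> geodesic_from q v e b g ->
  forall e' b' : R, a * e' <= e -> a * b' <= b -> 0 < e' -> 0 < b' -> 0 < b ->
  geodesic_from q (a *: v) e' b' (fun s => g (a * s)).
Proof.
move=> a0 e0 [G q0 v0] e' b' ae ab e'0 b'0 b0.
have Eg : (fun s => g (a * s)) = (fun s => g (a * s + 0)) by apply/funext => s; rewrite addr0.
have dc : dom (chart_at X q) (g (a * 0 + 0)) by rewrite mulr0 addr0 q0; exact: chart_atP.
have A0 : `](- e), b[%classic (a * 0 + 0 : R) by rewrite /= in_itv/= mulr0 addr0; apply/andP; split; lra.
split; last 1 first.
- rewrite Eg; have := geo_in_at (geo_in_affine (geo_on_in (@oo_open _ _) G A0 dc)).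
  by move=> [_ _ _ _ ->]; rewrite mulr0 addr0 v0.
- rewrite Eg; apply: geo_affine (@oo_open _ _) G _ => t /=.
  rewrite !in_itv/= addr0 => /andP[h1 h2]; move: a0; rewrite le_eqVlt => /orP[/eqP <-|a0].
    by rewrite mul0r; apply/andP; split; lra.
  have k1 : a * - e' < a * t by rewrite ltr_pM2l.
  have k2 : a * t < a * b' by rewrite ltr_pM2l.
  by apply/andP; split; lra.
- by rewrite mulr0.
Qed.

Lemma gspeed_from q v e b g : 0 < e -> 0 < b -> geodesic_from q v e b g ->
  forall t, - e < t -> t < b -> gspeed g t = tnorm X q v.
Proof.
move=> e0 b0 [G q0 v0] t et tb.
rewrite (@gspeed_const (- e) b g t 0)//; last by lra.
by rewrite /gspeed q0 v0.
Qed.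

End Geodesics.

(** * Maps near the identity *)

Section NearIdentity.
Context {R : realType} {n : nat}.
Local Notation E := 'rV[R]_n.
Variables (e : E -> E) (r : R).
Hypothesis He : forall v w, `|v| < r -> `|w| < r -> `|e v - e w - (v - w)| <= 2^-1 * `|v - w|.

Lemma near_id_inj v w : `|v| < r -> `|w| < r -> `|v - w| <= 2 * `|e v - e w|.
Proof.
move=> vr wr; have h := He vr wr.
have : `|v - w| <= `|e v - e w - (v - w)| + `|e v - e w|.
  by rewrite -{1}[v - w](subKr (e v - e w)) (le_trans (ler_normB _ _))// addrC.
lra.
Qed.

Lemma near_id_lip v w : `|v| < r -> `|w| < r -> `|e v - e w| <= 2 * `|v - w|.
Proof.
move=> vr wr; have h := He vr wr; rewrite -(subrK (v - w) (e v - e w)).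
rewrite (le_trans (ler_normD _ _))//; have := normr_ge0 (v - w); lra.
Qed.

(** The iteration [v |-> v - (e v - y)] contracts by one half. *)
Lemma near_id_surj v0 (s : R) y : (forall v, `|v - v0| <= s -> `|v| < r) -> `|y - e v0| <= s / 2 ->
  exists2 v, `|v - v0| <= s & e v = y.
Proof.
move=> Hs ys.
have s0 : 0 <= s by have := le_trans (normr_ge0 _) ys; lra.
pose u k := iter k (fun v => v - (e v - y)) v0.
have uS k : u k.+1 = u k - (e (u k) - y) by [].
have H k : `|u k - v0| <= s * (1 - 2^-1 ^+ k) /\ `|u k.+1 - u k| <= s / 2 * 2^-1 ^+ k.
  elim: k => [|k [IH1 IH2]].
    rewrite subrr normr0 expr0 subrr mulr0 mulr1; split=> //.
    by rewrite uS [u 0%N]/u /= addrC addKr normrN distrC.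
  have p0 : 0 <= (2^-1 : R) ^+ k by rewrite exprn_ge0.
  have h1 : `|u k.+1 - v0| <= s * (1 - 2^-1 ^+ k.+1).
    rewrite -(subrK (u k) (u k.+1)) -addrA (le_trans (ler_normD _ _))// exprS; lra.
  split=> //.
  have a1 : `|u k.+1| < r.
    apply: Hs; rewrite (le_trans h1)// ler_piMr// gerBl exprn_ge0//.
  have a2 : `|u k| < r by apply: Hs; rewrite (le_trans IH1)// ler_piMr// gerBl exprn_ge0.
  have -> : u k.+2 - u k.+1 = - (e (u k.+1) - e (u k) - (u k.+1 - u k)).
    by rewrite (uS k.+1) {5}(uS k); vlinear R.
  by rewrite normrN (le_trans (He a1 a2))// exprS; lra.
have [_ cE] := @ode_space_rV R n.
have [l Hl] := cE u (s / 2) (fun k => (H k).2).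
have ls : `|l - v0| <= s.
  by have := Hl 0%N; rewrite expr0 mulr1 [u 0%N]/u /= distrC => h; lra.
exists l => //; apply/eqP; rewrite -subr_eq0 -normr_le0.
apply: (@le0_geom R _ (3 * s)) => k.
have ur : `|u k| < r.
  apply: Hs; rewrite (le_trans (H k).1)// ler_piMr// gerBl exprn_ge0//.
have h1 := near_id_lip (Hs _ ls) ur; have h2 := Hl k; have h3 := (H k).2.
have -> : e l - y = (e l - e (u k)) - (u k.+1 - u k) by rewrite uS; vlinear R.
rewrite (le_trans (ler_normB _ _))//; rewrite distrC in h2.
have := mulr_ge0 s0 (exprn_ge0 k (ltac:(lra) : 0 <= 2^-1 :> R)); lra.
Qed.

End NearIdentity.

(** * Lifting a curve through a map near the identity *)

Section LogCurve.
Context {R : realType} {n : nat}.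
Local Notation E := 'rV[R]_n.

(** Compare the two first-order approximations of [e] at [v0] along a small
    multiple of [h]. *)
Lemma near_id_der (e : E -> E) (de : E -> E) (r C : R) v0 : 0 <= C ->
  (forall v w, `|v| < r -> `|w| < r -> `|e v - e w - (v - w)| <= 2^-1 * `|v - w|) ->
  lin de -> `|v0| < r ->
  (forall w, `|w| < r -> `|e w - e v0 - de (w - v0)| <= C * `|w - v0| ^+ 2) ->
  forall h, `|de h - h| <= 2^-1 * `|h|.
Proof.
move=> C0 He lde Vt Hde h.
have [->|h0] := eqVneq h 0; first by rewrite (lin0 lde) subrr normr0 mulr0.
have nh : 0 < `|h| by rewrite normr_gt0.
apply/ler_addgt0Pr => ep ep0.
pose s := Num.min ((r - `|v0|) / (2 * `|h|)) (ep / ((C + 1) * `|h| ^+ 2)).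
have C1 : 0 < C + 1 by lra.
have s0 : 0 < s by rewrite lt_min !divr_gt0 ?mulr_gt0 ?exprn_gt0 ?subr_gt0.
have s1 : s * (2 * `|h|) <= r - `|v0| by rewrite -ler_pdivlMr ?mulr_gt0// ge_min lexx.
have s2 : s * ((C + 1) * `|h| ^+ 2) <= ep.
  by rewrite -ler_pdivlMr ?mulr_gt0 ?exprn_gt0// ge_min lexx orbT.
have nsh : `|s *: h| = s * `|h| by rewrite normrZ gtr0_norm.
have wr : `|v0 + s *: h| < r.
  rewrite (le_lt_trans (ler_normD _ _))// nsh.
  have := mulr_gt0 s0 nh; lra.
have h1 := He _ _ wr Vt; have h2 := Hde _ wr.
rewrite [v0 + _]addrC addrK in h1 h2.
rewrite nsh in h1 h2; rewrite -(ler_pM2l s0).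
have -> : s * `|de h - h| = `|s *: (de h - h)| by rewrite normrZ gtr0_norm.
have -> : s *: (de h - h) = (e (s *: h + v0) - e (v0) - s *: h) - (e (s *: h + v0) - e (v0) - de (s *: h)).
  by rewrite (linZ lde); vlinear R.
rewrite (le_trans (ler_normB _ _))// (le_trans (lerD h1 h2))//.
have sh2 : 0 <= s * `|h| ^+ 2 by rewrite mulr_ge0 ?sqr_ge0// ltW.
have : C * (s * `|h|) ^+ 2 <= s * ep.
  have -> : C * (s * `|h|) ^+ 2 = s * (s * (C * `|h| ^+ 2)) by ring.
  rewrite ler_pM2l//; lra.
lra.
Qed.

(** By [near_id_inj], [V] is as Lipschitz at [t] as [x] is; the Taylor
    expansion of [e] at [V t] then gives the derivative. *)
Lemma log_hasd (e : E -> E) (de : E -> E) (r C : R) (A : set R) (V x : R -> E) t x' :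
  0 <= C -> A t ->
  (forall v w, `|v| < r -> `|w| < r -> `|e v - e w - (v - w)| <= 2^-1 * `|v - w|) ->
  lin de ->
  (forall w, `|w| < r -> `|e w - e (V t) - de (w - V t)| <= C * `|w - V t| ^+ 2) ->
  (\forall s \near t, A s -> `|V s| < r /\ e (V s) = x s) ->
  hasd A x t x' ->
  exists V', de V' = x' /\ hasd A V t V'.
Proof.
move=> C0 At He lde Hde nV hx.
have [Vt EVt] := nbhs_singleton nV At.
have Hd := near_id_der C0 He lde Vt Hde.
have Hdd v w : `|v| < (2 * `|x'| + 1) -> `|w| < (2 * `|x'| + 1) -> `|de v - de w - (v - w)| <= 2^-1 * `|v - w|.
  by move=> _ _; rewrite -(linB lde); exact: Hd.
have [V' _ EV'] : exists2 V', `|V' - 0| <= 2 * `|x'| & de V' = x'.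
  apply: (near_id_surj Hdd) => [v|]; first by rewrite subr0; lra.
  by rewrite (lin0 lde) subr0; lra.
exists V'; split=> // ep ep0.
have Hinv h : `|h| <= 2 * `|de h|.
  have := Hd h; have : `|h| <= `|de h - h| + `|de h|.
    by rewrite -{1}[h](subKr (de h)) (le_trans (ler_normB _ _))// addrC.
  lra.
have e4 : 0 < ep / 4 by lra.
pose k := 2 * (1 + `|x'|).
have k0 : 0 < k by rewrite mulr_gt0// ltr_pwDl.
have C1 : 0 < C + 1 by lra.
near=> s => As.
have [Vs EVs] : `|V s| < r /\ e (V s) = x s by move: As; near: s; exact: nV.
have h1 : `|x s - x t - (s - t) *: x'| <= ep / 4 * `|s - t| by move: As; near: s; exact: hx.
have h1' : `|x s - x t - (s - t) *: x'| <= 1 * `|s - t| by move: As; near: s; exact: hx.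
have h2 : `|s - t| <= ep / (4 * (C + 1) * k ^+ 2).
  apply/ltW; near: s; apply: (@near_dist R R^o).
  by rewrite divr_gt0// !mulr_gt0 ?exprn_gt0.
have h3 : `|V s - V t| <= k * `|s - t|.
  rewrite (le_trans (near_id_inj He Vs Vt))// EVs EVt /k -mulrA ler_wpM2l//.
  rewrite -(subrK ((s - t) *: x') (x s - x t)) (le_trans (ler_normD _ _))// normrZ.
  lra.
rewrite (le_trans (Hinv _))//.
have -> : de (V s - V t - (s - t) *: V') =
  (x s - x t - (s - t) *: x') - (e (V s) - e (V t) - de (V s - V t)).
  by rewrite (linB lde (V s - V t)) (linZ lde) EV' EVs EVt; vlinear R.
have h4 := Hde _ Vs.
have h5 : C * `|V s - V t| ^+ 2 <= ep / 4 * `|s - t|.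
  have st0 := normr_ge0 (s - t).
  apply: (@le_trans _ _ (C * (k * `|s - t|) ^+ 2)).
    by rewrite ler_wpM2l// lerXn2r ?nnegrE// mulr_ge0// ltW.
  have -> : C * (k * `|s - t|) ^+ 2 = (C * k ^+ 2 * `|s - t|) * `|s - t| by ring.
  rewrite ler_wpM2r//.
  have k2 : 0 < k ^+ 2 by rewrite exprn_gt0.
  move: h2; rewrite ler_pdivlMr ?mulr_gt0// => h2.
  have := mulr_ge0 (ltW k2) st0; lra.
rewrite (le_trans (ler_wpM2l _ (ler_normB _ _)))//; lra.
Unshelve. all: by end_near. Qed.

Lemma log_deriv_cont (de : E -> E -> E) (C : R) (A : set R) (V V' x' : R -> E) t :
  0 <= C -> A t ->
  (\forall s \near t, A s -> [/\ lin (de (V s)), forall h, `|de (V s) h - h| <= 2^-1 * `|h|,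
     (forall h, `|de (V s) h - de (V t) h| <= C * `|V s - V t| * `|h|) & de (V s) (V' s) = x' s]) ->
  contw A V t -> contw A x' t -> contw A V' t.
Proof.
move=> C0 At nH cV cx' ep ep0.
have C1 : 0 < C * `|V' t| + 1 by rewrite ltr_wpDl// mulr_ge0.
have e4 : 0 < ep / 4 by lra.
have e5 : 0 < ep / (4 * (C * `|V' t| + 1)) by rewrite divr_gt0// mulr_gt0.
have [_ _ _ Et] := nbhs_singleton nH At.
apply: filterS3 nH (cV _ e5) (cx' _ e4) => s Hs h1 h2 As.
have [l Hd Hl Es] := Hs As; have {}h1 := h1 As; have {}h2 := h2 As.
have Hinv h : `|h| <= 2 * `|de (V s) h|.
  have := Hd h; have : `|h| <= `|de (V s) h - h| + `|de (V s) h|.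
    by rewrite -{1}[h](subKr (de (V s) h)) (le_trans (ler_normB _ _))// addrC.
  lra.
rewrite (le_lt_trans (Hinv _))//.
have -> : de (V s) (V' s - V' t) = (x' s - x' t) - (de (V s) (V' t) - de (V t) (V' t)).
  by rewrite (linB l) Es Et; vlinear R.
have h3 := Hl (V' t).
have : C * `|V s - V t| * `|V' t| <= ep / 4.
  move: h1; rewrite ltr_pdivlMr ?mulr_gt0// => h1.
  have := normr_ge0 (V s - V t); lra.
move=> h4; rewrite (le_lt_trans (ler_wpM2l _ (ler_normB _ _)))//; lra.
Qed.

End LogCurve.

(** * Smooth truncation *)

Section Cap.
Context {R : realType}.

Definition pos_part (x : R) : R := Num.max 0 x.

Lemma pos_part_ge0 x : 0 <= pos_part x. Proof. by rewrite le_max lexx. Qed.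
Lemma pos_part_id x : 0 <= x -> pos_part x = x. Proof. by move=> x0; exact: max_r. Qed.
Lemma pos_part_0 x : x <= 0 -> pos_part x = 0. Proof. by move=> x0; exact: max_l. Qed.

Lemma hasd_sqr_pos_part A (f : R -> R) t l : A t -> hasd A (f : R -> R^o) t l ->
  hasd A (fun s => pos_part (f s) ^+ 2 : R^o) t (2 * pos_part (f t) * l).
Proof.
move=> At hf.
apply: (@hasd_comp R R^o R^o A f (fun x => pos_part x ^+ 2) t l (fun h => 2 * pos_part (f t) * h)) => //.
split.
- by move=> a u v; rewrite mulrDr /GRing.scale/=; ring.
- exists (2 * pos_part (f t)); first by rewrite mulr_ge0// pos_part_ge0.
  by move=> h; rewrite normrM ger0_norm// mulr_ge0// pos_part_ge0.
move=> e e0; apply/(@near_distP R R^o); exists e => // y ye.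
apply: (@le_trans _ _ (`|y - f t| ^+ 2)); last by rewrite expr2 ler_wpM2r// ltW.
rewrite real_normK ?num_real//.
set b := f t.
have [y0|y0] := leP 0 y; have [b0|b0] := leP 0 b.
- by rewrite !pos_part_id//= ler_norml; have := sqr_ge0 (y - b); rewrite !expr2 => h; apply/andP; split; lra.
- rewrite (pos_part_id y0) (pos_part_0 (ltW b0)) expr0n /= mulr0 mul0r !subr0 ger0_norm ?sqr_ge0//.
  by rewrite lerXn2r ?nnegrE//; lra.
- rewrite (pos_part_0 (ltW y0)) (pos_part_id b0) expr0n /=.
  rewrite ler_norml; have h1 : 0 <= b * b by rewrite mulr_ge0.
  have h2 : 0 <= y * y by rewrite -expr2 sqr_ge0.
  have h3 : 0 <= - (y * b) by rewrite -mulNr mulr_ge0// oppr_ge0 ltW.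
  by rewrite !expr2; apply/andP; split; lra.
- rewrite (pos_part_0 (ltW y0)) (pos_part_0 (ltW b0)) expr0n /= mulr0 mul0r !subr0 normr0; exact: sqr_ge0.
Qed.

Variables (a D : R).
Hypotheses (a0 : 0 < a) (D0 : 0 < D) (Da : D <= a).

(** A primitive of [dcap], which decreases linearly from [1] at [a] to [0] at
    [a + D]. Applied to the squared radius it gives a function that is
    constant outside a ball, hence is defined on the whole manifold. *)
Definition cap (w : R) : R := w - pos_part (w - a) ^+ 2 / (2 * D) + pos_part (w - (a + D)) ^+ 2 / (2 * D).
Definition dcap (w : R) : R := 1 - pos_part (w - a) / D + pos_part (w - (a + D)) / D.

Lemma cap_small w : w <= a -> cap w = w.
Proof.
move=> wa; have D0' := D0; rewrite /cap (@pos_part_0 (w - a)) ?(@pos_part_0 (w - (a + D))); try lra.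
Qed.

Lemma cap_large w : a + D <= w -> cap w = cap (a + D).
Proof.
move=> wa; have D0' := D0.
have k1 : 0 <= w - a by lra.
have k2 : 0 <= w - (a + D) by lra.
have k3 : 0 <= a + D - a by lra.
have k4 : a + D - (a + D) <= 0 by lra.
rewrite /cap (pos_part_id k1) (pos_part_id k2) (pos_part_id k3) (pos_part_0 k4).
by field; rewrite gt_eqF.
Qed.

(** The last inequality says that the square root of [cap (r ^+ 2)] has slope
    at most [1] in [r]. *)
Lemma dcap_bound w : 0 <= w -> [/\ 0 <= dcap w, 0 <= cap w & w * dcap w ^+ 2 <= cap w].
Proof.
move=> w0; have D0' := D0; have a0' := a0; have Da' := Da.
have [wa|aw] := leP w a.
  have -> : dcap w = 1.
    rewrite /dcap (@pos_part_0 (w - a)) ?(@pos_part_0 (w - (a + D))); lra.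
  by rewrite cap_small// expr1n mulr1.
have [wD|Dw] := leP w (a + D).
  have wa0 : 0 <= w - a by lra.
  have wd0 : w - (a + D) <= 0 by lra.
  pose u := (w - a) / D.
  have u0 : 0 <= u by rewrite divr_ge0// ltW.
  have u1 : u <= 1 by rewrite ler_pdivrMr// mul1r; lra.
  have wE : w = a + u * D by rewrite divfK ?gt_eqF//; lra.
  have -> : dcap w = 1 - u by rewrite /dcap (pos_part_id wa0) (pos_part_0 wd0) mul0r addr0.
  have -> : cap w = a + u * D - u ^+ 2 * D / 2.
    rewrite /cap (pos_part_id wa0) (pos_part_0 wd0) expr0n mul0r addr0 {1}wE /u.
    by field; rewrite gt_eqF.
  have uu : u * u <= u by rewrite -[leRHS]mulr1 ler_wpM2l.
  have uu0 : 0 <= u * u by rewrite mulr_ge0.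
  have uD : u * D <= u * a by rewrite ler_wpM2l.
  have uuD : u * u * D <= u * D by rewrite ler_wpM2r// ltW.
  have uuD0 : 0 <= u * u * D by rewrite mulr_ge0// ltW.
  have uD0 : 0 <= u * D by rewrite mulr_ge0// ltW.
  split; [lra|by rewrite expr2; lra|].
  rewrite {1}wE !expr2.
  have k1 : (a + u * D) * (1 - u) <= a.
    rewrite mulrDl mulrBr mulr1 mulrBr mulr1; lra.
  have : (a + u * D) * (1 - u) * (1 - u) <= a * 1 by rewrite ler_pM ?mulr_ge0//; lra.
  rewrite mulr1 mulrA => k2; lra.
have wa0 : 0 <= w - a by lra.
have wd0 : 0 <= w - (a + D) by lra.
have -> : dcap w = 0 by rewrite /dcap (pos_part_id wa0) (pos_part_id wd0); field; rewrite gt_eqF.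
have k3 : 0 <= a + D - a by lra.
have k4 : a + D - (a + D) <= 0 by lra.
have -> : cap w = a + D / 2.
  rewrite (cap_large (ltW Dw)) /cap (pos_part_id k3) (pos_part_0 k4).
  by field; rewrite gt_eqF.
rewrite expr0n /= mulr0.
by split=> //; lra.
Qed.

Lemma hasd_cap A (f : R -> R) t l : A t -> hasd A (f : R -> R^o) t l ->
  hasd A (fun s => cap (f s) : R^o) t (dcap (f t) * l).
Proof.
move=> At hf.
have hc b : hasd A (fun s => (f s - b : R) : R^o) t l.
  by have := hasdB hf (hasd_cst A (b : R^o) t); rewrite subr0.
have h1 := hasdZ ((2 * D)^-1) (hasd_sqr_pos_part At (hc a)).
have h2 := hasdZ ((2 * D)^-1) (hasd_sqr_pos_part At (hc (a + D))).
have := hasdD (hasdB hf h1) h2.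
have -> : l - (2 * D)^-1 *: (2 * pos_part (f t - a) * l) + (2 * D)^-1 *: (2 * pos_part (f t - (a + D)) * l) = dcap (f t) * l.
  by rewrite /dcap /GRing.scale/=; field; rewrite gt_eqF.
apply: hasd_ext => s; rewrite /cap /GRing.scale/=; ring.
Qed.

Lemma hasd_sqrt A (f : R -> R) t l : A t -> 0 < f t -> hasd A (f : R -> R^o) t l ->
  hasd A (fun s => Num.sqrt (f s) : R^o) t (l / (2 * Num.sqrt (f t))).
Proof.
move=> At ft0 hf; have [d1 d2] := is_derive1_sqrt ft0.
have hs : hasd setT (Num.sqrt : R -> R^o) (f t) (2 * Num.sqrt (f t))^-1.
  rewrite -d2; have := derive_hasd d1; rewrite derive1E; exact.
have b0 : 0 <= (2 * Num.sqrt (f t))^-1 by rewrite invr_ge0 mulr_ge0// sqrtr_ge0.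
rewrite mulrC; move: b0 hs; set b := (2 * _)^-1 => b0 hs.
apply: (@hasd_comp R R^o R^o A f Num.sqrt t l (fun h => b * h)) => //.
split.
- by move=> x u v; rewrite mulrDr /GRing.scale/=; ring.
- by exists b => // h; rewrite normrM ger0_norm.
move=> e e0; have := hs e e0; apply: filterS => s /(_ I).
by rewrite [_ *: b]mulrC.
Qed.

End Cap.

Lemma lip_continuous (R : realType) (V W : normedModType R) (f : V -> W) (h : V) (d K : R) :
  0 < d -> 0 <= K -> (forall w, `|w - h| < d -> `|f w - f h| <= K * `|w - h|) -> {for h, continuous f}.
Proof.
move=> d0 K0 H; apply/cvgrPdist_lt => ep ep0; apply/near_distP.
have K1 : 0 < K + 1 by lra.
exists (Num.min d (ep / (K + 1))); first by rewrite lt_min d0 divr_gt0.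
move=> w; rewrite lt_min => /andP[/H w1]; rewrite ltr_pdivlMr// => w2.
by rewrite distrC (le_lt_trans w1)//; have := normr_ge0 (w - h); lra.
Qed.

Lemma le_sqrt_cap (R : realType) (ep d N W w : R) : 0 <= d -> 0 <= N -> N ^+ 2 = W -> W * d ^+ 2 <= w ->
  d * N <= Num.sqrt (ep ^+ 2 + w).
Proof.
move=> d0 N0 <- h; have k : 0 <= d * N by rewrite mulr_ge0.
rewrite -[leLHS](ger0_norm k) -sqrtr_sqr ler_wsqrtr// exprMn mulrC.
by rewrite (le_trans h)// lerDr sqr_ge0.
Qed.

Lemma calibration_slope (R : realType) (d I N p k : R) : 0 <= d -> 0 < k -> 0 <= p -> `|I| <= N * p -> d * N <= k ->
  `|d * (I + I) / (2 * k)| <= p.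
Proof.
move=> d0 k0 p0 h1 h2.
have -> : d * (I + I) / (2 * k) = d * I / k by field; rewrite gt_eqF.
rewrite normrM normfV (gtr0_norm k0) ler_pdivrMr// normrM (ger0_norm d0).
apply: (@le_trans _ _ (d * (N * p))); first by rewrite ler_wpM2l.
by rewrite mulrA mulrC ler_wpM2l.
Qed.

(** * The norm of the metric in a chart *)

Section MetricNorm.
Context {R : realType} {n : nat} {M : topologicalType}.
Variable X : riemannian_manifold R n M.
Implicit Types (c d : chart X) (q : M).
Local Notation E := 'rV[R]_n.

Definition chart_norm c (x v : E) : R := Num.sqrt (ip (gram c x) v v).

Lemma chart_norm_ge0 c x v : 0 <= chart_norm c x v. Proof. exact: sqrtr_ge0. Qed.

Lemma chart_norm_sqr c x v : cod c x -> chart_norm c x v ^+ 2 = ip (gram c x) v v.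
Proof. by move=> cx; rewrite sqr_sqrtr// ip_ge0. Qed.

Lemma chart_norm0 c x : chart_norm c x 0 = 0.
Proof. by rewrite /chart_norm ip0l sqrtr0. Qed.

Lemma chart_normZ c x (a : R) v : chart_norm c x (a *: v) = `|a| * chart_norm c x v.
Proof. by rewrite /chart_norm ipZl ipZr mulrA -expr2 sqrtrM ?sqr_ge0// sqrtr_sqr. Qed.

Lemma chart_normN c x v : chart_norm c x (- v) = chart_norm c x v.
Proof. by rewrite -scaleN1r chart_normZ normrN normr1 mul1r. Qed.

Lemma ip_cauchy_schwarz c x u v : cod c x -> `|ip (gram c x) u v| <= chart_norm c x u * chart_norm c x v.
Proof.
move=> cx; have [->|v0] := eqVneq v 0; first by rewrite ip0r normr0 chart_norm0 mulr0.
have vv := ip_gt0 cx v0.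
pose k := ip (gram c x) u v / ip (gram c x) v v.
have := ip_ge0 (u - k *: v) cx.
rewrite ipDl !ipDr ipNl !ipNr ipZl !ipZr (ip_gramC v u cx) ipNl ipZl => h.
have {h} h : ip (gram c x) u v ^+ 2 <= ip (gram c x) u u * ip (gram c x) v v.
  have E1 : k * ip (gram c x) v v = ip (gram c x) u v by rewrite divfK ?gt_eqF.
  have : 0 <= ip (gram c x) u u * ip (gram c x) v v - ip (gram c x) u v ^+ 2.
    have -> : ip (gram c x) u u * ip (gram c x) v v - ip (gram c x) u v ^+ 2 =
      (ip (gram c x) u u - k * ip (gram c x) u v) * ip (gram c x) v v by rewrite -E1; ring.
    rewrite mulr_ge0 ?(ltW vv)//; move: h; rewrite E1; lra.
  by rewrite subr_ge0.
rewrite -ler_sqr ?nnegrE ?mulr_ge0 ?chart_norm_ge0// exprMn !chart_norm_sqr// real_normK ?num_real//.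
Qed.

Lemma chart_normD c x u v : cod c x -> chart_norm c x (u + v) <= chart_norm c x u + chart_norm c x v.
Proof.
move=> cx; rewrite -ler_sqr ?nnegrE ?addr_ge0 ?chart_norm_ge0// chart_norm_sqr// sqrrD !chart_norm_sqr//.
rewrite ipDl !ipDr (ip_gramC v u cx) mulr2n.
have := ip_cauchy_schwarz u v cx; rewrite ler_norml => /andP[_]; lra.
Qed.

(** Compactness of the unit sphere bounds the metric at [x0] from below; the
    metric varies little near [x0]. *)
Lemma chart_norm_equiv c x0 : cod c x0 -> exists rho m K : R, [/\ 0 < rho, 0 < m, 0 < K &
  forall x, `|x - x0| < rho -> cod c x /\ forall v, m * `|v| <= chart_norm c x v /\ chart_norm c x v <= K * `|v|].
Proof.
move=> cx; pose G0 := gram c x0.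
have nn : 0 < (n%:R * n%:R + 1 : R) by rewrite ltr_wpDl// mulr_ge0.
have [a a0 Ha] : exists2 a : R, 0 < a & forall v, 2 * a * `|v| ^+ 2 <= ip G0 v v.
  pose S := [set v : E | `|v| = 1].
  have [S0|S0] := pselect (S !=set0); last first.
    exists 1 => // v; have [->|v0] := eqVneq v 0.
      by rewrite normr0 expr0n mulr0 ip0l.
    case: S0; exists (`|v|^-1 *: v); rewrite /S/= normrZ normfV normr_id.
    by rewrite mulVf// normr_eq0.
  have cS : compact S.
    apply: bounded_closed_compact.
      by exists 1; split; [exact: num_real|move=> y y1 v /= ->; exact: ltW].
    have -> : S = (fun v : E => `|v| : R^o) @^-1` [set 1] by [].
    apply: closed_comp => [v _|]; first exact: norm_continuous.
    exact: closed_eq.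
  have [v vS Hv] : exists2 v, v \in S & forall t, t \in S -> ip G0 v v <= ip G0 t t.
    apply: (@EVT_min_rV R n (fun v => ip G0 v v)) => //.
    apply: continuous_subspaceT => v.
    apply: (@hasD_continuous _ _ R^o); apply: C11_hasD.
    apply: (@C11_ip _ _ _ (fun=> G0) id id (fun _ _ => 0) (fun _ h => h) (fun _ h => h)).
    - exact: C11_cst.
    - by apply: (@C11_lin _ _ _ _ _ 1) => // h; rewrite mul1r.
    - by apply: (@C11_lin _ _ _ _ _ 1) => // h; rewrite mul1r.
  have v0 : v != 0.
    apply/eqP => v0; move: vS; rewrite inE /S /= v0 normr0 => /eqP.
    by rewrite eq_sym oner_eq0.
  have iv := ip_gt0 cx v0.
  exists (ip G0 v v / 2); first by rewrite divr_gt0.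
  move=> w; have [->|w0] := eqVneq w 0; first by rewrite normr0 expr0n mulr0 ip0l.
  have nw : 0 < `|w| by rewrite normr_gt0.
  have := Hv (`|w|^-1 *: w); rewrite inE /S/= normrZ normfV normr_id mulVf ?gt_eqF//.
  move=> /(_ erefl); rewrite ipZl ipZr mulrA -expr2 => h.
  have -> : 2 * (ip G0 v v / 2) * `|w| ^+ 2 = ip G0 v v * `|w| ^+ 2 by field.
  rewrite -ler_pdivlMr ?exprn_gt0// (le_trans h)// exprVn mulrC//.
have [g1 [C [g10 C0 /(_ x0)]]] := gram_C11 cx.
rewrite subrr normr0 => /(_ g10)[_ _ HG].
have [r2 r20 Hc] := near_ball_sub (@cod_open _ _ _ X c) cx.
pose rho := Num.min (Num.min g1 r2) (Num.min 1 (a / ((n%:R * n%:R + 1) * (C + 1)))).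
have C1 : 0 < C + 1 by lra.
have rho0 : 0 < rho by rewrite !lt_min g10 r20 ltr01/= divr_gt0// mulr_gt0.
pose K := n%:R * n%:R * (`|G0| + C) + 1.
have K0 : 0 < K by rewrite ltr_wpDl// !mulr_ge0// addr_ge0.
exists rho, (Num.sqrt a), (Num.sqrt K); split=> //; rewrite ?sqrtr_gt0//.
move=> x; rewrite !lt_min => /andP[/andP[x1 x2] /andP[x3 x4]].
have cx' := Hc x x2; split=> // v.
have [_ _ HGx] := HG x x1.
have d1 : `|gram c x - G0| <= C by rewrite (le_trans HGx)// ler_piMr// ltW.
have nn0 : 0 <= (n%:R * n%:R : R) by rewrite mulr_ge0.
have d2 : n%:R * n%:R * `|gram c x - G0| <= a.
  move: x4; rewrite ltr_pdivlMr ?mulr_gt0// => x4.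
  have h1 : n%:R * n%:R * `|gram c x - G0| <= n%:R * n%:R * (C * `|x - x0|) by rewrite ler_wpM2l.
  have h2 : 0 <= C * `|x - x0| by rewrite mulr_ge0.
  have h3 : 0 <= n%:R * n%:R * `|x - x0| by rewrite mulr_ge0.
  have h4 := normr_ge0 (x - x0); nra.
have E1 : ip (gram c x) v v = ip G0 v v + ip (gram c x - G0) v v.
  by rewrite /ip -{1}(subrK G0 (gram c x)) addrC mulmxDr mulmxDl mxE.
have h1 := ip_le (gram c x - G0) v v; have h2 := Ha v; have h3 := ip_le G0 v v.
have v2 : 0 <= `|v| ^+ 2 by exact: sqr_ge0.
have h1' : `|ip (gram c x - G0) v v| <= a * `|v| ^+ 2.
  by rewrite (le_trans h1)// expr2 -mulrA ler_wpM2r// mulr_ge0.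
have h1'' : `|ip (gram c x - G0) v v| <= n%:R * n%:R * C * `|v| ^+ 2.
  by rewrite (le_trans h1)// expr2 -mulrA ler_wpM2r ?mulr_ge0// ler_wpM2l.
rewrite -[_ * `|v| * `|v|]mulrA -[`|v| * `|v|]expr2 in h3.
move: h1' h1'' h3; rewrite !ler_norml => /andP[k1 _] /andP[_ k2] /andP[_ k3].
split.
  rewrite -ler_sqr ?nnegrE ?mulr_ge0 ?sqrtr_ge0// exprMn sqr_sqrtr ?(ltW a0)// chart_norm_sqr// E1; lra.
rewrite -ler_sqr ?nnegrE ?mulr_ge0 ?sqrtr_ge0// exprMn chart_norm_sqr// (sqr_sqrtr (ltW K0)) E1 /K.
lra.
Qed.

End MetricNorm.

(** * The Gauss lemma and the distance in a normal ball *)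

Section NormalBall.
Context {R : realType} {n : nat} {M : topologicalType}.
Variable X : riemannian_manifold R n M.
Implicit Types (q : M).
Local Notation E := 'rV[R]_n.
Variables (c : chart X) (q : M) (r C : R) (e : E -> E) (de : E -> E -> E) (xi up : E -> R -> E).
Local Notation cq := (chart_at X q).
Local Notation x := (coord c q).
Hypotheses (dc : dom c q) (S : chart_exp_spec c x r C e de xi up) (e0 : e 0 = x).

Definition to_chart (v : E) : E := Dtau cq c (coord cq q) v.

Lemma to_chart_lin : lin to_chart.
Proof. by apply: Dtau_lin; apply: overlap_coord => //; exact: chart_atP. Qed.

Lemma to_chart_nrm v : tnorm X q v = chart_norm c x (to_chart v).
Proof. exact: tnorm_chart. Qed.

Lemma to_chartK h : to_chart (Dtau c cq x h) = h.
Proof.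
have dq := chart_atP X q; have o := overlap_coord dc dq.
have := DtauK h o; rewrite tau_coord//; exact.
Qed.

Lemma to_chartV v : Dtau c cq x (to_chart v) = v.
Proof.
have dq := chart_atP X q; have o := overlap_coord dq dc.
have := DtauK v o; rewrite tau_coord//; exact.
Qed.

Lemma to_chart_inj v w : to_chart v = to_chart w -> v = w.
Proof. by move=> E1; rewrite -(to_chartV v) E1 to_chartV. Qed.

Definition ray h t := para c (xi h t).

Lemma ray_in h t : `|h| < r -> `|t| < 2 -> geo_in c (ray h) (xi h) (up h) t.
Proof.
move=> hr t2; have [S1 _ _ _ _] := S hr.
have n2 : \forall s \near t, `|s| <= 2.
  apply/(@near_distP R R^o); exists (2 - `|t|); first lra.
  move=> s sd; have : `|s| <= `|s - t| + `|t| by rewrite -{1}(subrK t s) ler_normD.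
  lra.
have [ct _ _] := S1 t (ltW t2).
split; first by have [] := codP ct.
  by apply: filterS n2 => s /S1[cs _ _]; have [] := codP cs.
by apply: filterS n2 => s /S1[cs].
Qed.

Lemma ray_from v : `|to_chart v| < r -> geodesic_from X q v 2 2 (ray (to_chart v)).
Proof.
move=> vr; have [_ [S2 S3 _] _ _ _] := S vr; have dq := chart_atP X q.
have q0 : ray (to_chart v) 0 = q by rewrite /ray S2 coordK.
have G0 : geo_in c (ray (to_chart v)) (xi (to_chart v)) (up (to_chart v)) 0.
  by apply: ray_in => //; rewrite normr0.
split=> //.
  apply: in_geo_on => t; rewrite /= in_itv/= => /andP[t1 t2].
  eexists _, _, _; apply: ray_in => //.
  by rewrite ltr_norml; apply/andP; split; lra.
have dq' : dom cq (ray (to_chart v) 0) by rewrite q0.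
have [_ _ _ _ ->] := geo_in_at (geo_in_chart G0 dq').
by rewrite S2 S3 to_chartV.
Qed.

Lemma ray1 h : `|h| < r -> ray h 1 = para c (e h).
Proof. by move=> hr; have [_ [_ _ S4] _ _ _] := S hr; rewrite /ray S4. Qed.

Lemma Exp_chart v : `|to_chart v| < r -> Exp X q v = para c (e (to_chart v)).
Proof.
move=> vr; rewrite -ray1//; apply: Exp_geodesic (ray_from vr) => //; lra.
Qed.

Lemma e_cod h : `|h| < r -> cod c (e h).
Proof.
move=> hr; have [S1 [_ _ <-] _ _ _] := S hr.
by have [] := S1 1; rewrite ?normr1 ?ler1n.
Qed.

Lemma e_near h w : `|h| < r -> `|w| < r -> `|e h - e w - (h - w)| <= 2^-1 * `|h - w|.
Proof. by move=> hr wr; have [_ _ _ H _] := S hr; have [] := H w wr. Qed.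

Lemma e_continuous (h : E) : `|h| < r -> {for h, continuous e}.
Proof.
move=> hr; apply: (@lip_continuous _ _ _ _ _ (r - `|h|) 2) => [||w w1]; [lra|by []|].
have wr : `|w| < r.
  have : `|w| <= `|w - h| + `|h| by rewrite -{1}(subrK h w) ler_normD.
  lra.
have := near_id_lip (e_near) wr hr; exact.
Qed.

(** A geodesic has constant speed; compare times [0] and [1]. *)
Lemma gauss_speed h : `|h| < r -> chart_norm c (e h) (up h 1) = chart_norm c x h.
Proof.
move=> hr; have Eh := to_chartK h; set v := Dtau c cq x h in Eh.
have vr : `|to_chart v| < r by rewrite Eh.
have F := ray_from vr.
have n1 : `|1 : R| < 2 by rewrite normr1; lra.
have [_ [_ _ S4] _ _ _] := S hr.
have G := ray_in hr n1.
rewrite -S4 /chart_norm -(gspeedE G) -[RHS]/(chart_norm c x h) -{2}Eh -to_chart_nrm.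
by rewrite -Eh; apply: (gspeed_from _ _ F); lra.
Qed.

Variable m : R.
Hypotheses (m0 : 0 < m) (Hm : forall h, m * `|h| <= chart_norm c x h).

Lemma Exp_inj v w : tnorm X q v < m * r -> tnorm X q w < m * r -> Exp X q v = Exp X q w -> v = w.
Proof.
rewrite !to_chart_nrm => v1 w1.
have vr : `|to_chart v| < r by rewrite -(ltr_pM2l m0) (le_lt_trans (Hm _)).
have wr : `|to_chart w| < r by rewrite -(ltr_pM2l m0) (le_lt_trans (Hm _)).
rewrite !Exp_chart// => E1; apply: to_chart_inj; apply/eqP.
have := congr1 (coord c) E1; rewrite (codP (e_cod vr)).2 (codP (e_cod wr)).2 => E2.
have := near_id_inj (e_near) vr wr; rewrite E2 subrr normr0 mulr0 normr_le0 subr_eq0//.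
Qed.

Definition chart_log (y : M) : E := xget 0 [set h | `|h| < r /\ para c (e h) = y].

Lemma chart_logE h : `|h| < r -> chart_log (para c (e h)) = h.
Proof.
move=> hr; apply: xget_subset1 => //.
move=> h1 h2 [hr1 E1] [hr2 E2]; apply/eqP; rewrite -subr_eq0 -normr_le0.
have := near_id_inj (e_near) hr1 hr2.
have -> : e h1 = e h2 by rewrite -(codP (e_cod hr1)).2 -(codP (e_cod hr2)).2 E1 E2.
by rewrite subrr normr0 mulr0.
Qed.

Lemma chart_log_curve A g (xg xg' : R -> E) t h : A t -> curve_in c A g xg xg' t -> `|h| < r ->
  g t = para c (e h) ->
  \forall s \near t, A s -> [/\ `|chart_log (g s)| < r, e (chart_log (g s)) = xg s & para c (e (chart_log (g s))) = g s].
Proof.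
move=> At cg hr Eg; have [dg cx Ex Exg hx] := curve_in_at At cg.
case: cg => _ n1 _ _.
have Eh : xg t = e h by rewrite -Ex Eg (codP (e_cod hr)).2.
pose s0 := (r - `|h|) / 2.
have s00 : 0 < s0 by rewrite divr_gt0// subr_gt0.
have s02 : 0 < s0 / 2 by rewrite divr_gt0.
apply: filterS2 n1 (hasd_cont hx s02) => s h1 h2 As.
have [ds Es] := h1 As; have {}h2 := ltW (h2 As).
have Hs v : `|v - h| <= s0 -> `|v| < r.
  move=> vh; have : `|v| <= `|v - h| + `|h| by rewrite -{1}(subrK h v) ler_normD.
  have E0 : s0 = (r - `|h|) / 2 by []. move: vh hr E0; lra.
rewrite Eh in h2; have [v vs Ev] := near_id_surj (e_near) Hs h2.
have Eg' : g s = para c (e v) by rewrite Ev -Es coordK.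
have vr := Hs v vs.
by rewrite Eg' (chart_logE vr).
Qed.

Variable b : R.
Hypotheses (b0 : 0 < b) (bm : b < m * r).

Definition ball_image : set M := [set y | exists2 h, chart_norm c x h <= b & y = para c (e h)].

(** Closedness is what makes the calibration locally constant outside the
    ball. *)
Lemma ball_image_closed : closed ball_image.
Proof.
apply: compact_closed; first exact: (@rm_hausdorff _ _ _ X).
have b0' := b0; have m0' := m0.
pose K := [set h : E | chart_norm c x h <= b].
have Kr h : K h -> `|h| < r.
  move=> Kh; rewrite -(ltr_pM2l m0) (le_lt_trans (Hm _))// (le_lt_trans Kh)//.
have -> : ball_image = (fun h => para c (e h)) @` K.
  by apply/seteqP; split=> y [h Kh E1]; exists h.
apply: continuous_compact.
  apply/subspace_continuousP => h Kh; apply: cvg_within_filter.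
  have hr := Kr h Kh.
  exact: (cvg_comp _ _ (e_continuous hr) (para_continuous (e_cod hr))).
apply: bounded_closed_compact.
  exists (b / m); split; first exact: num_real.
  move=> y y1 v /= Kv; apply/ltW; apply: le_lt_trans y1.
  by rewrite ler_pdivlMr// mulrC (le_trans (Hm _)).
have -> : K = (fun h : E => chart_norm c x h : R^o) @^-1` [set y | y <= b] by [].
apply: closed_comp; last exact: closed_le.
move=> v _.
have cc : {for v, continuous (fun v => ip (gram c x) v v : R^o)}.
  apply: (@hasD_continuous _ _ R^o); apply: C11_hasD.
  apply: (@C11_ip _ _ _ (fun=> gram c x) id id (fun _ _ => 0) (fun _ h => h) (fun _ h => h)).
  - exact: C11_cst.
  - by apply: (@C11_lin _ _ _ _ _ 1) => // h; rewrite mul1r.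
  - by apply: (@C11_lin _ _ _ _ _ 1) => // h; rewrite mul1r.
exact: (cvg_comp _ _ cc (@sqrt_continuous R _)).
Qed.

(** The truncated radius. The shift by [ep ^+ 2] keeps the square root
    differentiable at the centre. *)
Definition calibration_radial (ep : R) (h : E) := Num.sqrt (ep ^+ 2 + cap (b ^+ 2 / 2) (b ^+ 2 / 2) (ip (gram c x) h h)).
(** The truncated radius as a function on [M]; the value outside the ball is
    the one taken by [calibration_radial] beyond the radius [b]. *)
Definition calibration (ep : R) (y : M) : R :=
  if `[< ball_image y >] then calibration_radial ep (chart_log y)
  else Num.sqrt (ep ^+ 2 + cap (b ^+ 2 / 2) (b ^+ 2 / 2) (b ^+ 2)).

Let cx : cod c x. Proof. exact: cod_coord. Qed.
Let bb : 0 < b ^+ 2 / 2. Proof. by rewrite divr_gt0// exprn_gt0. Qed.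

Lemma calibration_in ep h : `|h| < r -> calibration ep (para c (e h)) = calibration_radial ep h.
Proof.
move=> hr; rewrite /calibration; case: asboolP => [_|H]; first by rewrite chart_logE.
rewrite /calibration_radial; congr (Num.sqrt (_ + _)); rewrite [RHS]cap_large//.
  by congr cap; lra.
rewrite -splitr -chart_norm_sqr// lerXn2r ?nnegrE ?(ltW b0) ?chart_norm_ge0// leNgt; apply/negP => hb.
by apply: H; exists h => //; exact: ltW.
Qed.

(** By the Gauss lemma, half the squared radius has along a curve the
    derivative given by the inner product of the velocity with the radial
    velocity, whose norm is the radius; the inequality of Cauchy and Schwarz
    and [dcap_bound] bound the slope by the speed. *)
Lemma calibration_hasd ep : 0 < ep -> forall a' b' g, a' < b' -> C1_curve_on X `[a', b'] g ->
  forall t, a' <= t -> t <= b' ->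
  exists2 l, hasd `[a', b'] (calibration ep \o g : R -> R^o) t l & `|l| <= speed_within X `[a', b'] g t.
Proof.
move=> ep0 a' b' g ab Cg t at_ tb.
have At : `[a', b']%classic t by apply/itvP_cc.
set A := `[a', b']%classic in At *.
have [[h [hr Eg]]|NU] := pselect (exists h, `|h| < r /\ g t = para c (e h)); last first.
  exists 0; last by rewrite normr0 sqrtr_ge0.
  have nB : \forall s \near t, A s -> ~ ball_image (g s).
    have [/subspace_continuousP/(_ t At) cg _] := Cg.
    apply: (cg (~` ball_image)); apply: open_nbhs_nbhs; split.
      exact: closed_openC ball_image_closed.
    move=> [h hb Eh]; apply: NU; exists h; split=> //.
    by rewrite -(ltr_pM2l m0) (le_lt_trans (Hm _))// (le_lt_trans hb).
  apply: (@hasd_near _ _ _ (fun=> Num.sqrt (ep ^+ 2 + cap (b ^+ 2 / 2) (b ^+ 2 / 2) (b ^+ 2)) : R^o)) => //.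
    apply: filterS nB => s H As; rewrite /calibration /=; case: asboolP => // B.
    by case: (H As B).
  exact: hasd_cst.
have dg : dom c (g t) by rewrite Eg; exact: (codP (e_cod hr)).1.
have cg := C1_curve_in ab at_ tb Cg dg; rewrite -/A in cg.
set xg := coord c \o g in cg; set xg' := derive_within A xg in cg.
have nV := chart_log_curve At cg hr Eg.
have [_ _ _ _ hx] := curve_in_at At cg.
pose V s := chart_log (g s).
have Vt : V t = h by rewrite /V Eg chart_logE.
have [Vr eV pV] := nbhs_singleton nV At; rewrite -/(V t) in Vr eV pV.
have [_ _ dl dH gaussH] := S Vr.
have [C' C'0 HC] : exists2 C' : R, 0 <= C' & forall w, `|w| < r -> `|e w - e (V t) - de (V t) (w - V t)| <= C' * `|w - V t| ^+ 2.
  exists `|C| => // w wr; have [_ k _] := dH w wr.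
  by apply: (le_trans k); apply: ler_wpM2r; [exact: sqr_ge0|exact: ler_norm].
have nV' : \forall s \near t, A s -> `|V s| < r /\ e (V s) = xg s.
  by apply: filterS nV => s H As; have [] := H As.
have [V' [EV' hV]] := log_hasd C'0 At (e_near) dl HC nV' hx.
have hip := hasd_ip (hasd_cst A (gram c x) t) hV hV.
have hcap := @hasd_cap R (b ^+ 2 / 2) (b ^+ 2 / 2) bb _ _ _ _ At hip.
set W := ip (gram c x) (V t) (V t) in hcap.
have W0 : 0 <= W by exact: ip_ge0.
have [dc0 c0 wc] := dcap_bound bb bb (lexx _) W0.
set cw := cap _ _ W in hcap c0 wc; set dw := dcap _ _ W in hcap dc0 wc.
have f0 : 0 < ep ^+ 2 + cw by rewrite ltr_pwDl// exprn_gt0.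
have hs := @hasd_sqrt R A (fun s => ep ^+ 2 + cap (b ^+ 2 / 2) (b ^+ 2 / 2) (ip (gram c x) (V s) (V s))) t _ At f0 (hasdD (hasd_cst A (ep ^+ 2 : R^o) t) hcap).
set sq := Num.sqrt (ep ^+ 2 + cw) in hs.
eexists.
  apply: hasd_near hs => //; apply: filterS nV => s H As; have [k1 _ k2] := H As.
  by rewrite /= -k2 calibration_in// chart_logE.
rewrite add0r -/W -/cw -/dw -/sq ip0m add0r (ip_gramC V' _ cx).
have gE := gaussH V'; rewrite EV' in gE; rewrite -gE.
have cs := ip_cauchy_schwarz (up (V t) 1) (xg' t) (e_cod Vr).
rewrite (gauss_speed Vr) in cs.
have sp : chart_norm c (e (V t)) (xg' t) = speed_within X A g t.
  by rewrite (curve_in_speed ab at_ tb cg) eV.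
rewrite sp in cs; set I := ip _ _ _ in cs *.
have sq0 : 0 < sq by rewrite sqrtr_gt0.
have sp0 : 0 <= speed_within X A g t by exact: sqrtr_ge0.
set N := chart_norm c x (V t) in cs.
have NW : N ^+ 2 = W by exact: chart_norm_sqr.
have N0 : 0 <= N by exact: chart_norm_ge0.
have dN : dw * N <= sq by exact: (le_sqrt_cap ep dc0 N0 NW wc).
exact: (calibration_slope dc0 sq0 sp0 cs dN).
Qed.

(** The calibration is [sqrt (ep ^+ 2 + |v| ^+ 2)] at [Exp q v] and [ep] at
    [q]; let [ep] tend to [0]. *)
Lemma dist_Exp_ge v : tnorm X q v <= b / 2 -> ((tnorm X q v)%:E <= dist X q (Exp X q v))%E.
Proof.
rewrite to_chart_nrm => vb; have b0' := b0.
have vr : `|to_chart v| < r.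
  by rewrite -(ltr_pM2l m0) (le_lt_trans (Hm _))// (le_lt_trans vb)// (lt_trans _ bm)//; lra.
have r0 : 0 < r by exact: le_lt_trans vr.
rewrite Exp_chart//; set N := chart_norm c x _.
have N0 : 0 <= N by exact: chart_norm_ge0.
suff H ep : 0 < ep -> ((N - ep)%:E <= dist X q (para c (e (to_chart v))))%E.
  apply/lee_addgt0Pr => ep ep0; have := H ep ep0; rewrite EFinB leeBlDr//.
move=> ep0; 
have := @dist_ge R n M X _ q (para c (e (to_chart v))) (calibration_hasd ep0); apply: le_trans.
have Eq : q = para c (e 0) by rewrite e0 coordK.
rewrite [in calibration ep q]Eq !calibration_in ?normr0// /calibration_radial ip0l lee_fin.
rewrite -(chart_norm_sqr _ cx) -/N !cap_small ?(ltW bb)//; last first.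
  have : N ^+ 2 <= (b / 2) ^+ 2 by rewrite lerXn2r ?nnegrE//; lra.
  rewrite expr_div_n; have : 0 < b ^+ 2 by rewrite exprn_gt0.
  lra.
rewrite addr0 sqrtr_sqr (gtr0_norm ep0) lerB//.
rewrite -{1}(ger0_norm N0) -sqrtr_sqr ler_sqrt ?lerDr ?sqr_ge0//.
by rewrite addr_ge0 ?sqr_ge0.
Qed.

End NormalBall.

Lemma compact_unif (R : realType) (T : topologicalType) (K : set T) (P : T -> R -> Prop) :
  compact K -> (forall q e e', P q e -> 0 < e' -> e' <= e -> P q e') ->
  (forall q, K q -> exists2 e : R, 0 < e & \forall q' \near q, K q' -> P q' e) ->
  exists2 e : R, 0 < e & forall q, K q -> P q e.
Proof.
move=> /compact_near_coveringP/near_covering_withinP cK mon H.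
have F : Filter ((0 : R)^'+) by apply: at_right_proper_filter.
have := cK R (0 : R)^'+ (fun e q => 0 < e -> P q e) F.
case.
  move=> q Kq; have [e e0 nq] := H q Kq.
  exists ([set q' | K q' -> P q' e], [set e' : R | e' <= e]) => /=.
    split; first exact: nq.
    by apply: nbhs_right_le.
  move=> [q' e'] /= [h1 h2] Kq' e'0; exact: (mon q' e e' (h1 Kq') e'0 h2).
move=> d d0 Hd; have d2 : 0 < d / 2 by rewrite divr_gt0.
exists (d / 2) => // q Kq; apply: (Hd (d / 2)) => //.
by rewrite /ball /= sub0r normrN gtr0_norm//; lra.
Qed.

(** * Joining geodesics *)

Section Joining.
Context {R : realType} {n : nat} {M : topologicalType}.
Variable X : riemannian_manifold R n M.
Implicit Types (c d : chart X) (q : M) (g : R -> M) (A : set R).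
Local Notation E := 'rV[R]_n.

Lemma curve_in_ext c A g g' x x' t : A t -> (forall s, A s -> g s = g' s) ->
  curve_in c A g x x' t -> curve_in c A g' x x' t.
Proof.
move=> At H [dg n1 n2 n3]; split=> //; first by rewrite -H.
by apply: filterS n1 => s h As; rewrite -H//; exact: h.
Qed.

Lemma geo_piece g h (a b k l p r : R) : geodesic_on X `]a, b[ g -> p < r ->
  (forall t, p <= t -> t <= r -> a < k * t + l /\ k * t + l < b) ->
  (forall t, p <= t -> t <= r -> h t = g (k * t + l)) ->
  C1_curve_on X `[p, r] h /\
  forall t, p <= t -> t <= r -> speed_within X `[p, r] h t = `|k| * gspeed X g (k * t + l).
Proof.
move=> G pr Hab Hh.
have H t : p <= t -> t <= r -> exists c x x', curve_in (c : chart X) `[p, r] h x x' t /\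
    Num.sqrt (ip (gram c (x t)) (x' t) (x' t)) = `|k| * gspeed X g (k * t + l).
  move=> pt tr; have [h1 h2] := Hab t pt tr.
  have At : `]a, b[%classic (k * t + l) by rewrite /= in_itv/= h1.
  have dc := chart_atP X (g (k * t + l)).
  have G0 := geo_on_in (@oo_open _ _ _) G At dc.
  have G1 := geo_in_affine G0.
  eexists _, _, _; split.
    apply: (curve_in_ext _ _ (geo_in_curve `[p, r] G1)); first by apply/itvP_cc.
    by move=> s /itvP_cc[ps sr]; rewrite Hh.
  rewrite (gspeedE G0) -!/(chart_norm _ _ _) chart_normZ//.
split.
  apply: curve_in_C1 => // t pt tr; have [c [x [x' [h1 _]]]] := H t pt tr.
  by exists c, x, x'.
move=> t pt tr; have [c [x [x' [h1 <-]]]] := H t pt tr.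
exact: curve_in_speed h1.
Qed.

Lemma dist_le_geo g (a b : R) : geodesic_on X `]a, b[ g -> a < 0 -> 1 < b ->
  (dist X (g 0%R) (g 1%R) <= (gspeed X g 0)%:E)%E.
Proof.
move=> G a0 b1; have [|||C sp] := @geo_piece g g a b 1 0 0 1 G => //.
- by move=> t t0 t1; rewrite mul1r addr0; split; lra.
- by move=> t _ _; rewrite mul1r addr0.
apply: (dist_le_C1 C) => t t0 t1; rewrite (sp t t0 t1) normr1 !mul1r addr0.
by rewrite (@gspeed_const _ _ _ X a b g t 0 G); lra.
Qed.

Lemma dist_le_geo2 g1 g2 (a1 b1 a2 b2 : R) : geodesic_on X `]a1, b1[ g1 -> geodesic_on X `]a2, b2[ g2 ->
  a1 < 0 -> 1 < b1 -> a2 < 0 -> 1 < b2 -> g1 1 = g2 0 ->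
  (dist X (g1 0%R) (g2 1%R) <= (gspeed X g1 0 + gspeed X g2 0)%:E)%E.
Proof.
move=> G1 G2 a10 b11 a20 b21 E12.
pose h s := if s <= 2^-1 then g1 (2 * s + 0) else g2 (2 * s + -1).
have hf0 : (0 : R) < 2^-1 by lra.
have hf1 : (2^-1 : R) < 1 by lra.
have [||C1 s1] := @geo_piece g1 h a1 b1 2 0 0 2^-1 G1 hf0.
- by move=> t t0 t1; split; lra.
- by move=> t t0 t1; rewrite /h t1.
have [||C2 s2] := @geo_piece g2 h a2 b2 2 (-1) 2^-1 1 G2 hf1.
- by move=> t t0 t1; split; lra.
- move=> t t0 t1; rewrite /h; case: ifP => // t2.
  have -> : t = 2^-1 by apply/eqP; rewrite eq_le t2.
  by rewrite addr0 divff// subrr.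
have h0 : h 0 = g1 0 by rewrite /h ifT ?mulr0 ?addr0//; lra.
have h1 : h 1 = g2 1.
  rewrite /h ifF; first by congr g2; lra.
  by apply/negbTE; rewrite -ltNge; lra.
rewrite -h0 -h1.
have D2 (u w : R) : u + w = 2 * u / 2 + 2 * w / 2 by lra.
rewrite (D2 (gspeed X g1 0) (gspeed X g2 0)).
have n2 : `|2 : R| = 2 by exact: gtr0_norm.
apply: (dist_le_piecewise_C1 C1 C2) => t t0 t1.
  by rewrite (s1 t t0 t1) n2 (@gspeed_const _ _ _ X a1 b1 g1 _ 0 G1); lra.
by rewrite (s2 t t0 t1) n2 (@gspeed_const _ _ _ X a2 b2 g2 _ 0 G2); lra.
Qed.

(** A closed segment inside an open interval can be prolonged a little at both
    ends. *)
Lemma affine_room (a b k l : R) : a < l -> l < b -> a < k + l -> k + l < b ->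
  exists2 eta : R, 0 < eta & forall t, - eta < t -> t < 1 + eta -> a < k * t + l /\ k * t + l < b.
Proof.
move=> al lb ak kb; pose m := Num.min (Num.min (l - a) (b - l)) (Num.min (k + l - a) (b - (k + l))).
have m0 : 0 < m by rewrite !lt_min !subr_gt0 al lb ak kb.
have m1 : m <= l - a by rewrite !ge_min lexx.
have m2 : m <= b - l by rewrite !ge_min lexx orbT.
have m3 : m <= k + l - a by rewrite !ge_min lexx orbT.
have m4 : m <= b - (k + l) by rewrite !ge_min lexx !orbT.
have k1 : 0 < 1 + `|k| by rewrite ltr_pwDl.
pose eta := m / (1 + `|k|).
have eta0 : 0 < eta by rewrite divr_gt0.
have ke : `|k| * eta < m.
  have : eta * (1 + `|k|) = m by rewrite divfK ?gt_eqF.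
  lra.
have kn := ler_norm k; have kn' := ler_norm (- k); rewrite normrN in kn'.
exists eta => // t t1 t2.
have h1 : k * eta <= `|k| * eta by rewrite ler_wpM2r// ltW.
have h2 : - k * eta <= `|k| * eta by rewrite ler_wpM2r// ltW.
have [k0|k0] := leP 0 k.
  have : k * - eta <= k * t by rewrite ler_wpM2l// ltW.
  have : k * t <= k * (1 + eta) by rewrite ler_wpM2l// ltW.
  split; lra.
have : k * t <= k * - eta by rewrite ler_wnM2l// ltW.
have : k * (1 + eta) <= k * t by rewrite ler_wnM2l// ltW.
split; lra.
Qed.

Lemma geo_in_near_ext c g g' x x' t : (\forall s \near t, g s = g' s) ->
  geo_in c g x x' t -> geo_in c g' x x' t.
Proof.
move=> N [dg n1 n2]; split=> //; first by rewrite -(nbhs_singleton N).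
by apply: filterS2 N n1 => s <-.
Qed.

(** By forward uniqueness the two geodesics agree just after [t1], so that
    near [t1] the glued curve is [g1]. *)
Lemma geo_extend q v (e1 b1 t1 e2 b2 : R) g1 g2 u : 0 < e1 -> 0 < t1 -> t1 < b1 -> 0 < e2 -> 0 < b2 ->
  geodesic_from X q v e1 b1 g1 ->
  u = derive1 (coord (chart_at X (g1 t1)) \o g1) t1 ->
  geodesic_from X (g1 t1) u e2 b2 g2 ->
  exists g, geodesic_from X q v e1 (t1 + b2) g /\ forall t, t <= t1 -> g t = g1 t.
Proof.
move=> e10 t10 tb1 e20 b20 [G1 q1 v1] Eu [G2 q2 v2].
pose g t := if t <= t1 then g1 t else g2 (1 * t + - t1).
have gl t : t <= t1 -> g t = g1 t by rewrite /g => ->.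
have in1 t : - e1 < t -> t < b1 -> `](- e1), b1[%classic t.
  by move=> h1 h2; rewrite /= in_itv/= h1.
have G2' : geodesic_on X `](t1 - e2), (t1 + b2)[ (fun t => g2 (1 * t + - t1)).
  apply: geo_affine (@oo_open _ _ _) G2 _ => t /=; rewrite !in_itv/= => /andP[h1 h2].
  by apply/andP; split; lra.
pose a := Num.max (- e1) (t1 - e2); pose b := Num.min b1 (t1 + b2).
have a1 : - e1 <= a by rewrite le_max lexx.
have a2 : t1 - e2 <= a by rewrite le_max lexx orbT.
have a3 : a < t1 by rewrite gt_max; apply/andP; split; lra.
have bb1 : b <= b1 by rewrite ge_min lexx.
have bb2 : b <= t1 + b2 by rewrite ge_min lexx orbT.
have bb3 : t1 < b by rewrite lt_min tb1 ltrDl.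
have E12 t : t1 <= t -> t < b -> g1 t = g2 (1 * t + - t1).
  apply: (@geo_unique _ _ _ X a b g1 (fun t => g2 (1 * t + - t1)) t1 (chart_at X (g1 t1))).
  - by apply: geodesic_sub G1 => s /=; rewrite !in_itv/= => /andP[h1 h2]; apply/andP; split; lra.
  - by apply: geodesic_sub G2' => s /=; rewrite !in_itv/= => /andP[h1 h2]; apply/andP; split; lra.
  - exact: a3.
  - by rewrite mul1r subrr q2.
  - exact: chart_atP.
  - have A0 : `](- e2), b2[%classic (1 * t1 + - t1 : R).
      by rewrite /= in_itv/= mul1r subrr; apply/andP; split; lra.
    have dc : dom (chart_at X (g1 t1)) (g2 (1 * t1 + - t1)).
      by rewrite mul1r subrr q2; exact: chart_atP.
    have [_ _ _ _ ->] := geo_in_at (geo_in_affine (geo_on_in (@oo_open _ _ _) G2 A0 dc)).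
    by rewrite mul1r subrr v2 scale1r -Eu.
have gr t : t1 <= t -> g t = g2 (1 * t + - t1).
  rewrite /g; case: ifP => // t2 t3; have -> : t = t1 by apply/eqP; rewrite eq_le t2.
  exact: E12.
have loc t : - e1 < t -> t < t1 + b2 -> t < b \/ t1 < t.
  by move=> _ _; have [tb|bt] := ltP t b; [left|right; lra].
have nl t : t < b -> \forall s \near t, g1 s = g s.
  move=> tb; apply/(@near_distP R R^o); exists (b - t); first by rewrite subr_gt0.
  move=> s; rewrite ltr_norml => /andP[h1 h2].
  have [st|ts] := leP s t1; first by rewrite gl.
  by rewrite gr ?(ltW ts)//; apply: E12; lra.
have nr t : t1 < t -> \forall s \near t, g2 (1 * s + - t1) = g s.
  move=> tb; apply/(@near_distP R R^o); exists (t - t1); first by rewrite subr_gt0.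
  move=> s; rewrite ltr_norml => /andP[h1 h2].
  by rewrite gr//; lra.
exists g; split; last exact: gl.
split.
- apply: in_geo_on => t /=; rewrite in_itv/= => /andP[h1 h2].
  have [tb|tt] := loc t h1 h2.
    eexists _, _, _; apply: (geo_in_near_ext (nl t tb)).
    apply: (geo_on_in (@oo_open _ _ _) G1); last exact: chart_atP.
    by apply: in1 => //; lra.
  eexists _, _, _; apply: (geo_in_near_ext (nr t tt)).
  apply: (geo_on_in (@oo_open _ _ _) G2'); last exact: chart_atP.
  by rewrite /= in_itv/=; apply/andP; split; lra.
- by rewrite gl// ltW.
- have b0 : 0 < b by lra.
  have dq : dom (chart_at X q) (g1 0) by rewrite q1; exact: chart_atP.
  have A0 : `](- e1), b1[%classic (0 : R) by apply: in1; lra.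
  have [_ _ _ _ ->] := geo_in_at (geo_in_near_ext (nl 0 b0) (geo_on_in (@oo_open _ _ _) G1 A0 dq)).
  exact: v1.
Qed.

End Joining.

(** * A uniform normal radius *)

Section InjectivityRadius.
Context {R : realType} {n : nat} {M : topologicalType}.
Variable X : riemannian_manifold R n M.
Implicit Types (c d : chart X) (q : M) (g : R -> M) (A : set R).
Local Notation E := 'rV[R]_n.

Definition normal_radius (q : M) (s : R) := forall v, tnorm X q v < s ->
  [/\ exists g, geodesic_from X q v 2 2 g, dist X q (Exp X q v) = (tnorm X q v)%:E &
      forall w, tnorm X q w < s -> Exp X q v = Exp X q w -> v = w].

Lemma dist_le_from q v (e b : R) g : 0 < e -> 1 < b -> geodesic_from X q v e b g ->
  (dist X q (Exp X q v) <= (tnorm X q v)%:E)%E.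
Proof.
move=> e0 b1 F; rewrite (Exp_geodesic e0 b1 F); case: (F) => G q0 _.
have b0 : 0 < b by lra.
rewrite -(gspeed_from e0 b0 F (t := 0)); [|lra|by []].
rewrite -{1}q0; apply: dist_le_geo G _ b1; lra.
Qed.

Lemma normal_radius_ex (q0 : M) : exists2 s : R, 0 < s & \forall q \near q0, normal_radius q s.
Proof.
pose c := chart_at X q0; pose x0 := coord c q0.
have dc0 : dom c q0 by exact: chart_atP.
have cx0 : cod c x0 by exact: cod_coord.
have [r1 [m [K [r10 m0 K0 Hn]]]] := chart_norm_equiv cx0.
have [r2 [r [C [r20 r0 C0 He]]]] := chart_exp cx0.
exists (m * r / 4); first by rewrite divr_gt0// mulr_gt0.
have r12 : 0 < Num.min r1 r2 by rewrite lt_min r10.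
have nd : \forall q \near q0, dom c q by exact: open_nbhs_nbhs (conj (@dom_open _ _ _ X c) dc0).
have nx : \forall q \near q0, `|coord c q - x0| < Num.min r1 r2.
  have /cvgrPdist_lt/(_ _ r12) := coord_continuous dc0.
  by apply: filterS => q; rewrite distrC.
apply: filterS2 nd nx => q dc; rewrite lt_min => /andP[/Hn[cx Hm] /He[_ [e [de [xi [up [S e0]]]]]]].
have {}Hm h : m * `|h| <= chart_norm c (coord c q) h by have [] := Hm h.
have mr : 0 < m * r by rewrite mulr_gt0.
move=> v vs; have vr : `|to_chart c q v| < r.
  rewrite -(ltr_pM2l m0) (le_lt_trans (Hm _))// -to_chart_nrm// (lt_trans vs)//; lra.
have F := ray_from dc S vr.
split.
- by eexists; exact: F.
- apply/eqP; rewrite eq_le; apply/andP; split.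
    by apply: dist_le_from F; lra.
  apply: (dist_Exp_ge dc S e0 m0 Hm (b := m * r / 2)); lra.
- move=> w ws; apply: (Exp_inj dc S m0 Hm); lra.
Qed.

Lemma normal_radius_unif : compact [set: M] -> exists2 s : R, 0 < s & forall q, normal_radius q s.
Proof.
move=> cM; have [|q _|s s0 H] := @compact_unif R M setT normal_radius cM.
- move=> q e e' H e'0 ee v ve; have [] := H v (lt_le_trans ve ee).
  by move=> h1 h2 h3; split=> // w we; apply: h3; exact: lt_le_trans ee.
- have [s s0 H] := normal_radius_ex q; exists s => //; by apply: filterS H.
- by exists s => // q; exact: H.
Qed.

End InjectivityRadius.

(** * Logarithms and cut locus *)

Section CutLocus.
Context {R : realType} {n : nat} {M : topologicalType}.
Variable X : riemannian_manifold R n M.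
Implicit Types (c d : chart X) (q : M) (g : R -> M) (A : set R).
Local Notation E := 'rV[R]_n.
Variable s : R.
Hypotheses (s0 : 0 < s) (NR : forall q, normal_radius X q s).

Lemma tnorm_ge0 q v : 0 <= tnorm X q v. Proof. exact: sqrtr_ge0. Qed.

Lemma tnormZ q (a : R) v : tnorm X q (a *: v) = `|a| * tnorm X q v.
Proof. exact: chart_normZ. Qed.

Lemma tnorm0 q : tnorm X q 0 = 0.
Proof. exact: chart_norm0. Qed.

Lemma Exp_zero q : Exp X q 0 = q.
Proof.
have [|[g F] _ _] := @NR q 0; first by rewrite tnorm0.
have two : (0 : R) < 2 by [].
have F' := geodesic_from_scale (a := 0) (lexx _) two F (e' := 2) (b' := 2).
rewrite scaler0 in F'.
rewrite (Exp_geodesic two _ (F' _ _ two two two)) ?mul0r//; [by case: F|lra].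
Qed.

Lemma dist_self q : dist X q q = 0%:E.
Proof. by have [|_ + _] := @NR q 0; rewrite tnorm0// Exp_zero. Qed.

(** Where no geodesic exists, [Exp] has the default value [q], which is at
    distance [0] from [q]; minimality then forces the vector to have norm [0].
    *)
Lemma Exp_cases q u : (exists g e, 0 < e /\ geodesic_from X q u e (1 + e) g) \/ Exp X q u = q.
Proof.
rewrite /Exp; case: xgetP => [y _ [g [e [e0 G q0 v0 _]]]|]; last by right.
by left; exists g, e; split.
Qed.

(** Follow the geodesic of [xi] up to the common point, then [g] from time
    [t1] to time [t2], backwards if [t2 < t1]. *)
Lemma exp_detour q w xi (e b t1 t2 : R) g : 0 < e -> geodesic_from X q w e b g ->
  0 <= t1 -> t1 < b -> 0 <= t2 -> t2 < b -> tnorm X q xi < s -> g t1 = Exp X q xi ->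
  dist X q (g t2) = (t2 * tnorm X q w)%:E ->
  t2 * tnorm X q w <= tnorm X q xi + `|t2 - t1| * tnorm X q w.
Proof.
move=> e0 F t10 t1b t20 t2b xs E1 D2.
have [[g1 F1] _ _] := NR xs; case: (F1) => G1 q1 v1; case: (F) => G q0 v0.
have two : (0 : R) < 2 by [].
have Eg : g1 1 = g t1 by rewrite E1 (Exp_geodesic two _ F1)//; lra.
have [||||eta eta0 Heta] := @affine_room _ (- e) b (t2 - t1) t1; try lra.
pose g2 u := g ((t2 - t1) * u + t1).
have G2 : geodesic_on X `](- eta), (1 + eta)[ g2.
  apply: geo_affine (@oo_open _ _ _) G _ => t /=; rewrite !in_itv/= => /andP[h1 h2].
  by have [-> ->] := Heta t h1 h2.
have sp2 : gspeed X g2 0 = `|t2 - t1| * tnorm X q w.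
  have At : `](- e), b[%classic ((t2 - t1) * 0 + t1 : R).
    by rewrite /= in_itv/= mulr0 add0r; apply/andP; split; lra.
  have dc := chart_atP X (g ((t2 - t1) * 0 + t1)).
  have G0 := geo_on_in (@oo_open _ _ _) G At dc.
  rewrite (gspeedE (geo_in_affine G0)) -!/(chart_norm _ _ _) chart_normZ; congr (_ * _).
  rewrite [LHS](_ : _ = gspeed X g ((t2 - t1) * 0 + t1)); last by rewrite (gspeedE G0).
  by apply: (gspeed_from e0 _ F); rewrite ?mulr0 ?add0r//; lra.
have := @dist_le_geo2 _ _ _ X g1 g2 (-2) 2 (- eta) (1 + eta) G1 G2.
rewrite sp2 (gspeed_from two two F1 (t := 0)) ?oppr_lt0//.
rewrite q1 {1 2}/g2 mulr1 subrK mulr0 add0r D2 lee_fin.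
by move=> h; apply: h Eg => //; lra.
Qed.

Lemma cut_time_small q xi : tnorm X q xi < s / 2 -> (1%:E < cut_time X q xi)%E.
Proof.
move=> xs; apply: (@lt_le_trans _ _ 2%:E); first by rewrite lte_fin; lra.
apply: ereal_sup_ubound; exists 2 => //; split=> //.
have [|_ -> _] := @NR q (2 *: xi); rewrite tnormZ ger0_norm//; lra.
Qed.

(** Another logarithm [xi'] is minimizing up to some [t > 1]. By [exp_detour]
    with [t1 = 1] and [t2 = t] it is no longer than [xi], hence lies in the
    ball on which [Exp] is injective. *)
Lemma log_set_small q xi : tnorm X q xi < s / 2 -> log_set X q (Exp X q xi) = [set xi].
Proof.
move=> xs; have xs' : tnorm X q xi < s by have s0' := s0; lra.
apply/seteqP; split=> [xi' [/= /ereal_sup_gt[_ [t [t0 Dt] <-] /=]]|_ ->]; last first.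
  by split=> //; exact: cut_time_small.
rewrite lte_fin => t1 Exi.
have n0 := tnorm_ge0 q xi'.
suff : tnorm X q xi' <= tnorm X q xi.
  move=> h; have [_ _ H] := NR (le_lt_trans h xs').
  exact: H.
have [[g [e [e0 F]]]|Eq] := Exp_cases q (t *: xi'); last first.
  rewrite Eq dist_self in Dt; case: Dt => Dt.
  have := tnorm_ge0 q xi; nra.
have tp : 0 < t by lra.
have e1 : 0 < 1 + e by lra.
have te : 0 < t * e by rewrite mulr_gt0.
have te1 : 0 < t * (1 + e) by rewrite mulr_gt0.
have F' := geodesic_from_scale (a := t^-1) _ e0 F (e' := t * e) (b' := t * (1 + e)).
rewrite scalerA mulVf ?gt_eqF// scale1r !mulKf ?gt_eqF// invr_ge0 in F'.
have {}F' := F' (ltW tp) (lexx _) (lexx _) te te1 e1.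
have tb : t < t * (1 + e) by rewrite mulrDr mulr1 ltrDl.
have b1 : 1 < t * (1 + e) by lra.
have := exp_detour te F' ler01 b1 (ltW tp) tb xs'.
rewrite mulVf ?gt_eqF// -(Exp_geodesic e0 _ F) ?ltrDl//.
rewrite -Exi -(Exp_geodesic te b1 F') => /(_ erefl Dt).
rewrite gtr0_norm ?subr_gt0//; nra.
Qed.

(** Suppose that [w] has cut time [1] and the same image. It is minimizing up
    to times arbitrarily close to [1], so [exp_detour], run backwards from
    time [1], shows that [w] is no longer than [xi]; but then its cut time
    exceeds [1]. First the geodesic of [w] has to be continued up to time [1]:
    geodesics of bounded speed can be continued by a uniform time. *)
Lemma interior_small q xi : tnorm X q xi < s / 2 -> interior_set X q (Exp X q xi).
Proof.
move=> xs [w /= cw Ew].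
have s0' := s0.
have xs' : tnorm X q xi < s by lra.
have sup t : t < 1 -> exists t', [/\ t < t', t' <= 1, 0 <= t' & dist X q (Exp X q (t' *: w)) = (t' * tnorm X q w)%:E].
  move=> t1; have : (t%:E < cut_time X q w)%E by rewrite cw lte_fin.
  move=> /ereal_sup_gt[_ [t' [t'0 D'] <-]]; rewrite lte_fin => tt; exists t'; split=> //.
  rewrite -lee_fin -[leRHS]cw; apply: ereal_sup_ubound; by exists t'.
have small : tnorm X q w < s / 2 -> False.
  by move=> /cut_time_small; rewrite cw ltxx.
have wb : s / 2 <= tnorm X q w by rewrite leNgt; apply/negP.
have w0 : 0 < tnorm X q w by lra.
pose a := s / (2 * tnorm X q w).
have a0 : 0 < a by rewrite divr_gt0// mulr_gt0.
have aw : a * tnorm X q w = s / 2 by rewrite /a; field; rewrite gt_eqF.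
have [e [b [g [e0 b1 F]]]] : exists e b g, [/\ 0 < e, 1 < b & geodesic_from X q w e b g].
  have [|t' [t1 t2 t3 D']] := sup (Num.max 2^-1 (1 - a)).
    by rewrite gt_max; apply/andP; split; lra.
  move: t1; rewrite gt_max => /andP[t1 t1'].
  have tp : 0 < t' by lra.
  have [[g [e [e0 F]]]|Eq] := Exp_cases q (t' *: w); last first.
    move: D'; rewrite Eq dist_self => -[D']; have := mulr_gt0 tp w0.
    by rewrite -D' ltxx.
  have te : 0 < t' * e by rewrite mulr_gt0.
  have e1 : 0 < 1 + e by lra.
  have te1 : 0 < t' * (1 + e) by rewrite mulr_gt0.
  have F' := geodesic_from_scale (a := t'^-1) _ e0 F (e' := t' * e) (b' := t' * (1 + e)).
  rewrite scalerA mulVf ?gt_eqF// scale1r !mulKf ?gt_eqF// invr_ge0 in F'.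
  have {}F' := F' (ltW tp) (lexx _) (lexx _) te te1 e1.
  set g1 := (fun _ => _) in F'.
  have tb : t' < t' * (1 + e) by rewrite mulrDr mulr1 ltrDl.
  pose u := derive1 (coord (chart_at X (g1 t')) \o g1) t'.
  have nu : tnorm X (g1 t') u = tnorm X q w.
    by apply: (gspeed_from te te1 F') => //; lra.
  have [|[g2 F2] _ _] := @NR (g1 t') (a *: u).
    by rewrite tnormZ gtr0_norm// nu aw; lra.
  have two : (0 : R) < 2 by [].
  have a2 : 0 < a * 2 by rewrite mulr_gt0.
  have F2' := geodesic_from_scale (a := a^-1) _ two F2 (e' := a * 2) (b' := a * 2).
  rewrite scalerA mulVf ?gt_eqF// scale1r !mulKf ?gt_eqF// invr_ge0 in F2'.
  have {}F2' := F2' (ltW a0) (lexx _) (lexx _) a2 a2 two.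
  have [g3 [F3 _]] := geo_extend te tp tb a2 a2 F' erefl F2'.
  by exists (t' * e), (t' + a * 2), g3; split=> //; lra.
apply: small; apply: le_lt_trans xs; rewrite leNgt; apply/negP => lw.
pose d := (tnorm X q w - tnorm X q xi) / (4 * tnorm X q w).
have d0 : 0 < d by rewrite divr_gt0 ?mulr_gt0// subr_gt0.
have dw : d * tnorm X q w = (tnorm X q w - tnorm X q xi) / 4 by rewrite /d; field; rewrite gt_eqF.
have [|t [t1 t2 t3 Dt]] := sup (1 - d); first lra.
have b0 : 0 < b by lra.
have dt : t * 1 < b by lra.
have tb : t < b by lra.
have E1 : g 1 = Exp X q xi by rewrite -Ew (Exp_geodesic e0 b1 F).
have Et : dist X q (g t) = (t * tnorm X q w)%:E.
  rewrite -Dt; congr dist.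
  have [t0|tn] := eqVneq t 0.
    by rewrite t0 scale0r Exp_zero; case: F.
  have tp : 0 < t by rewrite lt_neqAle eq_sym tn.
  have [e'0 b'0] : 0 < e / t /\ 1 < b / t.
    by split; [rewrite divr_gt0|rewrite ltr_pdivlMr// mul1r].
  have F' := geodesic_from_scale t3 e0 F (e' := e / t) (b' := b / t).
  rewrite ![t * (_ / t)]mulrC !divfK ?gt_eqF// in F'.
  have b'0' : 0 < b / t by lra.
  have {}F' := F' (lexx _) (lexx _) e'0 b'0' b0.
  by rewrite (Exp_geodesic e'0 b'0 F') mulr1.
have := exp_detour e0 F ler01 b1 t3 tb xs' E1 Et.
rewrite ler0_norm; last lra.
have : (1 - t) * tnorm X q w <= d * tnorm X q w by rewrite ler_wpM2r ?(ltW w0)//; lra.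
rewrite dw; lra.
Qed.

End CutLocus.

Lemma near_continuous (R : realType) (V W : normedModType R) (f : V -> W) (x : V) :
  (forall e : R, 0 < e -> \forall y \near x, `|f x - f y| < e) -> {for x, continuous f}.
Proof. by move=> H; apply/cvgrPdist_lt. Qed.

Lemma contwD (R : realType) (W : normedModType R) (A : set R) (f g : R -> W) t :
  contw A f t -> contw A g t -> contw A (fun s => f s + g s) t.
Proof.
move=> hf hg e e0; have e2 : 0 < e / 2 by rewrite divr_gt0.
apply: filterS2 (hf _ e2) (hg _ e2) => s h1 h2 As; have {}h1 := h1 As; have {}h2 := h2 As.
rewrite opprD addrACA (le_lt_trans (ler_normD _ _))//; lra.
Qed.

Lemma contw_scale (R : realType) (W : normedModType R) (A : set R) (g : R -> W) t :
  contw A g t -> contw A (fun s => s *: g s) t.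
Proof.
move=> hg; have h1 : contw A (id : R -> R^o) t.
  by move=> e e0; apply: filterS (@near_dist R R^o t e e0) => s.
apply: (@contw_comp _ _ _ A (fun s => (s : R^o, g s)) (fun p : R^o * W => p.1 *: p.2)).
  exact: contw_pair.
apply: hasD_continuous; exact: C11_hasD (C11_bilin0 _ (@bilin_scale R W)).
Qed.

(** * Implicit differentiation *)

Section Implicit.
Context {R : realType} {n : nat}.
Local Notation E := 'rV[R]_n.

Lemma mulmx_le (v : E) (A : 'M[R]_n) : `|v *m A| <= n%:R * `|v| * `|A|.
Proof.
apply: mx_norm_le => [|i j]; first by rewrite !mulr_ge0.
rewrite mxE (le_trans (ler_norm_sum _ _ _))//.
apply: (@le_trans _ _ (\sum_(k < n) `|v| * `|A|)).
  by apply: ler_sum => k _; rewrite normrM ler_pM// mx_entry_le.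
by rewrite sumr_const card_ord -[leLHS]mulr_natl mulrA.
Qed.

Lemma unit_bounded_below (A : 'M[R]_n) : A \in unitmx ->
  exists2 k : R, 0 < k & forall v : E, k * `|v| <= `|v *m A|.
Proof.
move=> uA; pose K := n%:R * `|invmx A| + 1.
have K0 : 0 < K by rewrite ltr_wpDl// mulr_ge0.
exists K^-1; first by rewrite invr_gt0.
move=> v; rewrite ler_pdivrMl// /K mulrDl mul1r.
have := mulmx_le (v *m A) (invmx A); rewrite mulmxK//.
have := normr_ge0 (v *m A); rewrite [_ * `|v *m A| * _]mulrAC; lra.
Qed.

Lemma bounded_below_unit (A : 'M[R]_n) (k : R) : 0 < k ->
  (forall v : E, k * `|v| <= `|v *m A|) -> A \in unitmx.
Proof.
move=> k0 H; rewrite unitmxE unitfE; apply/det0P => -[v v0 vA].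
by have := H v; rewrite vA normr0 leNgt mulr_gt0// normr_gt0.
Qed.

(** The equation gives [(x s - x t) *m (A1 + t *: A2)] as [- (s - t) *: P2 (x
    s)] up to an error smaller than [|x s - x t|]. The lower bound first makes
    [x] Lipschitz at [t], and then determines its derivative. *)
Lemma implicit_hasd (P1 P2 : E -> E) (x : R -> E) t (A1 A2 : 'M[R]_n) (k : R) V :
  hasD P1 (x t) (fun h => h *m A1) -> hasD P2 (x t) (fun h => h *m A2) ->
  (\forall s \near t, P1 (x s) + s *: P2 (x s) = 0) ->
  contw setT x t -> 0 < k -> (forall v : E, k * `|v| <= `|v *m (A1 + t *: A2)|) ->
  V *m (A1 + t *: A2) = - P2 (x t) ->
  hasd setT x t V.
Proof.
move=> h1 h2 Z cx k0 Hk HV.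
have [_ _ d1] := h1; have [_ _ d2] := h2.
have cP2 : contw setT (P2 \o x) t by apply: (contw_comp cx); exact: hasD_continuous h2.
have nx (Q : E -> Prop) : (\forall y \near x t, Q y) -> \forall s \near t, Q (x s).
  move=> /near_distP[r r0 H]; apply: filterS (cx r r0) => s h.
  by apply: H; exact: h.
have t1 : 0 < 1 + `|t| by rewrite ltr_pwDl.
have Zt := nbhs_singleton Z.
pose K := 2 * (`|P2 (x t)| + 1) / k.
have K0 : 0 < K by rewrite divr_gt0// mulr_gt0// ltr_wpDl.
have dec s : P1 (x s) + s *: P2 (x s) = 0 ->
  (x s - x t) *m (A1 + t *: A2) = - (P1 (x s) - P1 (x t) - (x s - x t) *m A1)
    - t *: (P2 (x s) - P2 (x t) - (x s - x t) *m A2) - (s - t) *: P2 (x s).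
  move=> Zs; rewrite mulmxDr -scalemxAr.
  move: ((x s - x t) *m A1) ((x s - x t) *m A2) => B1 B2.
  have -> : P1 (x s) = - (s *: P2 (x s)) by apply/eqP; rewrite -addr_eq0 Zs.
  have -> : P1 (x t) = - (t *: P2 (x t)) by apply/eqP; rewrite -addr_eq0 Zt.
  by move: (P2 (x s)) (P2 (x t)) => p q; vlinear R.
have step e : 0 < e -> \forall s \near t, P1 (x s) + s *: P2 (x s) = 0 /\
   `|- (P1 (x s) - P1 (x t) - (x s - x t) *m A1) - t *: (P2 (x s) - P2 (x t) - (x s - x t) *m A2)|
      <= (1 + `|t|) * e * `|x s - x t|.
  move=> e0; apply: filterS3 Z (nx _ (d1 e e0)) (nx _ (d2 e e0)) => s Zs k1 k2; split=> //.
  rewrite (le_trans (ler_normB _ _))// normrN normrZ mulrDl mul1r mulrDl.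
  by rewrite lerD// -mulrA ler_wpM2l.
have Lip : \forall s \near t, `|x s - x t| <= K * `|s - t|.
  have e0 : 0 < k / (2 * (1 + `|t|)) by rewrite divr_gt0// mulr_gt0.
  apply: filterS2 (step _ e0) (cP2 1 ltr01) => s [Zs k1] k2; have {}k2 := k2 I.
  have k3 := Hk (x s - x t); rewrite dec// in k3.
  have k4 := le_trans k3 (ler_normB _ _); rewrite normrZ in k4.
  have -> : K * `|s - t| = (2 * (`|P2 (x t)| + 1) * `|s - t|) / k by rewrite /K; ring.
  rewrite ler_pdivlMr//.
  have k5 : (1 + `|t|) * (k / (2 * (1 + `|t|))) * `|x s - x t| = k / 2 * `|x s - x t|.
    by field; rewrite gt_eqF.
  rewrite k5 in k1.
  have k6 : `|P2 (x s)| <= `|P2 (x t)| + 1.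
    rewrite -(subrK (P2 (x t)) (P2 (x s))) (le_trans (ler_normD _ _))// addrC lerD2l ltW//.
  have k7 : `|s - t| * `|P2 (x s)| <= `|s - t| * (`|P2 (x t)| + 1) by rewrite ler_wpM2l.
  lra.
move=> e e0.
pose e1 := k * e / (2 * ((1 + `|t|) * K)).
have e10 : 0 < e1.
  by apply: divr_gt0; [exact: mulr_gt0|apply: mulr_gt0 => //; exact: mulr_gt0].
have e20 : 0 < k * e / 2.
  by apply: divr_gt0; rewrite ?mulr_gt0.
apply: filterS3 (step _ e10) Lip (cP2 _ e20) => s [Zs k1] k2 k3 _; have {}k3 := k3 I.
rewrite -(ler_pM2l k0) (le_trans (Hk _))//.
rewrite mulmxBl -scalemxAl HV dec//.
set a := - (_ - _ - _) - _ in k1 *.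
have LZ (b p q : E) (u : R) : b - u *: p - u *: - q = b - u *: (p - q) by vlinear R.
rewrite LZ.
rewrite (le_trans (ler_normB _ _))// normrZ.
have st0 := normr_ge0 (s - t).
have k4 : `|s - t| * `|P2 (x s) - P2 (x t)| <= `|s - t| * (k * e / 2) by rewrite ler_wpM2l// ltW.
have k5 : (1 + `|t|) * e1 * `|x s - x t| <= (1 + `|t|) * e1 * (K * `|s - t|).
  by rewrite ler_wpM2l// mulr_ge0 ?ltW.
have k6 : (1 + `|t|) * e1 * (K * `|s - t|) = k * e / 2 * `|s - t|.
  by rewrite /e1; field; rewrite !gt_eqF.
rewrite k6 in k5; lra.
Qed.

Lemma implicit_cont (A : R -> 'M[R]_n) (V P : R -> E) t (k : R) :
  contw setT A t -> contw setT P t -> 0 < k -> (forall v : E, k * `|v| <= `|v *m A t|) ->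
  (\forall s \near t, V s *m A s = P s) -> contw setT V t.
Proof.
move=> cA cP k0 Hk HV e e0.
have Vt := nbhs_singleton HV.
pose B := n%:R + 1 : R.
have B0 : 0 < B by rewrite ltr_wpDl.
pose K := 2 * (`|P t| + 1) / k.
have K0 : 0 < K by rewrite divr_gt0// mulr_gt0// ltr_wpDl.
have m1 : 0 < k / (2 * B) by rewrite divr_gt0// mulr_gt0.
have m2 : 0 < k * e / (4 * B * K).
  by apply: divr_gt0; [exact: mulr_gt0|apply: mulr_gt0 => //; exact: mulr_gt0].
have m3 : 0 < k * e / 4 by rewrite divr_gt0// mulr_gt0.
near=> s => _.
have a1 : `|A s - A t| < k / (2 * B) by have := I; near: s; exact: cA.
have a2 : `|A s - A t| < k * e / (4 * B * K) by have := I; near: s; exact: cA.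
have a3 : `|P s - P t| < 1 by have := I; near: s; exact: (cP _ ltr01).
have a4 : `|P s - P t| < k * e / 4 by have := I; near: s; exact: cP.
have Vs : V s *m A s = P s by near: s; exact: HV.
have md : `|V s *m (A s - A t)| <= B * `|V s| * `|A s - A t|.
  rewrite (le_trans (mulmx_le _ _))// -!mulrA ler_wpM2r ?mulr_ge0// lerDl//.
have bV : `|V s| <= K.
  rewrite ler_pdivlMr//.
  have h1 := Hk (V s).
  have E1 : V s *m A t = P s - V s *m (A s - A t) by rewrite mulmxBr Vs opprB addrC subrK.
  rewrite E1 in h1; have h2 := le_trans h1 (ler_normB _ _).
  have h3 : B * `|V s| * `|A s - A t| <= `|V s| * (k / 2).
    rewrite [B * _]mulrC -mulrA ler_wpM2l//; move: a1; rewrite ltr_pdivlMr ?mulr_gt0//; lra.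
  have h4 : `|P s| <= `|P t| + 1.
    by rewrite -(subrK (P t) (P s)) (le_trans (ler_normD _ _))// addrC lerD2l ltW.
  lra.
rewrite -(ltr_pM2l k0) (le_lt_trans (Hk _))//.
have -> : (V s - V t) *m A t = (P s - P t) - V s *m (A s - A t).
  by rewrite mulmxBl mulmxBr Vt Vs; move: (P s) (P t) (V s *m A t) => p q a; vlinear R.
rewrite (le_lt_trans (ler_normB _ _))//.
have h5 : B * `|V s| * `|A s - A t| <= B * K * `|A s - A t|.
  by rewrite ler_wpM2r// ler_wpM2l// ltW.
have h6 : B * K * `|A s - A t| <= k * e / 4.
  have p0 : 0 < 4 * B * K by apply: mulr_gt0 => //; exact: mulr_gt0.
  move: a2; rewrite ltr_pdivlMr// => a2.
  have E2 : `|A s - A t| * (4 * B * K) = 4 * (B * K * `|A s - A t|) by ring.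
  move: a2; rewrite E2; lra.
have := mulr_gt0 k0 e0; lra.
Unshelve. all: by end_near. Qed.

Lemma bounded_below_near (A : R -> 'M[R]_n) t (k : R) :
  contw setT A t -> 0 < k -> (forall v : E, k * `|v| <= `|v *m A t|) ->
  \forall s \near t, forall v : E, k / 2 * `|v| <= `|v *m A s|.
Proof.
move=> cA k0 Hk; have B0 : 0 < n%:R + 1 :> R by rewrite ltr_wpDl.
have m1 : 0 < k / (2 * (n%:R + 1)) by rewrite divr_gt0// mulr_gt0.
apply: filterS (cA _ m1) => s /(_ I) a1 v.
have h1 := Hk v.
have E1 : v *m A t = v *m A s - v *m (A s - A t) by rewrite mulmxBr subKr.
rewrite E1 in h1; have h2 := le_trans h1 (ler_normB _ _).
have h3 := mulmx_le v (A s - A t).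
have h4 : n%:R * `|v| * `|A s - A t| <= `|v| * (k / 2).
  move: a1; rewrite ltr_pdivlMr ?mulr_gt0// => a1.
  rewrite [n%:R * _]mulrC -mulrA ler_wpM2l//; have := normr_ge0 (A s - A t); lra.
lra.
Qed.

Lemma hasd_min (F : R -> R) t l : hasd setT (F : R -> R^o) t l -> (forall s, F t <= F s) -> l = 0.
Proof.
move=> hF Hm; apply/eqP; apply/negPn/negP => l0.
have nl : 0 < `|l| by rewrite normr_gt0.
have /(@near_distP R R^o)[d d0 Hd] := hF (`|l| / 2) (divr_gt0 nl (ltr0n _ 2)).
pose s := t - Num.sg l * (d / 2).
have Es : s - t = - (Num.sg l * (d / 2)) by rewrite /s; ring.
have ns : `|s - t| = d / 2.
  by rewrite Es normrN normrM normr_sg l0 mul1r gtr0_norm// divr_gt0.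
have := Hd s; rewrite ns => /(_ (ltac:(lra)) I).
have -> : (s - t) *: (l : R^o) = - (`|l| * (d / 2)).
  by rewrite Es /GRing.scale/= mulNr mulrAC -normrEsg.
have := Hm s; rewrite ler_norml => h /andP[_ h'].
have := mulr_gt0 nl d0; lra.
Qed.

Lemma hasd_derive_dir (W : normedModType R) (f : E -> W) (x v : E) l :
  hasd setT (fun s => f (x + s *: v)) 0 l -> 'D_v f x = l.
Proof.
move=> /hasd_derive[_]; rewrite /derive1 /derive => <-.
set F1 := (X in X @ _); set F2 := (X in _ = lim (X @ _)).
have -> : F1 = F2; last by [].
by apply/funext => h; rewrite /F1 /F2 /= scale0r !addr0 [h *: v + x]addrC.
Qed.

Lemma hasd_sum (W : normedModType R) (A : set R) (m : nat) (f : 'I_m -> R -> W) t l :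
  (forall i, hasd A (f i) t (l i)) -> hasd A (fun s => \sum_i f i s) t (\sum_i l i).
Proof.
move=> H; elim: (index_enum _) => [|i r IH].
  rewrite big_nil; apply: hasd_ext (hasd_cst A (0 : W) t) => s; by rewrite big_nil.
rewrite big_cons; apply: hasd_ext (hasdD (H i) IH) => s; by rewrite big_cons.
Qed.

End Implicit.

(** * Smoothness of the solution path *)

Section SolutionPathSmooth.
Context {R : realType} {n : nat} {M : topologicalType}.
Variable X : riemannian_manifold R n M.
Implicit Types (c d : chart X) (q : M) (f : M -> R).
Local Notation E := 'rV[R]_n.

(** The differential instead of the gradient: it has the same zeros, and its
    derivative involves no derivative of the metric. *)
Definition chart_diff c f (x : E) : E := \row_l ('D_(delta_mx 0 l : E) (f \o para c : E -> R) x : R).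
Definition chart_hess c f (x : E) : 'M[R]_n :=
  \matrix_(j, l) ('D_(delta_mx 0 j : E) (fun y => 'D_(delta_mx 0 l : E) (f \o para c : E -> R) y : R) x : R).

Lemma chart_diff_hasD c f x : C2_on_manifold X f -> cod c x -> hasD (chart_diff c f) x (fun h => h *m chart_hess c f x).
Proof.
move=> /(_ c) [_ H2] cx.
have l : lin (fun h : E => h *m chart_hess c f x) by move=> a u v; rewrite mulmxDl -scalemxAl.
split=> //; first exact: lin_bounded.
move=> e e0.
have Hl (l : 'I_n) := diff_hasD ((H2 (delta_mx 0 l)).1 x cx).
have : \forall y \near x, forall l : 'I_n,
   `|'D_(delta_mx 0 l : E) (f \o para c : E -> R) y - 'D_(delta_mx 0 l : E) (f \o para c : E -> R) x
     - 'D_(y - x) ('D_(delta_mx 0 l : E) (f \o para c : E -> R)) x| <= e * `|y - x|.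
  by apply: near_ord => i; have [_ _ h] := Hl i; exact: h.
apply: filterS => y H; apply: rV_norm_le => [|j]; first by rewrite mulr_ge0// ltW.
apply: le_trans (H j); rewrite !mxE.
rewrite (derive_sum_delta (y - x) ((H2 (delta_mx 0 j)).1 x cx)).
rewrite le_eqVlt; apply/orP; left; apply/eqP; congr (Num.norm (_ - _)).
by apply: eq_bigr => i _; rewrite !mxE.
Qed.

Lemma chart_hess_continuous c f x : C2_on_manifold X f -> cod c x -> {for x, continuous (chart_hess c f)}.
Proof.
move=> /(_ c) [_ H2] cx; apply: near_continuous => e e0.
have e2 : 0 < e / 2 by rewrite divr_gt0.
have : \forall y \near x, forall j l : 'I_n,
   `|chart_hess c f x j l - chart_hess c f y j l| < e / 2.
  apply: near_ord => j; apply: near_ord => l.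
  have E1 y : chart_hess c f y j l = 'D_(delta_mx 0 j : E) (fun y => 'D_(delta_mx 0 l : E) (f \o para c : E -> R) y : R) y.
    by rewrite mxE.
  have /cvgrPdist_lt/(_ _ e2) := (H2 (delta_mx 0 l)).2 (delta_mx 0 j) x cx.
  by apply: filterS => y; rewrite -(E1 x) -(E1 y).
apply: filterS => y H; apply: (@le_lt_trans _ _ (e / 2)); last lra.
by apply: mx_norm_le => [|i j]; [exact: ltW|rewrite mxE [X in _ + X]mxE; exact: ltW].
Qed.

Lemma C2_continuous f q : C2_on_manifold X f -> {for q, continuous f}.
Proof.
move=> H; set c := chart_at X q; have dc : dom c q by exact: chart_atP.
have [H1 _] := H c; have cf := differentiable_continuous (H1 _ (cod_coord dc)).
have cc := coord_continuous dc.
have := cvg_comp _ _ cc cf; rewrite /= coordK// => h U /h nU.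
have nd : \forall q' \near q, dom c q' by exact: open_nbhs_nbhs (conj (@dom_open _ _ _ X c) dc).
by apply: filterS2 nd nU => q' dq' /=; rewrite coordK.
Qed.

Variables (f1 f2 : M -> R) (gamma : R -> M).
Hypotheses (f1_C2 : C2_on_manifold X f1) (f2_C2 : C2_on_manifold X f2).
Hypothesis M_compact : compact [set: M].
Hypothesis gammaP : forall mu : R, 0 < mu ->
       argmin_set (fun x => f1 x + mu * f2 x) = [set gamma mu].
Hypothesis hess_inj : forall mu : R, 0 < mu ->
       injective (hessian X (fun x => f1 x + mu * f2 x) (gamma mu)).

Lemma gamma_min mu y : 0 < mu -> f1 (gamma mu) + mu * f2 (gamma mu) <= f1 y + mu * f2 y.
Proof.
move=> mu0; have : argmin_set (fun x => f1 x + mu * f2 x) (gamma mu) by rewrite gammaP.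
exact.
Qed.

Lemma gamma_unique mu q : 0 < mu -> f1 q + mu * f2 q <= f1 (gamma mu) + mu * f2 (gamma mu) -> q = gamma mu.
Proof.
move=> mu0 h; have : argmin_set (fun x => f1 x + mu * f2 x) q.
  by move=> y; exact: le_trans h (gamma_min y mu0).
by rewrite gammaP.
Qed.

(** Outside a neighbourhood of [gamma mu0] the objective at [mu] exceeds its
    value at [gamma mu0]: at each point for all [mu] close to [mu0], and
    uniformly by compactness. *)
Lemma gamma_cont (mu0 : R) : 0 < mu0 -> gamma mu @[mu --> mu0] --> gamma mu0.
Proof.
move=> mu00 U; rewrite nbhsE => -[V [oV Vg] VU].
have cK : compact (~` V).
  by rewrite -(setTI (~` V)); apply: compact_closedI => //; exact: open_closedC.
have H : \forall mu \near mu0, forall x, (~` V) x -> f1 (gamma mu0) + mu * f2 (gamma mu0) < f1 x + mu * f2 x.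
  move/compact_near_coveringP : cK => /(_ R (nbhs mu0) (fun mu x => f1 (gamma mu0) + mu * f2 (gamma mu0) < f1 x + mu * f2 x)).
  apply=> x Vx.
  pose D := f1 x - f1 (gamma mu0) + mu0 * (f2 x - f2 (gamma mu0)).
  have D0 : 0 < D.
    rewrite /D ltNge; apply/negP => h; apply: Vx.
    suff -> : x = gamma mu0 by [].
    apply: gamma_unique => //; lra.
  pose B := `|f2 x - f2 (gamma mu0)| + 2 + mu0.
  have B0 : 0 < B by rewrite /B; have := normr_ge0 (f2 x - f2 (gamma mu0)); lra.
  pose e := Num.min 1 (D / (4 * B)).
  have e0 : 0 < e by rewrite lt_min ltr01 divr_gt0// mulr_gt0.
  have e1 : e <= 1 by rewrite ge_min lexx.
  have eB : e * (4 * B) <= D by rewrite -ler_pdivlMr ?mulr_gt0// ge_min lexx orbT.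
  have /cvgrPdist_lt/(_ _ e0) n1 := C2_continuous (q := x) f1_C2.
  have /cvgrPdist_lt/(_ _ e0) n2 := C2_continuous (q := x) f2_C2.
  exists ([set x' | `|f1 x - f1 x'| < e /\ `|f2 x - f2 x'| < e], [set mu : R | `|mu - mu0| < e]) => /=.
    by split; [exact: filterS2 n1 n2|exact: (@near_dist R R^o)].
  move=> [x' mu] /= [[k1 k2] k3].
  rewrite -subr_gt0.
  have -> : f1 x' + mu * f2 x' - (f1 (gamma mu0) + mu * f2 (gamma mu0)) =
     D - (f1 x - f1 x') - mu0 * (f2 x - f2 x') + (mu - mu0) * (f2 x - f2 (gamma mu0)) - (mu - mu0) * (f2 x - f2 x').
    by rewrite /D; ring.
  have j1 : mu0 * (f2 x - f2 x') <= mu0 * e.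
    by rewrite ler_pM2l// (le_trans (ler_norm _))// ltW.
  have j2 : - ((mu - mu0) * (f2 x - f2 (gamma mu0))) <= e * `|f2 x - f2 (gamma mu0)|.
    by rewrite (le_trans (ler_norm _))// normrN normrM ler_wpM2r// ltW.
  have j3 : (mu - mu0) * (f2 x - f2 x') <= e * 1.
    by rewrite (le_trans (ler_norm _))// normrM ler_pM// ltW// (lt_le_trans k2).
  have j4 := ler_norm (f1 x - f1 x').
  have j5 : e * B = e * `|f2 x - f2 (gamma mu0)| + e * 2 + e * mu0 by rewrite /B; ring.
  have eB0 := mulr_gt0 e0 B0; lra.
have np : \forall mu \near mu0, 0 < mu by exact: lt_nbhsr.
apply: filterS2 H np => mu H mup; apply: VU; apply: contrapT => nV.
by have := H _ nV; rewrite ltNge gamma_min.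
Qed.

Lemma gamma_critical c mu : 0 < mu -> dom c (gamma mu) ->
  chart_diff c f1 (coord c (gamma mu)) + mu *: chart_diff c f2 (coord c (gamma mu)) = 0.
Proof.
move=> mu0 dc; have cx := cod_coord dc; set x := coord c (gamma mu) in cx *.
apply/rowP => l; rewrite !mxE.
have D f : C2_on_manifold X f -> hasd setT (fun s : R => (f \o para c) (x + s *: (delta_mx 0 l : E)) : R^o) 0
   ('D_(delta_mx 0 l : E) (f \o para c : E -> R) x).
  move=> /(_ c)[H1 _]; have h := diff_hasD (H1 x cx).
  apply: (@hasD_hasd_line R E R^o (f \o para c) x (delta_mx 0 l) 0 (fun h => 'D_h (f \o para c : E -> R) x)).
  by rewrite scale0r addr0.
have := hasdD (D _ f1_C2) (hasdZ mu (D _ f2_C2)).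
move=> /hasd_min; apply=> s; rewrite scale0r addr0 /= coordK//.
exact: gamma_min.
Qed.

(** At a critical point neither the connection term nor the derivative of the
    inverse metric contributes, so that a vector in the kernel of the matrix
    is in the kernel of the Hessian. *)
Lemma gamma_hess_unit mu : 0 < mu ->
  chart_hess (chart_at X (gamma mu)) f1 (coord (chart_at X (gamma mu)) (gamma mu))
  + mu *: chart_hess (chart_at X (gamma mu)) f2 (coord (chart_at X (gamma mu)) (gamma mu)) \in unitmx.
Proof.
set c := chart_at X (gamma mu); set x := coord c (gamma mu) => mu0; have dc : dom c (gamma mu) by exact: chart_atP.
have cx : cod c x by exact: cod_coord.
have crit := gamma_critical mu0 dc; rewrite -/x in crit.
set phi := (fun x => f1 x + mu * f2 x).
pose P y := chart_diff c f1 y + mu *: chart_diff c f2 y.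
have gE y : cod c y -> gradient c phi y = \row_k \sum_(l < n) invmx (gram c y) k l * P y 0 l.
  move=> cy; apply/rowP => k; rewrite !mxE; apply: eq_bigr => l _; congr (_ * _).
  rewrite !mxE; have [H1 _] := f1_C2 c; have [H2 _] := f2_C2 c.
  have d1 := H1 y cy; have d2 := H2 y cy.
  apply: hasd_derive_dir; have D f : differentiable (f \o para c) y ->
     hasd setT (fun s : R => (f \o para c) (y + s *: (delta_mx 0 l : E)) : R^o) 0
     ('D_(delta_mx 0 l : E) (f \o para c : E -> R) y).
    move=> df; have h := diff_hasD df.
    apply: (@hasD_hasd_line R E R^o (f \o para c) y (delta_mx 0 l) 0 (fun h => 'D_h (f \o para c : E -> R) y)).
    by rewrite scale0r addr0.
  exact: (hasdD (D _ d1) (hasdZ mu (D _ d2))).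
have g0 : gradient c phi x = 0.
  rewrite gE// /P crit; apply/rowP => k; rewrite !mxE big1// => l _; by rewrite mxE mulr0.
have hE v : hessian X phi (gamma mu) v = 'D_v (gradient c phi) x.
  rewrite /hessian -/c -/x g0; rewrite [connection_term _ _ _ _](_ : _ = 0) ?addr0//.
  apply/rowP => k; rewrite !mxE big1// => i _; rewrite big1// => j _.
  by rewrite mxE mulr0.
rewrite unitmxE unitfE; apply/det0P => -[v v0 vA].
move/eqP: v0; apply; apply: (@hess_inj mu mu0); rewrite !hE.
have Hz w : w *m (chart_hess c f1 x + mu *: chart_hess c f2 x) = 0 -> 'D_w (gradient c phi) x = 0.
  move=> wA; apply: hasd_derive_dir.
  apply: (@hasd_near _ _ _ (fun s => \row_k \sum_(l < n) invmx (gram c (x + s *: w)) k l * P (x + s *: w) 0 l)) => //.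
    apply: filterS (near_line w (@cod_open _ _ _ X c) cx) => s cs _; by rewrite gE.
  apply: hasd_rV => k; rewrite mxE.
  have hP : hasd setT (fun s : R => P (x + s *: w)) 0 0.
    have D f : C2_on_manifold X f -> hasd setT (fun s : R => chart_diff c f (x + s *: w)) 0 (w *m chart_hess c f x).
      move=> Cf; apply: (@hasD_hasd_line R E E (chart_diff c f) x w 0 (fun h => h *m chart_hess c f x)).
      by rewrite scale0r addr0; exact: chart_diff_hasD.
    have := hasdD (D _ f1_C2) (hasdZ mu (D _ f2_C2)).
    by rewrite scalemxAr -mulmxDr wA.
  apply: (@hasd_ext _ R^o _ (fun s => \sum_(l < n) invmx (gram c (x + s *: w)) k l * P (x + s *: w) 0 l)).
    by move=> s; rewrite mxE.
  suff : hasd setT (fun s => \sum_(l < n) invmx (gram c (x + s *: w)) k l * P (x + s *: w) 0 l : R^o) 0 (\sum_(l < n) 0).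
    by rewrite big1.
  apply: (@hasd_sum R R^o) => l.
  have [dg cg] : C11e (fun y => invmx (gram c y) k l : R^o) x.
    apply: C11e_invmx.
      have : \forall y \near x, cod c y by exact: open_nbhs_nbhs (conj (@cod_open _ _ _ X c) cx).
      by apply: filterS => y; exact: gram_unit.
    by move=> i' j'; eexists; apply: C11_entry; exact: gram_C11.
  have hG : hasd setT (fun s : R => invmx (gram c (x + s *: w)) k l : R^o) 0 (dg x w).
    apply: (@hasD_hasd_line R E R^o (fun y => invmx (gram c y) k l) x w 0 (dg x)).
    by rewrite scale0r addr0; exact: C11_hasD.
  have E2 : P (x + 0 *: w) 0 l = 0 by rewrite scale0r addr0 /P crit mxE.
  have := hasdM hG (hasd_entry 0 l hP).
  have -> : invmx (gram c (x + 0 *: w)) k l * (0 : E) 0 l + dg x w * P (x + 0 *: w) 0 l = 0.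
    by rewrite E2 mxE !mulr0 addr0.
  exact.
by rewrite Hz// Hz// mul0mx.
Qed.

(** The matrix of second derivatives remains bounded below near [mu0], so that
    the implicit differentiation applies at all nearby parameters in the same
    chart. *)
Theorem gamma_curve (mu0 : R) : 0 < mu0 -> exists x x',
  \forall mu \near mu0, curve_in (chart_at X (gamma mu0)) setT gamma x x' mu.
Proof.
move=> mu00; set c := chart_at X (gamma mu0).
have dc : dom c (gamma mu0) by exact: chart_atP.
pose x mu := coord c (gamma mu).
have cx : cod c (x mu0) by exact: cod_coord.
pose A mu := chart_hess c f1 (x mu) + mu *: chart_hess c f2 (x mu).
have [k k0 Hk] := unit_bounded_below (gamma_hess_unit mu00).
rewrite -/c -/(x mu0) -/(A mu0) in Hk.
(* The derivative prescribed by differentiating [chart_diff f1 + mu *: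
   chart_diff f2 = 0] along the curve. *)
pose x' mu := (- chart_diff c f2 (x mu)) *m invmx (A mu).
have cxw mu : 0 < mu -> dom c (gamma mu) -> contw setT x mu.
  move=> mup dmu e e0.
  have /cvgrPdist_lt/(_ _ e0) := cvg_comp _ _ (gamma_cont mup) (coord_continuous dmu).
  by apply: filterS => s /= h _; rewrite distrC.
have cA mu : 0 < mu -> dom c (gamma mu) -> contw setT A mu.
  move=> mup dmu; have cmu := cod_coord dmu.
  have h1 := contw_comp (cxw _ mup dmu) (chart_hess_continuous f1_C2 cmu).
  have h2 := contw_comp (cxw _ mup dmu) (chart_hess_continuous f2_C2 cmu).
  exact: contwD h1 (contw_scale h2).
pose Q mu := [/\ dom c (gamma mu), 0 < mu & forall v : E, k / 2 * `|v| <= `|v *m A mu|].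
have nQ : \forall mu \near mu0, Q mu.
  have n1 : \forall mu \near mu0, dom c (gamma mu).
    by apply: (gamma_cont mu00); exact: open_nbhs_nbhs (conj (@dom_open _ _ _ X c) dc).
  by apply: filterS3 n1 (lt_nbhsr mu00) (bounded_below_near (cA _ mu00 dc) k0 Hk) => mu; split.
have k2 : 0 < k / 2 by rewrite divr_gt0.
exists x, x'; move/near_join: (nQ); apply: filterS => mu nQmu.
have [dmu mup bA] := nbhs_singleton nQmu.
split=> //.
- by apply: filterS nQmu => s [ds _ _] _.
- move/near_join: (nQmu); apply: filterS => s nQs _.
  have [ds sp bs] := nbhs_singleton nQs; have cs := cod_coord ds.
  apply: (implicit_hasd (chart_diff_hasD f1_C2 cs) (chart_diff_hasD f2_C2 cs) _ (cxw _ sp ds) k2 bs).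
    by apply: filterS nQs => u [du up _]; exact: gamma_critical.
  by rewrite /x' mulmxKV// (bounded_below_unit k2 bs).
- have cP : contw setT (fun mu => - chart_diff c f2 (x mu)) mu.
    have := contw_comp (cxw _ mup dmu) (hasD_continuous (chart_diff_hasD f2_C2 (cod_coord dmu))).
    by move/contw_cvg => h; apply/contw_cvg; exact: cvgN.
  have H : contw setT x' mu.
    apply: (implicit_cont (cA _ mup dmu) cP k2 bA).
    by apply: filterS nQmu => s [_ _ bs]; rewrite /x' mulmxKV// (bounded_below_unit k2 bs).
  exact: H.
Qed.

End SolutionPathSmooth.

(** * The lifted path *)

Section LiftedPath.
Context {R : realType} {n : nat} {M : topologicalType}.
Variable X : riemannian_manifold R n M.
Implicit Types (c d : chart X) (q : M).
Local Notation E := 'rV[R]_n.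

Lemma hasd_segment (A : set R) (x h : E) t : hasd A (fun s : R => x + s *: h) t h.
Proof.
move=> e e0; apply/(@near_distP R R^o); exists 1 => // s _ _.
have -> : x + s *: h - (x + t *: h) - (s - t) *: h = 0 by vlinear R.
by rewrite normr0 mulr_ge0// ltW.
Qed.

Lemma chart_dist c (x0 x y : E) (rho K : R) : 0 <= K ->
  (forall z, `|z - x0| < rho -> cod c z /\ forall v, chart_norm c z v <= K * `|v|) ->
  `|x - x0| < rho -> `|y - x0| < rho ->
  (dist X (para c x) (para c y) <= (K * `|x - y|)%:E)%E.
Proof.
move=> K0 H xr yr; pose g (t : R) := para c (x + t *: (y - x)).
have g0 : g 0 = para c x by rewrite /g scale0r addr0.
have g1 : g 1 = para c y by rewrite /g scale1r addrC subrK.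
have Hg t : 0 <= t -> t <= 1 ->
    curve_in c `[0, 1] g (fun t => x + t *: (y - x)) (fun _ => y - x) t.
  move=> t0 t1; have [cz _] := H _ (seg_ball xr yr t0 t1).
  split.
  - by have [] := codP cz.
  - apply/(@near_distP R R^o); exists 1 => // s _ /itvP_cc[s0 s1].
    by have [/codP] := H _ (seg_ball xr yr s0 s1).
  - apply/(@near_distP R R^o); exists 1 => // s _ _; exact: hasd_segment.
  - move=> e e0; apply/(@near_distP R R^o); exists 1 => // s _ _.
    by rewrite subrr normr0.
rewrite -g0 -g1; apply: dist_le_C1.
  by apply: curve_in_C1 => // t t0 t1; eexists _, _, _; exact: Hg.
move=> t t0 t1; rewrite (curve_in_speed ltr01 t0 t1 (Hg t t0 t1)).
have [_ Hn] := H _ (seg_ball xr yr t0 t1).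
by rewrite [`|x - y|]distrC; exact: Hn.
Qed.

(** All that is needed on the interval [[a, b]]: the lifted curve with its
    continuous velocity bounded by [L], and a Lipschitz estimate for [Exp] on
    the ball of radius [s1]. The property persists when [s1] decreases or [L]
    increases, as required to make it uniform by compactness. *)
Definition lift_at (s : R) (gamma : R -> M) (a b s1 L : R) : Prop :=
  (exists W W' : R -> E, forall nu, a <= nu -> nu <= b ->
     [/\ tnorm X (gamma b) (W nu) < s / 2, Exp X (gamma b) (W nu) = gamma nu,
         hasd `[a, b] W nu (W' nu), contw `[a, b] W' nu & tnorm X (gamma b) (W' nu) <= L]) /\
  (forall w w', tnorm X (gamma b) w < s1 -> tnorm X (gamma b) w' < s1 ->
     (dist X (Exp X (gamma b) w) (Exp X (gamma b) w') <= (L * tnorm X (gamma b) (w - w'))%:E)%E).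

(** Near [gamma nu0] the exponential maps at all points share the constants
    given by [chart_exp]; the lift inverts them along [gamma]. *)
Lemma lift_local (s : R) (gamma : R -> M) : 0 < s ->
  (forall mu0 : R, 0 < mu0 -> exists x x',
     \forall mu \near mu0, curve_in (chart_at X (gamma mu0)) setT gamma x x' mu) ->
  forall nu0 : R, 0 < nu0 -> exists kap s1 L : R, [/\ 0 < kap, 0 < s1, 0 < L &
  forall a b, `|a - nu0| < kap -> `|b - nu0| < kap -> a < b -> lift_at s gamma a b s1 L].
Proof.
move=> s0 gamma_C1 nu0 nu00; have [x [x' nC]] := gamma_C1 _ nu00.
set c := chart_at X (gamma nu0) in nC.
have C0 := nbhs_singleton nC.
have [_ cx0 Ex0 _ hx0] := curve_in_at (A := setT) I C0.
pose x0 := x nu0.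
have [r1 [m [K [r10 m0 K0 Hn]]]] := chart_norm_equiv cx0; rewrite -/x0 in Hn.
have [r2 [r [C [r20 r0 Cp He]]]] := chart_exp cx0; rewrite -/x0 in He.
pose d := Num.min (Num.min (r1 / 2) r2) (Num.min (r / 8) (s / (16 * K))).
have d0 : 0 < d by rewrite !lt_min r20 !divr_gt0// mulr_gt0.
have d1 : d <= r1 / 2 by rewrite !ge_min lexx.
have d2 : d <= r2 by rewrite !ge_min lexx orbT.
have d3 : d <= r / 8 by rewrite !ge_min lexx !orbT.
have d4 : d * (16 * K) <= s by rewrite -ler_pdivlMr ?mulr_gt0// !ge_min lexx !orbT.
have nx := hasd_cont hx0 d0.
have nx' : \forall nu \near nu0, `|x' nu - x' nu0| < 1.
  by have [_ _ _ h] := C0; apply: filterS (h 1 ltr01) => u; exact.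
have /(@near_distP R R^o)[kap kap0 Hk] : \forall nu \near nu0,
   [/\ curve_in c setT gamma x x' nu, `|x nu - x0| < d & `|x' nu - x' nu0| < 1].
  by apply: filterS3 nC nx nx' => u h1 h2 h3; split=> //; exact: h2.
pose B := `|x' nu0| + 1.
pose s1 := Num.min (m * r / 2) (m * r1 / 8).
have s10 : 0 < s1 by rewrite lt_min !divr_gt0// mulr_gt0.
have s1a : s1 <= m * r / 2 by rewrite ge_min lexx.
have s1b : s1 <= m * r1 / 8 by rewrite ge_min lexx orbT.
have B0 : 0 < B by rewrite ltr_wpDl.
pose L := 2 * K * B + 2 * K / m.
have L0 : 0 < L by rewrite addr_gt0 ?divr_gt0 ?mulr_gt0.
exists kap, s1, L; split=> // a b ak bk ab.
have [Cb xb _] := Hk b bk.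
have [dq cxb Exb _ _] := curve_in_at (A := setT) I Cb.
set q := gamma b in dq Exb *.
have [_ [e [de [xi [up [S e0]]]]]] := He (x b) (lt_le_trans xb d2).
have d1' : d <= r1 by move: r10 d1; clear; lra.
have [_ Hm] := Hn (x b) (lt_le_trans xb d1').
rewrite -Exb in S e0 Hm xb.
have eN := e_near S.
split; last first.
  move=> w w' ws ws'.
  have tr v : tnorm X q v < s1 -> `|to_chart c q v| < r /\ `|e (to_chart c q v) - x0| < r1.
    rewrite (to_chart_nrm dq) => vs; have [h1 _] := Hm (to_chart c q v).
    have m1 : m * `|to_chart c q v| < m * (r / 2).
      by rewrite mulrA (le_lt_trans h1)// (lt_le_trans vs).
    have m2 : m * `|to_chart c q v| < m * (r1 / 8).
      by rewrite mulrA (le_lt_trans h1)// (lt_le_trans vs).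
    rewrite !ltr_pM2l// in m1 m2.
    have vr : `|to_chart c q v| < r by move: r0 m1; clear; lra.
    split=> //.
    have r0' : `|0 : E| < r by rewrite normr0.
    have := near_id_lip eN vr r0'; rewrite subr0 e0 => h2.
    rewrite -(subrK (coord c q) (e _)) -addrA (le_lt_trans (ler_normD _ _))//.
    move: h2 m2 xb d1 r10; clear; lra.
  have [wr wr1] := tr w ws; have [wr' wr1'] := tr w' ws'.
  rewrite (Exp_chart dq S wr) (Exp_chart dq S wr').
  have HK z : `|z - x0| < r1 -> cod c z /\ forall v, chart_norm c z v <= K * `|v|.
    by move=> /Hn[cz h]; split=> // v; have [] := h v.
  apply: (le_trans (chart_dist (ltW K0) HK wr1 wr1')); rewrite lee_fin.
  have h1 := near_id_lip eN wr wr'.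
  have h2 : tnorm X q (w - w') = chart_norm c (coord c q) (to_chart c q w - to_chart c q w').
    by rewrite (to_chart_nrm dq) (linB (to_chart_lin dq)).
  have [h3 _] := Hm (to_chart c q w - to_chart c q w').
  rewrite -h2 in h3; have t0 := tnorm_ge0 X q (w - w').
  have h4 : K * `|e (to_chart c q w) - e (to_chart c q w')| <= K * (2 * `|to_chart c q w - to_chart c q w'|).
    by rewrite ler_pM2l.
  rewrite (le_trans h4)// /L mulrDl.
  have h5 : K * (2 * `|to_chart c q w - to_chart c q w'|) <= 2 * K / m * tnorm X q (w - w').
    have -> : K * (2 * `|to_chart c q w - to_chart c q w'|) = 2 * K / m * (m * `|to_chart c q w - to_chart c q w'|).
      by field; rewrite gt_eqF.
    by rewrite ler_wpM2l// divr_ge0 ?mulr_ge0// ltW.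
  have h6 : 0 <= 2 * K * B * tnorm X q (w - w') by rewrite !mulr_ge0// ltW.
  lra.
have inK nu : a <= nu -> nu <= b -> `|nu - nu0| < kap.
  move=> an nb; move: ak bk; rewrite !ltr_norml => /andP[k1 k2] /andP[k3 k4].
  by apply/andP; split; [move: k1 an|move: nb k4]; clear; lra.
pose V nu := chart_log c r e (gamma nu).
have HV nu : a <= nu -> nu <= b -> [/\ `|V nu| < r, e (V nu) = x nu & `|V nu| <= 4 * d].
  move=> an nb; have [Cn xn _] := Hk nu (inK nu an nb).
  have [_ _ _ gE _] := curve_in_at (A := setT) I Cn.
  have Hs (v : E) : `|v - 0| <= r / 2 -> `|v| < r.
    by rewrite subr0; move: r0; clear; lra.
  have dd : `|x nu - coord c q| <= 2 * d.
    have -> : x nu - coord c q = (x nu - x0) - (coord c q - x0) by vlinear R.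
    by rewrite (le_trans (ler_normB _ _))//; move: xn xb; clear; lra.
  have [h hr Eh] : exists2 h, `|h - 0| <= r / 2 & e h = x nu.
    by apply: (near_id_surj eN Hs); rewrite e0; move: dd d3; clear; lra.
  have hr' := Hs h hr.
  have VE : V nu = h by rewrite /V gE -Eh (chart_logE S hr').
  rewrite VE; split=> //.
  have r0' : `|0 : E| < r by rewrite normr0.
  by have := near_id_inj eN hr' r0'; rewrite subr0 e0 Eh; move: dd; clear; lra.
pose I := `[a, b]%classic.
have Cge := ltW Cp.
have dV nu : a <= nu -> nu <= b -> hasd I V nu (derive_within I V nu) /\ de (V nu) (derive_within I V nu) = x' nu.
  move=> an nb; have [Vr eV _] := HV nu an nb.
  have In : I nu by apply/itvP_cc.
  have [Cn _ _] := Hk nu (inK nu an nb).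
  have [_ _ _ _ hx] := curve_in_at (A := setT) Logic.I Cn.
  have [_ _ dl dH _] := S _ Vr.
  have dq2 w : `|w| < r -> `|e w - e (V nu) - de (V nu) (w - V nu)| <= C * `|w - V nu| ^+ 2.
    by move=> wr; have [] := dH w wr.
  have nV : \forall u \near nu, I u -> `|V u| < r /\ e (V u) = x u.
    apply/(@near_distP R R^o); exists 1 => // u _ /itvP_cc[au ub].
    by have [] := HV u au ub.
  have [V' [EV' hV]] := log_hasd Cge In eN dl dq2 nV (hasd_sub (fun _ _ => Logic.I) hx).
  by have [_ ->] := hasd_within (itv_proper ab an nb) hV.
pose V' := derive_within I V.
have deN nu : a <= nu -> nu <= b -> forall h, `|de (V nu) h - h| <= 2^-1 * `|h|.
  move=> an nb; have [Vr eV _] := HV nu an nb.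
  have [_ _ dl dH _] := S _ Vr.
  by apply: (near_id_der Cge eN dl Vr) => w wr; have [] := dH w wr.
have cV' nu : a <= nu -> nu <= b -> contw I V' nu.
  move=> an nb; have In : I nu by apply/itvP_cc.
  have [Vr eV _] := HV nu an nb; have [_ _ dl dH _] := S _ Vr.
  have [Cn _ _] := Hk nu (inK nu an nb).
  apply: (@log_deriv_cont R n de C I V V' x' nu Cge In).
  - apply/(@near_distP R R^o); exists 1 => // u _ /itvP_cc[au ub].
    have [Vu _ _] := HV u au ub; have [_ _ dlu _ _] := S _ Vu.
    split=> //; first exact: deN.
      move=> h; rewrite distrC; have [_ _] := dH _ Vu; exact.
    by have [] := dV u au ub.
  - by move=> ep ep0; exact: hasd_cont (dV nu an nb).1 _ ep0.
  - by have [_ _ _ h] := Cn; move=> ep ep0; apply: filterS (h ep ep0) => u k _; exact: k.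
pose T := Dtau c (chart_at X q) (coord c q).
have lT : lin T by apply: Dtau_lin; apply: overlap_coord => //; exact: chart_atP.
have [CT CT0 bT] := lin_bounded lT.
exists (fun nu => T (V nu)), (fun nu => T (V' nu)) => nu an nb.
have [Vr eV Vd] := HV nu an nb; have [hV eV'] := dV nu an nb.
have [Cn _ x'n] := Hk nu (inK nu an nb).
have [_ _ _ gE _] := curve_in_at (A := setT) Logic.I Cn.
have tT h : to_chart c q (T h) = h by exact: to_chartK.
split.
- rewrite (to_chart_nrm dq) tT; have [_ h1] := Hm (V nu).
  have h2 : K * `|V nu| <= K * (4 * d) by rewrite ler_pM2l.
  have h3 : 4 * (K * (4 * d)) = d * (16 * K) by ring.
  move: s0 h1 h2 h3 d4; clear; lra.
- by rewrite (Exp_chart dq S (v := T (V nu))) tT// eV gE.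
- exact: hasd_lin lT bT hV.
- apply: (contw_comp (cV' nu an nb)); apply: hasD_continuous.
  exact: C11_hasD (C11_lin _ lT bT).
- rewrite (to_chart_nrm dq) tT; have [_ h1] := Hm (V' nu).
  have h2 := deN nu an nb (V' nu); rewrite eV' in h2.
  have h3 : `|V' nu| <= `|x' nu - V' nu| + `|x' nu|.
    by rewrite -{1}[V' nu](subKr (x' nu)) (le_trans (ler_normB _ _))// addrC.
  have h4 : `|x' nu| <= B.
    by rewrite -(subrK (x' nu0) (x' nu)) (le_trans (ler_normD _ _))// addrC lerD2l ltW.
  have h5 : K * `|V' nu| <= K * (2 * B) by rewrite ler_pM2l//; move: h2 h3 h4; clear; lra.
  have h6 : 0 < 2 * K / m by rewrite divr_gt0// mulr_gt0.
  by rewrite /L; move: h1 h5 h6; clear; lra.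
Qed.

End LiftedPath.

(** * Hermite interpolation in a tangent space *)

Section Hermite.
Context {R : realType} {n : nat} {M : topologicalType}.
Variable X : riemannian_manifold R n M.
Implicit Types (q : M).
Local Notation E := 'rV[R]_n.

Lemma tnormD q u v : tnorm X q (u + v) <= tnorm X q u + tnorm X q v.
Proof. by apply: chart_normD; apply: cod_coord; exact: chart_atP. Qed.

Lemma tnormN q v : tnorm X q (- v) = tnorm X q v.
Proof. exact: chart_normN. Qed.

Lemma tnormB q u v : tnorm X q (u - v) <= tnorm X q u + tnorm X q v.
Proof. by rewrite -(tnormN q v) tnormD. Qed.

(** The norm comes from an inner product: pairing with the increment itself
    reduces to the scalar case. *)
Lemma tnorm_mean_value_bound q (f f' : R -> E) (B a b : R) : a <= b ->
  (forall t, a <= t -> t <= b -> hasd `[a, b] f t (f' t) /\ tnorm X q (f' t) <= B) ->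
  tnorm X q (f b - f a) <= B * (b - a).
Proof.
move=> ab H; set c := chart_at X q; set x := coord c q.
have cx : cod c x by apply: cod_coord; exact: chart_atP.
pose d := f b - f a; pose G := gram c x.
have [d0|d0] := leP (tnorm X q d) 0.
  apply: (le_trans d0); apply: mulr_ge0; last by rewrite subr_ge0.
  have [_] := H a (lexx _) ab; apply: le_trans; exact: tnorm_ge0.
have hip t : a <= t -> t <= b -> hasd `[a, b] (fun s => ip G (f s) d : R^o) t (ip G (f' t) d).
  move=> at_ tb; have [h _] := H t at_ tb.
  have := hasd_ip (hasd_cst `[a, b] G t) h (hasd_cst `[a, b] d t).
  by rewrite ip0m add0r ip0r addr0.
have := @mean_value_bound R R^o (fun s => ip G (f s) d) (B * tnorm X q d) a b ab.
have -> : ip G (f b) d - ip G (f a) d = tnorm X q d ^+ 2.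
  by rewrite (chart_norm_sqr d cx) -ipNl -ipDl.
rewrite ger0_norm ?sqr_ge0// => h.
rewrite -(ler_pM2r d0) -expr2 mulrAC; apply: h => t at_ tb.
exists (ip G (f' t) d); first exact: hip.
have [_ h] := H t at_ tb.
rewrite (le_trans (ip_cauchy_schwarz (f' t) d cx))// ler_wpM2r// ltW//.
Qed.

Lemma hermite_l (a b : R) (ya yb va vb : E) : hermite a b ya yb va vb a = ya.
Proof. by rewrite /hermite subrr mul0r; vlinear R. Qed.

Lemma hermite_r (a b : R) (ya yb va vb : E) : a < b -> hermite a b ya yb va vb b = yb.
Proof.
move=> ab; rewrite /hermite divff; first by vlinear R.
by rewrite gt_eqF// subr_gt0.
Qed.

Lemma hermite_weights_le1 (th : R) : 0 <= th -> th <= 1 ->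
  [/\ `|- 2 * th ^+ 3 + 3 * th ^+ 2| <= 1, `|th ^+ 3 - 2 * th ^+ 2 + th| <= 1 &
      `|th ^+ 3 - th ^+ 2| <= 1].
Proof.
move=> th0 th1; have u0 : 0 <= 1 - th by lra.
have u1 : 1 - th <= 1 by lra.
have uu : 0 <= (1 - th) * (1 - th) by rewrite mulr_ge0.
have tu : 0 <= th * (1 - th) by rewrite mulr_ge0.
split.
- have t2 : 0 <= th * th by rewrite mulr_ge0.
  have t3 : 0 <= th * th * (1 - th) by rewrite mulr_ge0.
  have t5 : 0 <= (1 - th) * (1 - th) * th by rewrite mulr_ge0.
  by rewrite ler_norml !exprS !expr0 !mulr1; apply/andP; split; lra.
- have -> : th ^+ 3 - 2 * th ^+ 2 + th = th * ((1 - th) * (1 - th)) by ring.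
  have p0 : 0 <= th * ((1 - th) * (1 - th)) by rewrite mulr_ge0.
  rewrite (ger0_norm p0); apply: mulr_ile1 => //; exact: mulr_ile1.
- have -> : th ^+ 3 - th ^+ 2 = - (th * (th * (1 - th))) by ring.
  have p0 : 0 <= th * (th * (1 - th)) by rewrite mulr_ge0.
  rewrite normrN (ger0_norm p0); apply: mulr_ile1 => //; exact: mulr_ile1.
Qed.

(** With [u = W' a], both terms are compared with [W a + (mu - a) *: u]. The
    weights of the two velocities and of the increment add up to [th], so that
    [u] cancels; what remains has weights at most [1]. *)
Lemma hermite_error q (W W' : R -> E) (a b om eta : R) vL vR mu : a < b ->
  (forall t, a <= t -> t <= b -> hasd `[a, b] W t (W' t)) ->
  (forall t u, a <= t -> t <= b -> a <= u -> u <= b -> tnorm X q (W' t - W' u) <= om) ->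
  tnorm X q (vL - W' a) <= eta -> tnorm X q (vR - W' b) <= eta ->
  a <= mu -> mu <= b ->
  tnorm X q (W mu - hermite a b (W a) (W b) vL vR mu) <= (b - a) * (3 * om + 2 * eta).
Proof.
move=> ab hW Hom hL hR am mb.
pose th := (mu - a) / (b - a); pose h := b - a.
have h0 : 0 < h by rewrite subr_gt0.
have th0 : 0 <= th by rewrite divr_ge0 ?subr_ge0// ltW.
have th1 : th <= 1 by rewrite ler_pdivrMr// mul1r /h; lra.
have thE : mu = a + th * h by rewrite divfK ?gt_eqF//; lra.
have om0 : 0 <= om.
  have ab' := ltW ab; apply: le_trans (Hom a a (lexx _) ab' (lexx _) ab'); exact: tnorm_ge0.
have D u : a <= u -> u <= b -> tnorm X q (W u - W a - (u - a) *: W' a) <= om * h.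
  move=> au ub; apply: (@le_trans _ _ (om * (u - a))); last by rewrite ler_wpM2l// /h; lra.
  have := @tnorm_mean_value_bound q (fun s => W s - s *: W' a) (fun s => W' s - W' a) om a u au.
  have -> : W u - u *: W' a - (W a - a *: W' a) = W u - W a - (u - a) *: W' a by vlinear R.
  apply=> t at_ tu; have tb : t <= b by lra.
  split; last by apply: Hom => //; lra.
  apply: hasdB.
    by apply: hasd_sub (hW t at_ tb) => s /itvP_cc[s1 s2]; apply/itvP_cc; split; lra.
  apply: hasd_ext (hasd_segment `[a, u] 0 (W' a) t) => s; by rewrite add0r.
have eta0 : 0 <= eta by exact: le_trans (tnorm_ge0 _ _ _) hL.
set r1 := W b - W a - h *: W' a.
set r2 := W mu - W a - (mu - a) *: W' a.
pose h01 := - 2 * th ^+ 3 + 3 * th ^+ 2; pose h10 := th ^+ 3 - 2 * th ^+ 2 + th.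
pose h11 := th ^+ 3 - th ^+ 2.
have -> : W mu - hermite a b (W a) (W b) vL vR mu =
   r2 - h01 *: r1 - (h * h10) *: (vL - W' a) - (h * h11) *: ((vR - W' b) + (W' b - W' a)).
  rewrite /hermite -/h -/th /r2 /r1 /h01 /h10 /h11.
  have -> : mu - a = th * h by lra.
  by vlinear R.
have n1 : tnorm X q r1 <= om * h by apply: D; lra.
have n2 : tnorm X q r2 <= om * h by exact: D.
have [b01 b10 b11] := hermite_weights_le1 th0 th1.
have sc (k : R) v (B : R) : `|k| <= 1 -> tnorm X q v <= B -> tnorm X q (k *: v) <= B.
  move=> k1 vB; rewrite tnormZ (le_trans _ vB)// ler_piMl// tnorm_ge0//.
have sch (k : R) v (B : R) : `|k| <= 1 -> tnorm X q v <= B -> tnorm X q ((h * k) *: v) <= h * B.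
  by move=> k1 vB; rewrite -scalerA tnormZ (gtr0_norm h0) ler_pM2l//; exact: sc.
have m1 := sc _ _ _ b01 n1; have m2 := sch _ _ _ b10 hL.
have m3 : tnorm X q ((h * h11) *: ((vR - W' b) + (W' b - W' a))) <= h * (eta + om).
  apply: sch => //; rewrite (le_trans (tnormD _ _ _))// lerD//.
  exact: Hom (ltW ab) (lexx _) (lexx _) (ltW ab).
rewrite (le_trans (tnormB _ _ _))//.
have k1 := tnormB q (r2 - h01 *: r1) ((h * h10) *: (vL - W' a)).
have k2 := tnormB q r2 (h01 *: r1).
have -> : h * (3 * om + 2 * eta) = om * h + om * h + h * eta + h * (eta + om) by ring.
rewrite lerD// (le_trans k1)// lerD// (le_trans k2)// lerD//.
Qed.

End Hermite.

(** The mean value inequality gives [N1] for the lifted curve and [N2] for the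
    error of interpolation; both curves then stay in the ball of radius [r].
    *)
Lemma piece_arith (R : realType) (L h om eta r N1 N2 : R) : 0 <= L -> 0 < h -> om <= 2 * L -> eta <= 1 ->
  h * (7 * L + 2) < r -> N1 <= L * h -> N2 <= h * (3 * om + 2 * eta) -> N1 < r /\ N1 + N2 < r.
Proof.
move=> L0 h0 oL e1 hr n1 n2.
have k1 : 0 <= h * L by rewrite mulr_ge0// ltW.
have k2 : h * (3 * om + 2 * eta) <= h * (6 * L + 2) by rewrite ler_pM2l//; lra.
by split; lra.
Qed.

(** * Uniform estimates on one interval *)

Section Assembly.
Context {R : realType} {n : nat} {M : topologicalType}.
Variable X : riemannian_manifold R n M.
Implicit Types (q : M).
Local Notation E := 'rV[R]_n.
Variables (s : R) (gamma : R -> M).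
Hypotheses (s0 : 0 < s) (NR : forall q, normal_radius X q s).

Lemma lift_at_mono a b s1 L s1' L' : s1' <= s1 -> L <= L' ->
  lift_at X s gamma a b s1 L -> lift_at X s gamma a b s1' L'.
Proof.
move=> h1 h2 [[W [W' HW]] HL]; split.
  exists W, W' => nu an nb; have [k1 k2 k3 k4 k5] := HW nu an nb.
  by split=> //; exact: le_trans h2.
move=> w w' ws ws'; apply: (le_trans (HL w w' (lt_le_trans ws h1) (lt_le_trans ws' h1))).
by rewrite lee_fin ler_wpM2r// tnorm_ge0.
Qed.

Definition uniform_lift (a b e0 : R) := forall nu c, a <= nu -> nu <= b -> nu - e0 < c -> c < nu ->
  lift_at X s gamma c nu e0 e0^-1.

Lemma lift_uniform (a b : R) : 0 < a ->
  (forall mu0 : R, 0 < mu0 -> exists x x',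
    \forall mu \near mu0, curve_in (chart_at X (gamma mu0)) setT gamma x x' mu) ->
  exists2 e0 : R, 0 < e0 & uniform_lift a b e0.
Proof.
move=> a0 gC.
pose P nu e := forall c, nu - e < c -> c < nu -> lift_at X s gamma c nu e e^-1.
have [||e e0 H] := @compact_unif R R `[a, b] P (@segment_compact R a b).
- move=> nu e e' H e'0 ee c h1 h2; apply: (lift_at_mono ee); last first.
    by apply: H => //; lra.
  by rewrite lef_pV2 ?posrE//; lra.
- move=> nu0 /itvP_cc[an nb]; have nu00 : 0 < nu0 by lra.
  have [k [s1 [L [k0 s10 L0 H]]]] := lift_local s0 gC nu00.
  pose e := Num.min (Num.min (k / 2) s1) L^-1.
  have e0 : 0 < e by rewrite !lt_min s10 divr_gt0//= invr_gt0.
  have e1 : e <= k / 2 by rewrite !ge_min lexx.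
  have e2 : e <= s1 by rewrite !ge_min lexx orbT.
  have e3 : L <= e^-1.
    by rewrite -[leLHS]invrK lef_pV2 ?posrE ?invr_gt0// ge_min lexx orbT.
  exists e => //; apply: filterS (@near_dist R R^o nu0 e e0) => nu nue _ c h1 h2.
  apply: (lift_at_mono e2 e3); apply: H => //; last lra.
  by move: nue; rewrite !ltr_norml => /andP[j1 j2]; apply/andP; split; lra.
by exists e => // nu c an nb; apply: H; apply/itvP_cc.
Qed.

Lemma lift_facts (a b s1 L : R) : a < b -> lift_at X s gamma a b s1 L ->
  let q := gamma b in let G nu := Log X q (gamma nu) in
  [/\ forall nu, a <= nu -> nu <= b -> interior_set X q (gamma nu) /\ log_set X q (gamma nu) = [set G nu],
      forall nu, a <= nu -> nu <= b -> C1_within `[a, b] G nu,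
      forall nu, a <= nu -> nu <= b -> Exp X q (G nu) = gamma nu,
      forall nu, a <= nu -> nu <= b -> hasd `[a, b] G nu (derive_within `[a, b] G nu) /\
         tnorm X q (derive_within `[a, b] G nu) <= L & G b = 0].
Proof.
move=> ab [[W [W' HW]] _] q G.
have LS nu : a <= nu -> nu <= b -> log_set X q (gamma nu) = [set W nu].
  by move=> an nb; have [h1 <- _ _ _] := HW nu an nb; exact: (log_set_small s0 NR h1).
have GW nu : a <= nu -> nu <= b -> G nu = W nu.
  move=> an nb; have : log_set X q (gamma nu) (W nu) by rewrite LS.
  rewrite /G /Log => h; apply: xget_subset1 => // x y; rewrite LS// => -> ->//.
have nG (nu : R) : \forall t \near nu, `[a, b]%classic t -> W t = G t.
  by apply/(@near_distP R R^o); exists 1 => // t _ /itvP_cc[h1 h2]; rewrite GW.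
have hG nu : a <= nu -> nu <= b -> hasd `[a, b] G nu (W' nu).
  move=> an nb; have [_ _ h _ _] := HW nu an nb.
  by apply: (hasd_near _ (nG nu) h); apply/itvP_cc.
have dG nu : a <= nu -> nu <= b -> derivable_within `[a, b] G nu /\ derive_within `[a, b] G nu = W' nu.
  by move=> an nb; apply: hasd_within (hG nu an nb); exact: itv_proper.
split.
- move=> nu an nb; split; last by rewrite LS// GW.
  by have [h1 <- _ _ _] := HW nu an nb; exact: (interior_small s0 NR h1).
- move=> nu an nb; have [d1 d2] := dG nu an nb; split=> //.
  apply/(@contw_cvg R E); rewrite /contw d2 => e e0.
  have [_ _ _ h _] := HW nu an nb.
  apply: filterS (h e e0) => t k At; have /itvP_cc[t1 t2] := At.
  by have [_ ->] := dG t t1 t2; exact: k.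
- by move=> nu an nb; rewrite GW//; have [_] := HW nu an nb.
- move=> nu an nb; have [_ ->] := dG nu an nb; split; first exact: hG.
  by have [] := HW nu an nb.
- have bb := lexx b; rewrite (GW b (ltW ab) bb).
  have [h1 h2 _ _ _] := HW b (ltW ab) bb.
  have h1' : tnorm X q (W b) < s by have := s0; rewrite /q; lra.
  have [_ _ H] := NR h1'.
  apply: H; first by rewrite tnorm0.
  by rewrite (Exp_zero s0 NR).
Qed.

Lemma piece_error (a b s1 L om eta : R) vL vR : a < b -> lift_at X s gamma a b s1 L ->
  let q := gamma b in let G nu := Log X q (gamma nu) in
  let G' := derive_within `[a, b] G in
  (b - a) * (7 * L + 2) < s1 -> 0 <= L -> om <= 2 * L -> eta <= 1 ->
  (forall t u, a <= t -> t <= b -> a <= u -> u <= b -> tnorm X q (G' t - G' u) <= om) ->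
  tnorm X q (vL - G' a) <= eta -> tnorm X q (vR - G' b) <= eta ->
  forall mu, a <= mu -> mu <= b ->
  (dist X (gamma mu) (Exp X q (hermite a b (G a) (G b) vL vR mu)) <=
    (L * ((b - a) * (3 * om + 2 * eta)))%:E)%E.
Proof.
move=> ab HL q G G' small L0 omL eta1 Hom hL hR mu am mb.
have [_ _ EG dG Gb] := lift_facts ab HL.
have ab0 : 0 < b - a by rewrite subr_gt0.
have err : tnorm X q (G mu - hermite a b (G a) (G b) vL vR mu) <= (b - a) * (3 * om + 2 * eta).
  have hG t : a <= t -> t <= b -> hasd `[a, b] G t (G' t) by move=> h1 h2; have [] := dG t h1 h2.
  exact: (@hermite_error _ _ _ X q G G' a b om eta vL vR mu ab hG Hom hL hR am mb).
have Gmu : tnorm X q (G mu) <= L * (b - a).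
  have h : tnorm X q (G b - G mu) <= L * (b - mu).
    apply: (@tnorm_mean_value_bound _ _ _ X q G G' L mu b mb) => t mt tb.
    have at_ : a <= t by exact: le_trans mt.
    have [h1 h2] := dG t at_ tb; split; last exact: h2.
    apply: hasd_sub h1 => u /itvP_cc[u1 u2]; apply/itvP_cc; split; last exact: u2.
    exact: le_trans u1.
  have Gb' : G b = 0 by exact: Gb.
  rewrite Gb' sub0r tnormN in h; apply: (le_trans h); apply: ler_wpM2l => //.
  by rewrite lerD2l lerN2.
have [Gs Hs] := piece_arith L0 ab0 omL eta1 small Gmu err.
have {}Hs : tnorm X q (hermite a b (G a) (G b) vL vR mu) < s1.
  have -> : hermite a b (G a) (G b) vL vR mu = G mu - (G mu - hermite a b (G a) (G b) vL vR mu).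
    by rewrite subKr.
  exact: le_lt_trans (tnormB _ _ _ _) Hs.
case: HL => _ HL; have := HL _ _ Gs Hs; rewrite EG// => h.
by apply: (le_trans h); rewrite lee_fin ler_wpM2l.
Qed.

End Assembly.

(** * Partitions and the main estimate *)

Section Partition.
Context {R : realType}.
Implicit Types (a b : R) (N : nat) (p : nat -> R).

Lemma partition_mono a b N p : is_partition a b N p ->
  forall i j, (i <= j)%N -> (j <= N)%N -> p i <= p j.
Proof.
move=> [_ _ H] i j ij; elim: j ij => [|j IH]; first by rewrite leqn0 => /eqP ->.
rewrite leq_eqVlt => /orP[/eqP ->//|ij] jN.
by apply: (le_trans (IH ij (ltnW jN))); exact: ltW (H j jN).
Qed.

Lemma partition_range a b N p i : is_partition a b N p -> (i <= N)%N -> a <= p i /\ p i <= b.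
Proof.
move=> P iN; have [p0 pN _] := P.
by rewrite -p0 -pN; split; [exact: partition_mono P _ _ (leq0n i) iN|exact: partition_mono P _ _ iN (leqnn N)].
Qed.

Lemma partition_cover a b N p mu : a < b -> is_partition a b N p -> a <= mu -> mu <= b ->
  let j := find (fun i => mu <= p i.+1) (iota 0 N) in
  [/\ (j < N)%N, p j <= mu & mu <= p j.+1].
Proof.
move=> ab P am mb j; have [p0 pN H] := P.
have N0 : (0 < N)%N.
  by case: (N) p0 pN => // -> pb; move: ab; rewrite pb ltxx.
have hs : has (fun i => mu <= p i.+1) (iota 0 N).
  apply/hasP; exists N.-1; first by rewrite mem_iota add0n ltn_predL.
  by rewrite prednK// pN.
have jN : (j < N)%N by move: hs; rewrite has_find size_iota.
split=> //; last by have := nth_find 0%N hs; rewrite nth_iota.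
case E : j => [|k]; first by rewrite p0.
have kj : (k < j)%N by rewrite E.
have := before_find 0%N kj; rewrite nth_iota ?(ltn_trans kj)// add0n => /negbT.
by rewrite -ltNge => /ltW.
Qed.

(** At an interior node the search stops at the piece on its left. *)
Lemma partition_find a b N p mu i : is_partition a b N p -> (i < N)%N ->
  p i <= mu -> mu <= p i.+1 ->
  let j := find (fun i => mu <= p i.+1) (iota 0 N) in
  j = i \/ [/\ j.+1 = i & mu = p i].
Proof.
move=> P iN pi mi j.
have ji : (j <= i)%N.
  rewrite leqNgt; apply/negP => ij; have := before_find 0%N ij.
  by rewrite nth_iota// add0n mi.
move: ji; rewrite leq_eqVlt => /orP[/eqP|ji]; [by left|right].
have hs : has (fun i => mu <= p i.+1) (iota 0 N).
  by rewrite has_find size_iota (ltn_trans ji).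
have jm : mu <= p j.+1 by have := nth_find 0%N hs; rewrite nth_iota// ?(ltn_trans ji).
have pj : p j.+1 <= p i by apply: (partition_mono P) => //; exact: ltnW.
have mE : mu = p i by apply/eqP; rewrite eq_le pi (le_trans jm pj).
split=> //; apply/eqP; rewrite eqn_leq ji /= leqNgt; apply/negP => j2.
have [_ _ H] := P.
have : p j.+1 < p i.
  apply: (lt_le_trans (H _ (leq_ltn_trans ji iN))).
  by apply: (partition_mono P) => //; exact: ltnW.
by rewrite ltNge -mE jm.
Qed.

Lemma mesh_ge N p i : (i < N)%N -> p i.+1 - p i <= mesh N p.
Proof.
move=> iN; exact: (le_bigmax 0 (fun i : 'I_N => p i.+1 - p i) (Ordinal iN)).
Qed.

Lemma mesh_ge0 N p : 0 <= mesh N p.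
Proof. exact: bigmax_ge_id. Qed.

End Partition.

Lemma error_arith (R : realType) (L om eta h m : R) : 0 < L -> 0 <= om -> 0 <= eta -> h <= m -> 0 <= m ->
  L * (h * (3 * om + 2 * eta)) <= 3 * L * (m * om + eta * m).
Proof.
move=> L0 om0 eta0 hm m0.
have k1 : h * (3 * om + 2 * eta) <= m * (3 * om + 2 * eta).
  by rewrite ler_wpM2r// addr_ge0// mulr_ge0.
have k2 := mulr_ge0 eta0 m0.
rewrite [3 * L]mulrC -mulrA ler_pM2l//; lra.
Qed.

Theorem theorem1 (R : realType) (n : nat) (M : topologicalType)
    (X : riemannian_manifold R n M)
    (M_compact : compact [set: M])
    (f1 f2 : M -> R)
    (f1_C2 : C2_on_manifold X f1) (f2_C2 : C2_on_manifold X f2)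
    (gamma : R -> M)
    (gammaP : forall mu : R, 0 < mu ->
       argmin_set (fun x => f1 x + mu * f2 x) = [set gamma mu])
    (hess_invertible : forall mu : R, 0 < mu ->
       bijective (hessian X (fun x => f1 x + mu * f2 x) (gamma mu)))
    (mu_min mu_max : R) (mu_min_gt0 : 0 < mu_min) (mu_lt : mu_min < mu_max) :
  exists delta eta0 C : R, [/\ 0 < delta, 0 < eta0, 0 < C &
    forall (N : nat) (p : nat -> R),
      is_partition mu_min mu_max N p -> mesh N p <= delta ->
      (* the objects below are well defined *)
      (forall i : nat, (i < N)%N ->
         [/\ gamma @` node_interval p i `<=` interior_set X (base_point gamma p i),
             (forall mu : R, node_interval p i mu ->
                log_set X (base_point gamma p i) (gamma mu)
                  = [set lifted X gamma p i mu]) &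
             (forall mu : R, node_interval p i mu ->
                C1_within (node_interval p i) (lifted X gamma p i) mu)]) /\
      (forall (eta : R) (vL vR : nat -> 'rV[R]_n),
         0 <= eta <= eta0 ->
         (forall i : nat, (i < N)%N ->
            tnorm X (base_point gamma p i)
              (vL i - lifted_velocity X gamma p i (p i)) <= eta /\
            tnorm X (base_point gamma p i)
              (vR i - lifted_velocity X gamma p i (p i.+1)) <= eta) ->
         (forall (i : nat) (mu : R), (i < N)%N -> node_interval p i mu ->
            interpolant X gamma p N vL vR mu
              = interpolant_piece X gamma p vL vR i mu) /\
         (sup_error X gamma mu_min mu_max (interpolant X gamma p N vL vR)
            <= C%:E * ((mesh N p)%:E * velocity_modulus X gamma p N (mesh N p)
                       + (eta * mesh N p)%:E))%E) /\
      (* exact endpoint velocities *)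
      (sup_error X gamma mu_min mu_max
         (interpolant X gamma p N
            (fun i => lifted_velocity X gamma p i (p i))
            (fun i => lifted_velocity X gamma p i (p i.+1)))
         <= C%:E * ((mesh N p)%:E * velocity_modulus X gamma p N (mesh N p)))%E].
Proof.
have [s s0 NR] := normal_radius_unif X M_compact.
have hess_inj mu : 0 < mu -> injective (hessian X (fun x => f1 x + mu * f2 x) (gamma mu)).
  by move=> mu0; exact: bij_inj (hess_invertible mu mu0).
have gC mu0 (mu00 : 0 < mu0) := gamma_curve f1_C2 f2_C2 M_compact gammaP hess_inj mu00.
have [e0 e00 HU] := lift_uniform s0 mu_max mu_min_gt0 gC.
pose L := e0^-1; have L0 : 0 < L by rewrite invr_gt0.
have B0 : 0 < 2 * (7 * L + 2) by rewrite mulr_gt0// addr_gt0// mulr_gt0.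
(* The first bound gives access to [lift_at]; the second one keeps the
   interpolant in the ball where [Exp] is Lipschitz. *)
pose delta := Num.min (e0 / 2) (e0 / (2 * (7 * L + 2))).
have delta0 : 0 < delta by rewrite lt_min !divr_gt0.
have delta1 : delta < e0.
  have : delta <= e0 / 2 by rewrite ge_min lexx.
  lra.
have delta2 h : h <= delta -> h * (7 * L + 2) < e0.
  move=> hd; have : h <= e0 / (2 * (7 * L + 2)) by rewrite (le_trans hd)// ge_min lexx orbT.
  rewrite ler_pdivlMr//; lra.
exists delta, 1, (3 * L); split=> //; first by rewrite mulr_gt0.
move=> N p P hm.
have HL i : (i < N)%N -> p i < p i.+1 /\ lift_at X s gamma (p i) (p i.+1) e0 L.
  move=> iN; have [_ _ H] := P; have pi := H i iN; split=> //.
  have [r1 r2] := partition_range P iN.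
  apply: HU => //; have := mesh_ge p iN; lra.
have LF i : (i < N)%N -> _ := fun iN => lift_facts s0 NR (HL i iN).1 (HL i iN).2.
have core (eta : R) (vL vR : nat -> 'rV[R]_n) : 0 <= eta <= 1 ->
   (forall i : nat, (i < N)%N ->
            tnorm X (base_point gamma p i)
              (vL i - lifted_velocity X gamma p i (p i)) <= eta /\
            tnorm X (base_point gamma p i)
              (vR i - lifted_velocity X gamma p i (p i.+1)) <= eta) ->
   (forall (i : nat) (mu : R), (i < N)%N -> node_interval p i mu ->
            interpolant X gamma p N vL vR mu
              = interpolant_piece X gamma p vL vR i mu) /\
         (sup_error X gamma mu_min mu_max (interpolant X gamma p N vL vR)
            <= (3 * L)%:E * ((mesh N p)%:E * velocity_modulus X gamma p N (mesh N p)
                       + (eta * mesh N p)%:E))%E.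
  move=> /andP[eta0 eta1] Hv.
  pose om_i (i : 'I_N) := ereal_sup [set e | exists mu nu : R,
    [/\ node_interval p i mu, node_interval p i nu, `|mu - nu| <= mesh N p &
        e = (tnorm X (base_point gamma p i)
               (lifted_velocity X gamma p i mu - lifted_velocity X gamma p i nu))%:E]].
  have Om2 : (velocity_modulus X gamma p N (mesh N p) <= (2 * L)%:E)%E.
    apply: bigmax_le => [|i _]; first exact: leNye.
    apply: ge_ereal_sup => _ [mu [nu [/itvP_cc[m1 m2] /itvP_cc[n1 n2] _ ->]]].
    rewrite lee_fin; have [_ _ _ dG _] := LF i (ltn_ord i).
    have [_ k1] := dG mu m1 m2; have [_ k2] := dG nu n1 n2.
    apply: (le_trans (tnormB _ _ _ _)); rewrite mulrDl mul1r; exact: lerD k1 k2.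
  have OmP (i : nat) (iN : (i < N)%N) mu nu : p i <= mu -> mu <= p i.+1 -> p i <= nu -> nu <= p i.+1 ->
    ((tnorm X (base_point gamma p i)
       (lifted_velocity X gamma p i mu - lifted_velocity X gamma p i nu))%:E
     <= velocity_modulus X gamma p N (mesh N p))%E.
    move=> m1 m2 n1 n2; apply: le_trans (le_bigmax -oo%E om_i (Ordinal iN)).
    apply: ereal_sup_ubound; exists mu, nu; split=> //; try by apply/itvP_cc.
    rewrite (le_trans _ (mesh_ge p iN))// ler_norml; apply/andP; split; lra.
  have [j0N _ _] := partition_cover mu_lt P (lexx _) (ltW mu_lt).
  set j0 := find _ _ in j0N.
  (* There is at least one interval, and the velocities are bounded, so the
     modulus is a real number. *)
  have [om omE] : exists om : R, velocity_modulus X gamma p N (mesh N p) = om%:E.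
    have [pj _] := HL j0 j0N.
    have := OmP j0 j0N (p j0) (p j0) (lexx _) (ltW pj) (lexx _) (ltW pj).
    move: Om2; case: (velocity_modulus _ _ _ _ _) => [om _ _||//]; first by exists om.
    by rewrite leye_eq.
  rewrite omE in Om2 OmP *; rewrite lee_fin in Om2.
  have om0 : 0 <= om.
    have [pj _] := HL j0 j0N.
    have := OmP j0 j0N (p j0) (p j0) (lexx _) (ltW pj) (lexx _) (ltW pj).
    rewrite lee_fin; apply: le_trans; exact: tnorm_ge0.
  have pieceL i : (i < N)%N -> interpolant_piece X gamma p vL vR i (p i) = gamma (p i).
    move=> iN; have [pi _] := HL i iN; have [_ _ EG _ _] := LF i iN.
    rewrite /interpolant_piece hermite_l; exact: EG (lexx _) (ltW pi).
  have pieceR i : (i < N)%N -> interpolant_piece X gamma p vL vR i (p i.+1) = gamma (p i.+1).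
    move=> iN; have [pi _] := HL i iN; have [_ _ EG _ _] := LF i iN.
    rewrite /interpolant_piece hermite_r//; exact: EG (ltW pi) (lexx _).
  have con (i : nat) (mu : R) : (i < N)%N -> node_interval p i mu ->
     interpolant X gamma p N vL vR mu = interpolant_piece X gamma p vL vR i mu.
    move=> iN /itvP_cc[pi mi]; rewrite /interpolant /concatenation.
    have [->//|[E1 Em]] := partition_find P iN pi mi.
    set j := find _ _ in E1 *.
    have jN : (j < N)%N by rewrite -E1 in iN; exact: ltnW.
    by rewrite Em pieceL// -E1 pieceR.
  split; first exact: con.
  rewrite -(EFinM (mesh N p) om) -EFinD -EFinM; apply: ge_ereal_sup => _ [mu /itvP_cc[m1 m2] <-].
  have [iN pi mi] := partition_cover mu_lt P m1 m2.
  set i := find _ _ in iN pi mi.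
  rewrite (con i mu iN); last by apply/itvP_cc.
  have [pp HLi] := HL i iN; have [v1 v2] := Hv i iN.
  have hi := mesh_ge p iN.
  have small := delta2 _ (le_trans hi hm).
  apply: (le_trans (piece_error s0 NR pp HLi small (ltW L0) Om2 eta1 _ v1 v2 pi mi)).
    by move=> t u t1 t2 u1 u2; rewrite -lee_fin; exact: (OmP i iN).
  rewrite lee_fin.
  exact: error_arith L0 om0 eta0 hi (mesh_ge0 N p).
split; last split.
- move=> i iN; have [pp _] := HL i iN; have [h1 h2 _ _ _] := LF i iN; split.
  + by move=> _ [mu /itvP_cc[m1 m2] <-]; have [] := h1 mu m1 m2.
  + by move=> mu /itvP_cc[m1 m2]; have [] := h1 mu m1 m2.
  + by move=> mu /itvP_cc[m1 m2]; exact: h2.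
- exact: core.
- have := core 0 (fun i => lifted_velocity X gamma p i (p i)) (fun i => lifted_velocity X gamma p i (p i.+1)).
  rewrite mul0r adde0; case => //; first by rewrite lexx ler01.
  by move=> i iN; rewrite !subrr tnorm0.
Qed.
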